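(* For every value of $\alpha\in(0,\pi)$ for which the unit circle $(\cos t,\sin t)$ admits a non-trivial infinitesimal self-Bäcklund deformation (i.e. $\alpha$ is a solution of $\tan(k\alpha)=k\tan\alpha$ for some integer $k\ge3$, where $\alpha=\pi/2$ is counted as a solution for $k$ odd) there is a genuine analytic self-Bäcklund deformation realizing it, that is, an analytic self-Bäcklund deformation of the unit circle whose rotation number at deformation parameter $\varepsilon=0$ is $\alpha$ and whose associated infinitesimal deformation is non-trivial.
   Context: For $u,v\in\mathbb{R}^2$, $[u,v]$ denotes the determinant of the matrix with columns $u,v$. A centroaffine curve is a smooth curve $\gamma:\mathbb{R}\to\mathbb{R}^2$ with $[\gamma,\gamma']=1$; it is $\pi$-anti-periodic if $\gamma(t+\pi)=-\gamma(t)$. It is self-Bäcklund with rotation number $\alpha\in(0,\pi)$ if $[\gamma(t),\gamma(t+\alpha)]=c$ for all $t$, for some constant $c\neq0$. A (self-Bäcklund) deformation of such a curve is a function $\tilde\gamma(t,\varepsilon)$ on $\mathbb{R}\times(-\varepsilon_0,\varepsilon_0)$, $\varepsilon_0>0$, together with functions $\tilde\alpha(\varepsilon),\tilde c(\varepsilon)$, such that for each $\varepsilon$ the curve $\tilde\gamma(\cdot,\varepsilon)$ is $\pi$-anti-periodic, $[\tilde\gamma,\partial_t\tilde\gamma]=1$, $[\tilde\gamma(t,\varepsilon),\tilde\gamma(t+\tilde\alpha(\varepsilon),\varepsilon)]=\tilde c(\varepsilon)$ for all $t$, and $\tilde\gamma(\cdot,0)=\gamma$, $\tilde\alpha(0)=\alpha$,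 $\tilde c(0)=c$; it is analytic if it depends analytically on $\varepsilon$. An infinitesimal deformation is an expression $\gamma+\varepsilon\gamma_1$ satisfying these conditions modulo $\varepsilon^2$, for some $\alpha+\varepsilon\alpha_1$, $c+\varepsilon c_1$; the one associated with $\tilde\gamma$ is $\gamma+\varepsilon\,\partial_\varepsilon\tilde\gamma|_{\varepsilon=0}$. It is trivial if induced by a shift of the argument, $\gamma(t+a\varepsilon)$, or by $e^{\varepsilon A}\gamma(t)$ with $A\in\mathfrak{sl}_2(\mathbb{R})$ (modulo $\varepsilon^2$). *)

(* Defs.v *)
From Stdlib Require Import Reals Factorial.
From Coquelicot Require Import Coquelicot.
Open Scope R_scope.

Definition vec : Type := R * R.

Definition curve : Type := R -> vec.

Definition vadd (u v : vec) : vec := (fst u + fst v, snd u + snd v).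
Definition vscal (a : R) (u : vec) : vec := (a * fst u, a * snd u).

(* The determinant of the matrix with columns u and v. *)
Definition bracket (u v : vec) : R := fst u * snd v - snd u * fst v.

Definition smooth (g : curve) : Prop :=
  forall (n : nat) (t : R),
    ex_derive_n (fun s => fst (g s)) n t /\ ex_derive_n (fun s => snd (g s)) n t.

Definition velocity (g : curve) : curve :=
  fun t => (Derive (fun s => fst (g s)) t, Derive (fun s => snd (g s)) t).

Definition centroaffine (g : curve) : Prop :=
  smooth g /\ forall t, bracket (g t) (velocity g t) = 1.

Definition anti_periodic (g : curve) : Prop :=
  forall t, g (t + PI) = vscal (-1) (g t).

Definition self_backlund (g : curve) (alpha c : R) : Prop :=
  centroaffine g /\ anti_periodic g /\ 0 < alpha < PI /\ c <> 0 /\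
  forall t, bracket (g t) (g (t + alpha)) = c.

Definition unit_circle : curve := fun t => (cos t, sin t).

(* gam t e is the deformed curve with parameter e at time t; only the values of
   gam, alphat, ct with |e| < eps0 are constrained. *)
Definition deformation (g : curve) (alpha c eps0 : R)
    (gam : R -> R -> vec) (alphat ct : R -> R) : Prop :=
  self_backlund g alpha c /\ 0 < eps0 /\
  (forall e, Rabs e < eps0 ->
     centroaffine (fun t => gam t e) /\
     anti_periodic (fun t => gam t e) /\
     forall t, bracket (gam t e) (gam (t + alphat e) e) = ct e) /\
  (forall t, gam t 0 = g t) /\ alphat 0 = alpha /\ ct 0 = c.

Definition analytic_on (eps0 : R) (f : R -> R) : Prop :=
  forall e0, Rabs e0 < eps0 ->
  exists r : R, 0 < r /\
  exists a : nat -> R,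
    forall e, Rabs (e - e0) < r -> is_pseries a (e - e0) (f e).

(* Analytic dependence of the whole curve on e: around each e0 the expansion in
   powers of e - e0, with coefficients depending on t, is valid on a
   neighbourhood of e0 that does not depend on t. *)
Definition analytic_family_on (eps0 : R) (gam : R -> R -> vec) : Prop :=
  forall e0, Rabs e0 < eps0 ->
  exists r : R, 0 < r /\
  exists a b : R -> nat -> R,
    forall t e, Rabs (e - e0) < r ->
      is_pseries (a t) (e - e0) (fst (gam t e)) /\
      is_pseries (b t) (e - e0) (snd (gam t e)).

Definition analytic_deformation (g : curve) (alpha c eps0 : R)
    (gam : R -> R -> vec) (alphat ct : R -> R) : Prop :=
  deformation g alpha c eps0 gam alphat ct /\
  analytic_family_on eps0 gam /\ analytic_on eps0 alphat /\ analytic_on eps0 ct.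

(* Equality modulo e^2, that is, up to O(e^2) as e -> 0. *)
Definition eq_mod_eps2 (f h : R -> R) : Prop :=
  exists K delta : R, 0 < delta /\
    forall e, Rabs e < delta -> Rabs (f e - h e) <= K * e ^ 2.

Definition veq_mod_eps2 (f h : R -> vec) : Prop :=
  eq_mod_eps2 (fun e => fst (f e)) (fun e => fst (h e)) /\
  eq_mod_eps2 (fun e => snd (f e)) (fun e => snd (h e)).

Definition first_order (g g1 : curve) (e : R) : curve :=
  fun t => vadd (g t) (vscal e (g1 t)).

(* g1 stands for the infinitesimal deformation g + e g1. *)
Definition infinitesimal_deformation (g : curve) (alpha c : R) (g1 : curve) : Prop :=
  self_backlund g alpha c /\ smooth g1 /\
  exists alpha1 c1 : R,
    forall t,
      veq_mod_eps2 (fun e => first_order g g1 e (t + PI))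
                   (fun e => vscal (-1) (first_order g g1 e t)) /\
      eq_mod_eps2 (fun e => bracket (first_order g g1 e t)
                                    (velocity (first_order g g1 e) t))
                  (fun _ => 1) /\
      eq_mod_eps2 (fun e => bracket (first_order g g1 e t)
                                    (first_order g g1 e (t + (alpha + e * alpha1))))
                  (fun e => c + e * c1).

Record mat2 : Type := Mat2 { m00 : R; m01 : R; m10 : R; m11 : R }.

Definition mact (A : mat2) (v : vec) : vec :=
  (m00 A * fst v + m01 A * snd v, m10 A * fst v + m11 A * snd v).

Definition in_sl2 (A : mat2) : Prop := m00 A + m11 A = 0.

(* exp_act e A v is exp (e A) v, i.e. the sum over n of e^n / n! A^n v. *)
Definition exp_act (e : R) (A : mat2) (v : vec) : vec :=
  (Series (fun n => e ^ n / INR (fact n) * fst (Nat.iter n (mact A) v)),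
   Series (fun n => e ^ n / INR (fact n) * snd (Nat.iter n (mact A) v))).

Definition trivial_infinitesimal (g g1 : curve) : Prop :=
  (exists a : R, forall t,
     veq_mod_eps2 (fun e => first_order g g1 e t) (fun e => g (t + a * e))) \/
  (exists A : mat2, in_sl2 A /\ forall t,
     veq_mod_eps2 (fun e => first_order g g1 e t) (fun e => exp_act e A (g t))).

Definition nontrivial_infinitesimal_deformation
    (g : curve) (alpha c : R) (g1 : curve) : Prop :=
  infinitesimal_deformation g alpha c g1 /\ ~ trivial_infinitesimal g g1.

Definition admits_nontrivial_infinitesimal (g : curve) (alpha : R) : Prop :=
  exists (c : R) (g1 : curve), nontrivial_infinitesimal_deformation g alpha c g1.

Definition associated_infinitesimal (gam : R -> R -> vec) : curve :=
  fun t => (Derive (fun e => fst (gam t e)) 0, Derive (fun e => snd (gam t e)) 0).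

(* tan (k alpha) = k tan alpha.  The cosines are required to be nonzero because
   tan is a total function; alpha = PI/2, where both sides are infinite for odd
   k, counts as a solution exactly for odd k. *)
Definition tan_equation (k : nat) (alpha : R) : Prop :=
  (cos alpha <> 0 /\ cos (INR k * alpha) <> 0 /\
   tan (INR k * alpha) = INR k * tan alpha) \/
  (alpha = PI / 2 /\ Nat.Odd k).

(* Main.v *)
Require Import Defs.
From Stdlib Require Import Reals Lra Lia ZArith Classical ClassicalEpsilon FunctionalExtensionality.
From Coquelicot Require Import Coquelicot.
Open Scope R_scope.

(** Write g(t) = (cos t, sin t). A first-order deformation g1 of g that keeps
    [g, g'] = 1 is v g' - (v'/2) g for a function v of period PI, and the
    condition on [g(t), g(t + alpha)] becomes a linear difference equation for v.
    On the Fourier mode cos(2 k t) of v it reads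
    sin(k alpha) cos alpha = k cos(k alpha) sin alpha, which always holds for k = 0
    and k = 1, the modes of the sl_2-deformations, never for k = 2, and is the
    equation tan(k alpha) = k tan alpha for k >= 3. So if no k >= 3 solves the
    equation, v has only the modes 0 and 1, by completeness of the trigonometric
    system (low_frequency), and the deformation is trivial (exists_mode).

    Conversely, let k >= 3 be a solution. The deformation is written down with
    theta functions of nome q, the deformation parameter: up to a constant factor
    the curve gamma is, as a complex-valued function,

      e^(i t) theta_3(k t + i s) / theta_4(k t).

    A product of two theta functions of nome q, at u and v, is a combination of
    theta_3 and theta_2 of nome q^2 at u + v, with coefficients depending on
    u - v (zsum_product). Hence numerator and denominator of
    [gamma(t), gamma(t + d)] both lie, for fixed d, in a two-dimensional space of
    functions of t, and the bracket is constant in t as soon as two pairs of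
    coefficients are proportional. A third product identity (UV_relation) turns
    this into one scalar equation, Gf d = 0, that is, Im(e^(i d) theta_2(k d + i s)) = 0. It holds for d = 0, and
    its derivative there, Gd = 0, is the condition for the Wronskian
    [gamma, gamma'] to be constant (theta_curve_centroaffine,
    theta_curve_bracket).

    So s is determined by Gd = 0 and the rotation number alpha by Gf alpha = 0.
    At q = 0 these say tanh s = 1/k and sin(k alpha) cos alpha =
    k cos(k alpha) sin alpha, both with non-zero derivative in the unknown, and
    the analytic implicit function theorem (implicit_function) gives s and alpha
    as analytic functions of q; the constant factor that normalises the Wronskian
    is found in the same way (family_exists). Analyticity is handled in the algebra
    of power series with summable weighted coefficients: it is closed under
    countable sums (PS_series), its norm bounds do not depend on t, and the
    implicit function theorem is a contraction argument in it. The derivative at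
    q = 0 is the mode k of the first paragraph (associated_theta), which is not
    trivial (mode_nontrivial). *)

(** * Rearrangement of series *)

(* Equalities of reals are often typed over a normed-module carrier, which hides
   them from ring. *)
Ltac rring :=
  repeat match goal with |- context [@plus ?G ?a ?b] =>
    change (@plus G a b) with (Rplus a b) end;
  match goal with |- ?a = ?b => change (@eq R a b) end; ring.

Lemma sum_n_le_series (b : nat -> R) (N : nat) :
  (forall n, 0 <= b n) -> ex_series b -> sum_n b N <= Series b.
Proof.
intros Hb Hs. rewrite (Series_incr_n b (S N)) by (lia || auto).
simpl pred. rewrite <- sum_n_Reals.
assert (0 <= Series (fun k => b (S N + k)%nat)); [|lra].
replace 0 with (Series (fun _ : nat => 0)).
- apply Series_le. intros n; split; [lra|apply Hb].
  apply (ex_series_incr_n b (S N)), Hs.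
- apply is_series_unique. apply filterlim_ext with (fun _ : nat => 0).
  intros n; rewrite sum_n_const; ring. apply filterlim_const.
Qed.

Lemma ex_series_of_bounded_sums (b : nat -> R) (B : R) :
  (forall n, 0 <= b n) -> (forall N, sum_n b N <= B) -> ex_series b.
Proof.
intros Hb HB. destruct (ex_finite_lim_seq_incr (sum_n b) B) as [l Hl].
- intros n. rewrite sum_Sn. unfold plus; simpl. specialize (Hb (S n)); lra.
- exact HB.
- exists l. exact Hl.
Qed.

Lemma series_le_of_sums (b : nat -> R) (B : R) :
  ex_series b -> (forall N, sum_n b N <= B) -> Series b <= B.
Proof.
intros Hs HB.
assert (H : Rbar_le (Series b) B); [|exact H].
apply (is_lim_seq_le (sum_n b) (fun _ => B) (Series b) B HB).
- apply (Series_correct b Hs).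
- apply is_lim_seq_const.
Qed.

Lemma sum_n_single (c : R) N : sum_n (fun n => match n with O => c | _ => 0 end) N = c.
Proof.
induction N as [|N IH]. now rewrite sum_O.
rewrite sum_Sn, IH. unfold plus; simpl; ring.
Qed.

Lemma ex_series_dominated (a b : nat -> R) :
  (forall n, Rabs (a n) <= b n) -> ex_series b -> ex_series a.
Proof. intros H Hb. apply (ex_series_le (V := R_CompleteNormedModule) a b H Hb). Qed.

Lemma series_abs_le (a b : nat -> R) :
  (forall n, Rabs (a n) <= b n) -> ex_series b -> Rabs (Series a) <= Series b.
Proof.
intros H Hb.
assert (Ha : ex_series (fun n => Rabs (a n))).
{ apply ex_series_dominated with b; auto. intros n; rewrite Rabs_Rabsolu; auto. }
eapply Rle_trans; [apply Series_Rabs, Ha|].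
apply Series_le; auto. intros n; split; [apply Rabs_pos|auto].
Qed.

(** Dominated convergence for series: cut the sum where the tail of the
    dominating series is small, and use termwise convergence on the finite
    part. *)
Lemma tannery (u : nat -> nat -> R) (v B : nat -> R) :
  (forall N i, Rabs (u N i) <= B i) -> ex_series B ->
  (forall i, is_lim_seq (fun N => u N i) (v i)) ->
  is_lim_seq (fun N => Series (u N)) (Series v).
Proof.
intros Hu HB Hlim.
assert (HB0 : forall i, 0 <= B i).
{ intros i. apply Rle_trans with (2 := Hu 0%nat i), Rabs_pos. }
assert (Hv : forall i, Rabs (v i) <= B i).
{ intros i. assert (H : Rbar_le (Rabs (v i)) (B i)); [|exact H].
  apply (is_lim_seq_le (fun N => Rabs (u N i)) (fun _ => B i)).
  - auto.
  - apply (is_lim_seq_abs _ (v i)), Hlim.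
  - apply is_lim_seq_const. }
assert (eu : forall N, ex_series (u N)) by (intros N; apply ex_series_dominated with B; auto).
assert (ev : ex_series v) by (apply ex_series_dominated with B; auto).
assert (HD : forall I N, Rabs (Series (u N) - Series v) <=
   sum_n (fun i => Rabs (u N i - v i)) I + 2 * (Series B - sum_n B I)).
{ intros I N. rewrite <- Series_minus by auto.
  assert (Hd : forall i, Rabs (u N i - v i) <= 2 * B i).
  { intros i. specialize (Hu N i); specialize (Hv i).
    unfold Rminus. eapply Rle_trans; [apply Rabs_triang|rewrite Rabs_Ropp; lra]. }
  assert (e2 : ex_series (fun i => 2 * B i)) by (apply (ex_series_scal_l 2 B), HB).
  assert (ed : ex_series (fun i => Rabs (u N i - v i))).
  { apply ex_series_dominated with (2 := e2). intros i. rewrite Rabs_Rabsolu; auto. }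
  eapply Rle_trans; [apply Series_Rabs, ed|].
  rewrite (Series_incr_n _ (S I)) by (lia || auto).
  rewrite (Series_incr_n B (S I)) by (lia || auto).
  simpl pred. rewrite <- !sum_n_Reals.
  apply Rplus_le_compat_l.
  ring_simplify (sum_n B I + Series (fun k : nat => B (S I + k)%nat) - sum_n B I).
  rewrite <- Series_scal_l.
  apply Series_le. intros n; split; [apply Rabs_pos|apply Hd].
  apply (ex_series_incr_n (fun i => 2 * B i) (S I)), e2. }
apply is_lim_seq_spec. intros eps.
assert (Htail : is_lim_seq (fun I => sum_n B I) (Series B)) by apply (Series_correct B HB).
apply is_lim_seq_spec in Htail.
assert (He : 0 < eps / 4) by (generalize (cond_pos eps); lra).
destruct (Htail (mkposreal _ He)) as [I HI]. specialize (HI I (le_n _)). simpl in HI.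
assert (Hfin : is_lim_seq (fun N => sum_n (fun i => Rabs (u N i - v i)) I) 0).
{ clear HI. assert (Ht : forall i, is_lim_seq (fun N => Rabs (u N i - v i)) 0).
  { intros i. rewrite <- Rabs_R0. apply (is_lim_seq_abs _ 0).
    replace (Finite 0) with (Finite (v i - v i)) by (f_equal; ring).
    apply is_lim_seq_minus'; [apply Hlim|apply is_lim_seq_const]. }
  induction I as [|I IH].
  - apply is_lim_seq_ext with (2 := Ht 0%nat). intros N. now rewrite sum_O.
  - apply is_lim_seq_ext with (fun N => sum_n (fun i => Rabs (u N i - v i)) I + Rabs (u N (S I) - v (S I))).
    intros N. now rewrite sum_Sn.
    replace (Finite 0) with (Finite (0 + 0)) by (f_equal; ring).
    apply is_lim_seq_plus'; auto. }
apply is_lim_seq_spec in Hfin. destruct (Hfin (mkposreal _ He)) as [N0 HN0]. simpl in HN0.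
exists N0. intros N HN. specialize (HN0 N HN). specialize (HD I N).
apply Rabs_lt_between in HN0. apply Rabs_lt_between in HI. lra.
Qed.

Lemma sum_n_abs_le (a : nat -> R) N : Rabs (sum_n a N) <= sum_n (fun n => Rabs (a n)) N.
Proof.
induction N as [|N IH]. rewrite !sum_O; lra.
rewrite !sum_Sn. unfold plus; simpl. eapply Rle_trans; [apply Rabs_triang|lra].
Qed.

Lemma sum_n_series_swap (a : nat -> nat -> R) N :
  (forall n, ex_series (fun i => a i n)) ->
  ex_series (fun i => sum_n (a i) N) /\
  sum_n (fun n => Series (fun i => a i n)) N = Series (fun i => sum_n (a i) N).
Proof.
intros H. induction N as [|N [IH1 IH2]].
- split. apply ex_series_ext with (2 := H 0%nat). intros n; now rewrite sum_O.
  rewrite sum_O. apply Series_ext. intros n; now rewrite sum_O.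
- assert (E : forall i, sum_n (a i) N + a i (S N) = sum_n (a i) (S N)).
  { intros i; now rewrite sum_Sn. }
  split.
  + apply ex_series_ext with (1 := E). apply (ex_series_plus (V := R_NormedModule)); auto.
  + rewrite sum_Sn, IH2. unfold plus; simpl. rewrite <- Series_plus by auto.
    apply Series_ext, E.
Qed.

(** Rows are bounded in l^1 by B, and B is summable. The partial sums over n are
    finite sums of columns, so the interchange is dominated convergence for the
    partial sums of the rows. *)
Lemma fubini_series (a : nat -> nat -> R) (B : nat -> R) :
  (forall i N, sum_n (fun n => Rabs (a i n)) N <= B i) -> ex_series B ->
  (forall n, ex_series (fun i => Rabs (a i n))) /\
  (forall N, sum_n (fun n => Rabs (Series (fun i => a i n))) N <= Series B) /\
  is_series (fun n => Series (fun i => a i n)) (Series (fun i => Series (a i))).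
Proof.
intros Ha HB.
assert (H1 : forall i n, Rabs (a i n) <= B i).
{ intros i n. eapply Rle_trans; [|apply (Ha i n)].
  destruct n as [|n]. rewrite sum_O; lra.
  rewrite sum_Sn. unfold plus; simpl.
  assert (0 <= sum_n (fun n => Rabs (a i n)) n); [|lra].
  eapply Rle_trans; [apply Rabs_pos|apply sum_n_abs_le]. }
assert (E1 : forall n, ex_series (fun i => Rabs (a i n))).
{ intros n. apply ex_series_dominated with B; auto. intros i. rewrite Rabs_Rabsolu; auto. }
split; [exact E1|split].
- intros N.
  destruct (sum_n_series_swap (fun i n => Rabs (a i n)) N E1) as [E2 E3].
  apply Rle_trans with (sum_n (fun n => Series (fun i => Rabs (a i n))) N).
  + apply sum_n_m_le. intros n. apply Series_Rabs, E1.
  + rewrite E3. apply Series_le; auto. intros i; split; auto.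
    eapply Rle_trans; [apply Rabs_pos|apply sum_n_abs_le].
- assert (E0 : forall n, ex_series (fun i => a i n)).
  { intros n. apply ex_series_Rabs, E1. }
  change (is_lim_seq (sum_n (fun n => Series (fun i => a i n)))
    (Series (fun i => Series (a i)))).
  apply is_lim_seq_ext with (fun N => Series (fun i => sum_n (a i) N)).
  + intros N. symmetry. apply (sum_n_series_swap a N E0).
  + apply tannery with B; auto.
    * intros N i. eapply Rle_trans; [apply sum_n_abs_le|apply Ha].
    * intros i. apply (Series_correct (a i)). apply ex_series_Rabs.
      apply ex_series_of_bounded_sums with (B i); auto. intros; apply Rabs_pos.
Qed.

(** * The algebra of absolutely convergent power series *)

(** The ball of radius B in the Banach algebra of power series whose
    coefficients are summable with weights r^n, as a predicate on the sum
    function on [-r, r]. Only norm bounds are tracked, never the coefficients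
    themselves, so a family is uniformly analytic in a further variable as soon
    as its members share B. *)
Definition PS (r B : R) (f : R -> R) : Prop :=
  exists a : nat -> R,
    (forall N, sum_n (fun n => Rabs (a n) * r ^ n) N <= B) /\
    forall p, Rabs p <= r -> is_series (fun n => a n * p ^ n) (f p).

Lemma PS_ext r B f g :
  (forall p, Rabs p <= r -> f p = g p) -> PS r B f -> PS r B g.
Proof.
intros E [a [H1 H2]]. exists a; split; auto. intros p Hp; rewrite <- E; auto.
Qed.

Lemma PS_mono r B B' f : B <= B' -> PS r B f -> PS r B' f.
Proof.
intros E [a [H1 H2]]. exists a; split; auto. intros N; specialize (H1 N); lra.
Qed.

Lemma PS_radius r r' B f : 0 <= r' <= r -> PS r B f -> PS r' B f.
Proof.
intros E [a [H1 H2]]. exists a; split.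
- intros N. eapply Rle_trans; [|apply (H1 N)]. apply sum_n_m_le. intros n.
  apply Rmult_le_compat_l; [apply Rabs_pos|]. apply pow_incr; lra.
- intros p Hp; apply H2; lra.
Qed.

Lemma pow_abs_le p r n : Rabs p <= r -> Rabs (p ^ n) <= r ^ n.
Proof. intros H. rewrite <- RPow_abs. apply pow_incr. split; [apply Rabs_pos|auto]. Qed.

Lemma PS_abs r B f p : PS r B f -> Rabs p <= r -> Rabs (f p) <= B.
Proof.
intros [a [H1 H2]] Hp. rewrite <- (is_series_unique _ _ (H2 p Hp)).
assert (0 <= r) by (apply Rle_trans with (2 := Hp), Rabs_pos).
assert (Hpos : forall n, 0 <= Rabs (a n) * r ^ n).
{ intros n. apply Rmult_le_pos; [apply Rabs_pos|now apply pow_le]. }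
assert (Hs : ex_series (fun n => Rabs (a n) * r ^ n)).
{ now apply ex_series_of_bounded_sums with B. }
eapply Rle_trans; [apply series_abs_le with (2 := Hs)|].
- intros n. rewrite Rabs_mult. apply Rmult_le_compat_l; [apply Rabs_pos|].
  now apply pow_abs_le.
- now apply series_le_of_sums.
Qed.

Lemma PS_bound_nonneg r B f : 0 <= r -> PS r B f -> 0 <= B.
Proof.
intros Hr H. apply Rle_trans with (Rabs (f 0)); [apply Rabs_pos|].
apply PS_abs with (1 := H). rewrite Rabs_R0; auto.
Qed.

(** Closure under countable sums, the source of all other closure properties:
    products, powers, compositions and recentring are countable sums of terms
    already known to lie in the algebra. *)
Lemma PS_series r (B : nat -> R) (f : nat -> R -> R) :
  0 <= r -> (forall i, PS r (B i) (f i)) -> ex_series B ->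
  PS r (Series B) (fun p => Series (fun i => f i p)).
Proof.
intros Hr Hf HB.
set (a := fun i => proj1_sig (constructive_indefinite_description _ (Hf i))).
assert (Ha : forall i, (forall N, sum_n (fun n => Rabs (a i n) * r ^ n) N <= B i) /\
    forall p, Rabs p <= r -> is_series (fun n => a i n * p ^ n) (f i p)).
{ intros i. apply (proj2_sig (constructive_indefinite_description _ (Hf i))). }
exists (fun n => Series (fun i => a i n)). split.
- intros N.
  destruct (fubini_series (fun i n => a i n * r ^ n) B) as [_ [H2 _]]; auto.
  + intros i M. eapply Rle_trans; [|apply (proj1 (Ha i) M)].
    apply sum_n_m_le. intros n. rewrite Rabs_mult, (Rabs_pos_eq (r ^ n)).
    lra. now apply pow_le.
  + eapply Rle_trans; [|apply (H2 N)]. apply sum_n_m_le. intros n.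
    rewrite Series_scal_r, Rabs_mult, (Rabs_pos_eq (r ^ n)).
    lra. now apply pow_le.
- intros p Hp.
  destruct (fubini_series (fun i n => a i n * p ^ n) B) as [_ [_ H3]]; auto.
  + intros i M. eapply Rle_trans; [|apply (proj1 (Ha i) M)].
    apply sum_n_m_le. intros n. rewrite Rabs_mult.
    apply Rmult_le_compat_l; [apply Rabs_pos|]. now apply pow_abs_le.
  + replace (Series (fun i => f i p)) with (Series (fun i => Series (fun n => a i n * p ^ n))).
    * apply is_series_ext with (2 := H3). intros n. now rewrite Series_scal_r.
    * apply Series_ext. intros i. apply is_series_unique, Ha, Hp.
Qed.

Lemma PS_const r c : PS r (Rabs c) (fun _ => c).
Proof.
exists (fun n => match n with O => c | _ => 0 end). split.
- intros N. rewrite <- (sum_n_single (Rabs c) N). apply sum_n_m_le.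
  intros [|n]; simpl. lra. rewrite Rabs_R0; lra.
- intros p _. apply filterlim_ext with (fun _ : nat => c).
  + intros N. rewrite <- (sum_n_single c N) at 1. apply sum_n_ext.
    intros [|n]; simpl; ring.
  + apply filterlim_const.
Qed.

Lemma PS_scal r B c f : PS r B f -> PS r (Rabs c * B) (fun p => c * f p).
Proof.
intros [a [H1 H2]]. exists (fun n => c * a n). split.
- intros N. rewrite (sum_n_ext _ (fun n => scal (Rabs c) (Rabs (a n) * r ^ n))).
  rewrite sum_n_scal_l. apply Rmult_le_compat_l; [apply Rabs_pos|auto].
  intros n. rewrite Rabs_mult. unfold scal; simpl; unfold mult; simpl; ring.
- intros p Hp. apply is_series_ext with (fun n => scal c (a n * p ^ n)).
  intros n. unfold scal; simpl; unfold mult; simpl; ring.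
  apply (is_series_scal_l (V := R_NormedModule) c _ _ (H2 p Hp)).
Qed.

Lemma PS_plus r B C f g : 0 <= r -> PS r B f -> PS r C g -> PS r (B + C) (fun p => f p + g p).
Proof.
intros Hr [a [H1 H2]] [b [H3 H4]]. exists (fun n => a n + b n). split.
- intros N. apply Rle_trans with
    (sum_n (fun n => plus (Rabs (a n) * r ^ n) (Rabs (b n) * r ^ n)) N).
  + apply sum_n_m_le. intros n. unfold plus; simpl. rewrite <- Rmult_plus_distr_r.
    apply Rmult_le_compat_r; [now apply pow_le|apply Rabs_triang].
  + rewrite sum_n_plus. apply Rplus_le_compat; auto.
- intros p Hp. apply is_series_ext with (fun n => plus (a n * p ^ n) (b n * p ^ n)).
  intros n. unfold plus; simpl; ring.
  apply (is_series_plus (V := R_NormedModule)); auto.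
Qed.

Lemma PS_opp r B f : PS r B f -> PS r B (fun p => - f p).
Proof.
intros H. apply PS_mono with (Rabs (-1) * B).
rewrite Rabs_left; lra.
apply PS_ext with (2 := PS_scal r B (-1) f H). intros; ring.
Qed.

Lemma PS_minus r B C f g : 0 <= r -> PS r B f -> PS r C g -> PS r (B + C) (fun p => f p - g p).
Proof. intros Hr Hf Hg. apply PS_plus; auto. now apply PS_opp. Qed.

Lemma PS_shift r B f : 0 <= r -> PS r B f -> PS r (r * B) (fun p => p * f p).
Proof.
intros Hr [a [H1 H2]]. exists (fun n => match n with O => 0 | S n => a n end). split.
- intros [|N].
  + rewrite sum_O, Rabs_R0. specialize (H1 0%nat). rewrite sum_O in H1. simpl in *.
    assert (0 <= Rabs (a 0%nat)) by apply Rabs_pos.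
    assert (0 <= r * B) by (apply Rmult_le_pos; lra). lra.
  + unfold sum_n. rewrite sum_Sn_m by lia. rewrite <- sum_n_m_S.
    rewrite (sum_n_m_ext _ (fun n => scal r (Rabs (a n) * r ^ n))).
    2:{ intros n. unfold scal; simpl; unfold mult; simpl; ring. }
    rewrite sum_n_m_scal_l. rewrite Rabs_R0, Rmult_0_l. 
    change (0 + r * sum_n (fun n => Rabs (a n) * r ^ n) N <= r * B). rewrite Rplus_0_l.
    apply Rmult_le_compat_l; auto.
- intros p Hp.
  replace (p * f p) with (plus (p * f p) 0) by (unfold plus; simpl; ring).
  apply is_series_decr_1.
  match goal with |- is_series _ ?l => replace l with (scal p (f p)) end.
  2:{ unfold plus, opp, scal; simpl; unfold mult; simpl; ring. }
  apply is_series_ext with (fun n => scal p (a n * p ^ n)).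
  intros n. unfold scal; simpl; unfold mult; simpl; ring.
  apply (is_series_scal_l (V := R_NormedModule) p _ _ (H2 p Hp)).
Qed.

Lemma PS_monomial r B f n : 0 <= r -> PS r B f -> PS r (r ^ n * B) (fun p => p ^ n * f p).
Proof.
intros Hr H. induction n as [|n IH].
- apply PS_mono with B. simpl; lra. apply PS_ext with (2 := H). intros; simpl; ring.
- apply PS_mono with (r * (r ^ n * B)). simpl; lra.
  apply PS_ext with (2 := PS_shift _ _ _ Hr IH). intros; simpl; ring.
Qed.

(** A product is the sum over n of the monomials of one factor times the other
    factor, so it is a special case of countable sums. *)
Lemma PS_mult r B C f g : 0 <= r -> PS r B f -> PS r C g -> PS r (B * C) (fun p => f p * g p).
Proof.
intros Hr [a [H1 H2]] Hg.
assert (HC := PS_bound_nonneg r C g Hr Hg).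
assert (Hpos : forall n, 0 <= Rabs (a n) * r ^ n).
{ intros n. apply Rmult_le_pos; [apply Rabs_pos|now apply pow_le]. }
assert (Hs : ex_series (fun n => Rabs (a n) * r ^ n)).
{ now apply ex_series_of_bounded_sums with B. }
apply PS_mono with (Series (fun n => Rabs (a n) * r ^ n * C)).
{ rewrite Series_scal_r. apply Rmult_le_compat_r; auto. now apply series_le_of_sums. }
apply PS_ext with (fun p => Series (fun n => a n * (p ^ n * g p))).
{ intros p Hp. rewrite <- (is_series_unique _ _ (H2 p Hp)), <- Series_scal_r.
  apply Series_ext; intros; ring. }
apply PS_series; auto.
- intros n. apply PS_mono with (Rabs (a n) * (r ^ n * C)). lra.
  apply PS_scal. now apply PS_monomial.
- apply ex_series_ext with (fun n => scal C (Rabs (a n) * r ^ n)).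
  intros n. unfold scal; simpl; unfold mult; simpl; ring.
  apply (ex_series_scal_l (V := R_NormedModule)), Hs.
Qed.

Lemma PS_pow r B f n : 0 <= r -> PS r B f -> PS r (B ^ n) (fun p => f p ^ n).
Proof.
intros Hr H. induction n as [|n IH].
- apply PS_mono with (Rabs 1). rewrite Rabs_R1; simpl; lra. apply PS_const.
- simpl. now apply PS_mult.
Qed.

Lemma PS_id r : 0 <= r -> PS r r (fun p => p).
Proof.
intros Hr. apply PS_mono with (r * Rabs 1). rewrite Rabs_R1; lra.
apply PS_ext with (fun p => p * 1). intros; ring.
apply PS_shift; auto. apply PS_const.
Qed.

(** Every coefficient of index n >= 1 gains the factor (r'/r)^n <= r'/r. *)
Lemma PS_small r r' B f : 0 < r -> 0 <= r' <= r -> PS r B f -> f 0 = 0 ->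
  PS r' (B * (r' / r)) f.
Proof.
intros Hr Hr' [a [H1 H2]] H0.
assert (a0 : a 0%nat = 0).
{ assert (H : is_series (fun n => a n * 0 ^ n) (a 0%nat)).
  { apply filterlim_ext with (fun _ : nat => a 0%nat).
    - intros N. rewrite <- (sum_n_single (a 0%nat) N) at 1. apply sum_n_ext.
      intros [|n]; simpl; ring.
    - apply filterlim_const. }
  assert (Hp : Rabs 0 <= r) by (rewrite Rabs_R0; lra).
  rewrite <- (is_series_unique _ _ H), (is_series_unique _ _ (H2 0 Hp)). exact H0. }
exists a; split.
- intros N. apply Rle_trans with (sum_n (fun n => scal (r' / r) (Rabs (a n) * r ^ n)) N).
  + apply sum_n_m_le. intros [|n].
    * rewrite a0, Rabs_R0. unfold scal; simpl; unfold mult; simpl. lra.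
    * unfold scal; simpl; unfold mult; simpl.
      replace (r' / r * (Rabs (a (S n)) * (r * r ^ n))) with (Rabs (a (S n)) * (r' * r ^ n))
        by (field; lra).
      apply Rmult_le_compat_l; [apply Rabs_pos|].
      apply Rmult_le_compat_l; [lra|]. apply pow_incr; lra.
  + rewrite sum_n_scal_l. unfold scal; simpl; unfold mult; simpl.
    rewrite (Rmult_comm B). apply Rmult_le_compat_l; auto.
    apply Rmult_le_pos; [lra|]. left; now apply Rinv_0_lt_compat.
- intros p Hp; apply H2; lra.
Qed.

(** Expanding (p0 + h)^n in powers of h for each n is again a countable sum of
    functions of h, so recentring needs no rearrangement of its own. *)
Lemma PS_recenter r B f p0 : PS r B f -> Rabs p0 <= r ->
  PS (r - Rabs p0) B (fun h => f (p0 + h)).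
Proof.
intros [a [H1 H2]] Hp0. set (d := r - Rabs p0).
assert (Hd : 0 <= d) by (unfold d; lra).
assert (Hr : 0 <= r) by (apply Rle_trans with (2 := Hp0), Rabs_pos).
assert (Hpos : forall n, 0 <= Rabs (a n) * r ^ n).
{ intros n. apply Rmult_le_pos; [apply Rabs_pos|now apply pow_le]. }
assert (Hs : ex_series (fun n => Rabs (a n) * r ^ n)).
{ now apply ex_series_of_bounded_sums with B. }
apply PS_mono with (Series (fun n => Rabs (a n) * r ^ n)).
{ now apply series_le_of_sums. }
apply PS_ext with (fun h => Series (fun n => a n * (p0 + h) ^ n)).
{ intros h Hh. apply is_series_unique, H2.
  eapply Rle_trans; [apply Rabs_triang|]. unfold d in Hh; lra. }
apply PS_series; auto.
intros n. apply PS_scal. apply PS_pow; auto.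
apply PS_mono with (Rabs p0 + d). unfold d; lra.
apply PS_plus; auto. apply PS_const. now apply PS_id.
Qed.

Lemma PS_is_pseries r B f : PS r B f ->
  exists a, forall p, Rabs p <= r -> is_pseries a p (f p).
Proof.
intros [a [_ H]]. exists a. intros p Hp. unfold is_pseries.
apply is_series_ext with (2 := H p Hp).
intros n. rewrite Rmult_comm. apply (f_equal (fun z => z * _)). symmetry; apply pow_n_pow.
Qed.

Lemma PS_recentered_pseries r B f e0 : PS r B f -> Rabs e0 < r ->
  exists a, forall e, Rabs (e - e0) < r - Rabs e0 -> is_pseries a (e - e0) (f e).
Proof.
intros H He0.
destruct (PS_is_pseries _ _ _ (PS_recenter r B f e0 H (Rlt_le _ _ He0))) as [a Ha].
exists a. intros e He. replace (f e) with (f (e0 + (e - e0))) by (f_equal; ring).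
apply Ha. lra.
Qed.

Lemma PS_analytic r B f : PS r B f -> analytic_on r f.
Proof.
intros H e0 He0. exists (r - Rabs e0). split; [lra|]. now apply PS_recentered_pseries with B.
Qed.

Lemma PS_analytic_family r B (gam : R -> R -> vec) :
  (forall t, PS r B (fun e => fst (gam t e))) ->
  (forall t, PS r B (fun e => snd (gam t e))) -> analytic_family_on r gam.
Proof.
intros H1 H2 e0 He0. exists (r - Rabs e0). split; [lra|].
assert (C1 := fun t => PS_recentered_pseries _ _ _ _ (H1 t) He0).
assert (C2 := fun t => PS_recentered_pseries _ _ _ _ (H2 t) He0).
exists (fun t => proj1_sig (constructive_indefinite_description _ (C1 t))).
exists (fun t => proj1_sig (constructive_indefinite_description _ (C2 t))).
intros t e He. split.
- apply (proj2_sig (constructive_indefinite_description _ (C1 t)) e He).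
- apply (proj2_sig (constructive_indefinite_description _ (C2 t)) e He).
Qed.

(** The powers of f have geometrically growing norms, so every outer series that
    converges absolutely at the norm bound can be summed inside the algebra. *)
Lemma PS_comp (c : nat -> R) r B f :
  0 <= r -> PS r B f -> ex_series (fun i => Rabs (c i) * B ^ i) ->
  PS r (Series (fun i => Rabs (c i) * B ^ i)) (fun p => Series (fun i => c i * f p ^ i)).
Proof.
intros Hr Hf Hs. apply PS_series; auto.
intros i. apply PS_scal. now apply PS_pow.
Qed.

Lemma is_series_exp x : is_series (fun i => / INR (fact i) * x ^ i) (exp x).
Proof.
assert (H := is_exp_Reals x). unfold is_pseries in H.
apply is_series_ext with (2 := H). intros n.
rewrite (Rmult_comm (/ INR (fact n))). apply (f_equal (fun z => z * _)). apply pow_n_pow.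
Qed.

Lemma inv_fact_pos i : 0 < / INR (fact i).
Proof. apply Rinv_0_lt_compat, INR_fact_lt_0. Qed.

Lemma PS_exp r B f : 0 <= r -> PS r B f -> PS r (exp B) (fun p => exp (f p)).
Proof.
intros Hr H.
assert (E : forall i, / INR (fact i) * B ^ i = Rabs (/ INR (fact i)) * B ^ i).
{ intros i. rewrite Rabs_pos_eq; auto. left; apply inv_fact_pos. }
rewrite <- (is_series_unique _ _ (is_series_exp B)), (Series_ext _ _ E).
apply PS_ext with (fun p => Series (fun i => / INR (fact i) * f p ^ i)).
{ intros p _. apply is_series_unique, is_series_exp. }
apply PS_comp; auto. apply ex_series_ext with (1 := E).
exists (exp B). apply is_series_exp.
Qed.

Lemma PS_inv r u : 0 <= r -> PS r (1/2) u -> PS r 2 (fun p => / (1 + u p)).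
Proof.
intros Hr H.
assert (G : is_series (fun i => (1/2) ^ i) (/ (1 - 1/2))).
{ apply is_series_geom. rewrite Rabs_pos_eq; lra. }
assert (E : forall i, (1/2) ^ i = Rabs ((-1) ^ i) * (1/2) ^ i).
{ intros i. rewrite pow_1_abs; ring. }
apply PS_mono with (Series (fun i => Rabs ((-1) ^ i) * (1/2) ^ i)).
{ right. transitivity (/ (1 - 1/2)); [|field].
  apply is_series_unique. now apply is_series_ext with (2 := G). }
apply PS_ext with (fun p => Series (fun i => (-1) ^ i * u p ^ i)).
{ intros p Hp. apply is_series_unique.
  apply is_series_ext with (fun i => (- u p) ^ i).
  intros i. rewrite <- Rpow_mult_distr. f_equal; ring.
  replace (1 + u p) with (1 - - u p) by ring. apply is_series_geom.
  rewrite Rabs_Ropp. assert (HH := PS_abs _ _ _ _ H Hp). lra. }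
apply PS_comp; auto. apply ex_series_ext with (1 := E). now exists (/ (1 - 1/2)).
Qed.

(** * Analytic implicit functions *)

Lemma sin_plus_nPI x n : sin (x + INR n * PI) = (-1) ^ n * sin x.
Proof.
induction n as [|n IH].
- simpl. rewrite Rmult_0_l, Rplus_0_r; ring.
- rewrite S_INR. replace (x + (INR n + 1) * PI) with ((x + INR n * PI) + PI) by ring.
  rewrite neg_sin, IH. simpl; ring.
Qed.

(** The Taylor series of sine at th, assembled from the series of cos y (even
    terms) and of sin y / y (odd terms). *)
Lemma is_series_sin th y :
  is_series (fun i => sin (th + INR i * (PI / 2)) * / INR (fact i) * y ^ i) (sin (th + y)).
Proof.
destruct (Req_dec y 0) as [->|Hy].
{ rewrite Rplus_0_r. apply filterlim_ext with (fun _ : nat => sin th).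
  2: apply filterlim_const.
  intros N. rewrite <- (sum_n_single (sin th) N) at 1. apply sum_n_ext.
  intros [|n]; simpl. rewrite Rmult_0_l, Rplus_0_r; field. ring. }
set (a := fun i => sin (th + INR i * (PI / 2)) * / INR (fact i)).
assert (Hev : is_pseries (fun n => a (2 * n)%nat) (y ^ 2) (sin th * cos y)).
{ assert (H : is_series (fun i => sin th * (cos_n i * (y²) ^ i)) (sin th * cos y)).
  { apply (is_series_scal_l (V := R_NormedModule) (sin th)). apply is_series_Reals.
    unfold cos. destruct (exist_cos (Rsqr y)) as [l Hl]. exact Hl. }
  unfold is_pseries. apply is_series_ext with (2 := H). intros n.
  transitivity ((y ^ 2) ^ n * a (2 * n)%nat).
  2:{ apply (f_equal (fun z => z * _)). symmetry; apply pow_n_pow. }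
  unfold a, cos_n. replace (th + INR (2 * n) * (PI / 2)) with (th + INR n * PI)
    by (rewrite mult_INR; simpl (INR 2); lra).
  rewrite sin_plus_nPI. replace (y²) with (y ^ 2) by (unfold Rsqr; ring). unfold Rdiv; rring. }
assert (Hod : is_pseries (fun n => a (2 * n + 1)%nat) (y ^ 2) (cos th * (sin y / y))).
{ assert (H : is_series (fun i => cos th * (sin_n i * (y²) ^ i)) (cos th * (sin y / y))).
  { apply (is_series_scal_l (V := R_NormedModule) (cos th)). apply is_series_Reals.
    unfold sin. destruct (exist_sin (Rsqr y)) as [l Hl].
    replace (y * l / y) with l by (field; auto). exact Hl. }
  unfold is_pseries. apply is_series_ext with (2 := H). intros n.
  transitivity ((y ^ 2) ^ n * a (2 * n + 1)%nat).
  2:{ apply (f_equal (fun z => z * _)). symmetry; apply pow_n_pow. }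
  unfold a, sin_n. replace (th + INR (2 * n + 1) * (PI / 2)) with ((PI / 2 + th) + INR n * PI)
    by (rewrite plus_INR, mult_INR; simpl (INR 2); simpl (INR 1); field).
  rewrite sin_plus_nPI, <- cos_sin. replace (y²) with (y ^ 2) by (unfold Rsqr; ring). unfold Rdiv; rring. }
assert (H := is_pseries_odd_even a y _ _ Hev Hod).
replace (sin (th + y)) with (sin th * cos y + y * (cos th * (sin y / y))).
2:{ rewrite sin_plus. field; auto. }
unfold is_pseries in H. apply is_series_ext with (2 := H). intros n.
rewrite (Rmult_comm (_ * _)).
apply (f_equal (fun z => z * _)). apply pow_n_pow.
Qed.

Lemma sin_coef_bound th i : Rabs (sin (th + INR i * (PI / 2)) * / INR (fact i)) <= / INR (fact i).
Proof.
rewrite Rabs_mult, (Rabs_pos_eq (/ _)) by (left; apply inv_fact_pos).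
rewrite <- (Rmult_1_l (/ INR (fact i))) at 2.
apply Rmult_le_compat_r. left; apply inv_fact_pos.
apply Rabs_le. apply SIN_bound.
Qed.

Lemma PS_sin r B f th : 0 <= r -> PS r B f -> PS r (exp B) (fun p => sin (th + f p)).
Proof.
intros Hr H. assert (HB := PS_bound_nonneg _ _ _ Hr H).
set (a := fun i => sin (th + INR i * (PI / 2)) * / INR (fact i)).
assert (Hle : forall i, Rabs (a i) * B ^ i <= / INR (fact i) * B ^ i).
{ intros i. apply Rmult_le_compat_r; [now apply pow_le|apply sin_coef_bound]. }
assert (Hex : ex_series (fun i => / INR (fact i) * B ^ i)) by (exists (exp B); apply is_series_exp).
assert (Hp : forall i, 0 <= Rabs (a i) * B ^ i).
{ intros i; apply Rmult_le_pos; [apply Rabs_pos|now apply pow_le]. }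
apply PS_mono with (Series (fun i => Rabs (a i) * B ^ i)).
{ rewrite <- (is_series_unique _ _ (is_series_exp B)). apply Series_le; auto. }
apply PS_ext with (fun p => Series (fun i => a i * f p ^ i)).
{ intros p _. apply is_series_unique, is_series_sin. }
apply PS_comp; auto.
apply ex_series_dominated with (2 := Hex). intros i. rewrite Rabs_pos_eq; auto.
Qed.

Lemma PS_cos r B f th : 0 <= r -> PS r B f -> PS r (exp B) (fun p => cos (th + f p)).
Proof.
intros Hr H. apply PS_ext with (2 := PS_sin r B f (PI / 2 + th) Hr H).
intros p _. rewrite cos_sin. f_equal; ring.
Qed.

Lemma PS_pow_diff r rho B x y n : 0 <= r -> 0 < rho -> 0 <= B ->
  PS r rho x -> PS r rho y -> PS r B (fun p => x p - y p) ->
  PS r (B / rho * (2 * rho) ^ n) (fun p => x p ^ n - y p ^ n).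
Proof.
intros Hr Hrho HB Hx Hy Hxy. induction n as [|n IH].
- apply PS_mono with (Rabs 0).
  { rewrite Rabs_R0. simpl. apply Rmult_le_pos; [|lra]. apply Rdiv_le_0_compat; lra. }
  apply PS_ext with (2 := PS_const r 0). intros; simpl; ring.
- apply PS_mono with (rho * (B / rho * (2 * rho) ^ n) + B * rho ^ n).
  { assert (rho ^ n <= (2 * rho) ^ n) by (apply pow_incr; lra).
    assert (B * rho ^ n <= B * (2 * rho) ^ n) by (apply Rmult_le_compat_l; auto).
    replace (rho * (B / rho * (2 * rho) ^ n)) with (B * (2 * rho) ^ n) by (field; lra).
    replace (B / rho * (2 * rho) ^ S n) with (2 * (B * (2 * rho) ^ n)) by (simpl; field; lra).
    lra. }
  apply PS_ext with (fun p => x p * (x p ^ n - y p ^ n) + (x p - y p) * y p ^ n).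
  intros; simpl; ring.
  apply PS_plus; auto. apply PS_mult; auto. apply PS_mult; auto. apply PS_pow; auto.
Qed.

Lemma ex_series_geom_scal c x : Rabs x < 1 -> ex_series (fun i => c * x ^ i).
Proof.
intros H. apply (ex_series_scal_l (V := R_NormedModule) c). exists (/ (1 - x)).
now apply is_series_geom.
Qed.

Lemma Series_geom_scal c x : Rabs x < 1 -> Series (fun i => c * x ^ i) = c * / (1 - x).
Proof.
intros H. rewrite Series_scal_l. f_equal. apply is_series_unique. now apply is_series_geom.
Qed.

Section ImplicitFunction.
Variables (r0 M : R) (g : nat -> R -> R).
Hypothesis r0_pos : 0 < r0.
Hypothesis g_PS : forall i, PS r0 M (g i).
Let d := g 1%nat 0.
Hypothesis g0_0 : g 0%nat 0 = 0.
Hypothesis d_neq : d <> 0.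

Let S_ (x : R) (p : R) := Series (fun i => g i p * x ^ i).
Let T (x : R) (p : R) := x - / d * S_ x p.

Lemma M_nonneg : 0 <= M.
Proof. apply (PS_bound_nonneg r0 M (g 0%nat)); auto; lra. Qed.

Lemma ex_series_S x p : Rabs p <= r0 -> Rabs x <= 1/4 -> ex_series (fun i => g i p * x ^ i).
Proof.
intros Hp Hx. apply ex_series_dominated with (fun i => M * (1/4) ^ i).
- intros i. rewrite Rabs_mult. apply Rmult_le_compat; try apply Rabs_pos.
  now apply PS_abs with r0. now apply pow_abs_le.
- apply ex_series_geom_scal. rewrite Rabs_pos_eq; lra.
Qed.

Lemma T_diff x y p : Rabs p <= r0 -> Rabs x <= 1/4 -> Rabs y <= 1/4 ->
  T x p - T y p = - / d * ((g 1%nat p - d) * (x - y) +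
    Series (fun j => g (S (S j)) p * (x ^ (S (S j)) - y ^ (S (S j))))).
Proof.
intros Hp Hx Hy. unfold T, S_.
assert (Ex := ex_series_S x p Hp Hx). assert (Ey := ex_series_S y p Hp Hy).
rewrite (Series_incr_n _ 2%nat) by (lia || auto).
rewrite (Series_incr_n (fun i => g i p * y ^ i) 2%nat) by (lia || auto).
assert (E : Series (fun j => g (S (S j)) p * (x ^ (S (S j)) - y ^ (S (S j)))) =
   Series (fun j => g (2 + j)%nat p * x ^ (2 + j)) - Series (fun j => g (2 + j)%nat p * y ^ (2 + j))).
{ rewrite <- Series_minus. apply Series_ext; intros; simpl; ring.
  - apply (ex_series_incr_n (fun i => g i p * x ^ i) 2), Ex.
  - apply (ex_series_incr_n (fun i => g i p * y ^ i) 2), Ey. }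
rewrite E. simpl. field. auto.
Qed.

(** Differences of powers are Lipschitz with constant proportional to (2 rho)^n,
    so the terms of degree at least two contribute O(rho); the linear correction
    g 1 - d vanishes at the origin and contributes O(r). *)
Lemma T_contracts r rho : 0 < r <= r0 -> 0 < rho <= 1/4 ->
  Rabs (/ d) * ((M + Rabs d) * (r / r0)) <= 1/4 -> Rabs (/ d) * (8 * M * rho) <= 1/4 ->
  forall B x y, 0 <= B -> PS r rho x -> PS r rho y -> PS r B (fun p => x p - y p) ->
  PS r (B / 2) (fun p => T (x p) p - T (y p) p).
Proof.
intros Hr Hrho H1 H2 B x y HB Hx Hy Hxy.
assert (HM := M_nonneg).
assert (Hb : forall z, PS r rho z -> forall p, Rabs p <= r -> Rabs (z p) <= 1/4).
{ intros z Hz p Hp. assert (HH := PS_abs _ _ _ _ Hz Hp). lra. }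
apply PS_ext with (fun p => - / d * ((g 1%nat p - d) * (x p - y p) +
    Series (fun j => g (S (S j)) p * (x p ^ (S (S j)) - y p ^ (S (S j)))))).
{ intros p Hp. rewrite T_diff; auto. lra. }
set (K := fun j => M * (B / rho * (2 * rho) ^ (S (S j)))).
assert (EK : forall j, K j = (4 * M * B * rho) * (2 * rho) ^ j).
{ intros j. unfold K. simpl. field. lra. }
assert (H2r : Rabs (2 * rho) < 1) by (rewrite Rabs_pos_eq; lra).
assert (HK : ex_series K).
{ apply ex_series_ext with (fun j => (4 * M * B * rho) * (2 * rho) ^ j).
  intros j; now rewrite EK. now apply ex_series_geom_scal. }
apply PS_mono with (Rabs (- / d) * (((M + Rabs d) * (r / r0)) * B + Series K)).
{ rewrite Rabs_Ropp, (Series_ext _ _ EK), (Series_geom_scal _ _ H2r).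
  assert (Hinv : / (1 - 2 * rho) <= 2).
  { replace 2 with (/ (1/2)) at 2 by field. apply Rinv_le_contravar; lra. }
  assert (0 <= 4 * M * B * rho) by (repeat apply Rmult_le_pos; lra).
  assert (4 * M * B * rho * / (1 - 2 * rho) <= 4 * M * B * rho * 2)
    by (apply Rmult_le_compat_l; auto).
  assert (0 <= Rabs (/ d)) by apply Rabs_pos.
  apply Rle_trans with (Rabs (/ d) * ((M + Rabs d) * (r / r0) * B + 8 * M * rho * B)).
  apply Rmult_le_compat_l; lra.
  replace (Rabs (/ d) * ((M + Rabs d) * (r / r0) * B + 8 * M * rho * B)) with
    (Rabs (/ d) * ((M + Rabs d) * (r / r0)) * B + Rabs (/ d) * (8 * M * rho) * B) by ring.
  assert (Rabs (/ d) * ((M + Rabs d) * (r / r0)) * B <= 1/4 * B) by (apply Rmult_le_compat_r; auto).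
  assert (Rabs (/ d) * (8 * M * rho) * B <= 1/4 * B) by (apply Rmult_le_compat_r; auto).
  lra. }
apply PS_scal. apply PS_plus; [lra| |].
- apply PS_mult; auto; [lra|].
  apply PS_small with (r := r0); auto; [lra| |unfold d; ring].
  apply PS_minus; auto; [lra|apply PS_const].
- apply PS_series; auto; [lra|]. intros j. unfold K.
  apply PS_mult; [lra| |].
  + apply PS_radius with r0; auto; lra.
  + apply PS_pow_diff; auto; lra.
Qed.

(** Newton iteration with the derivative frozen at the origin contracts a small
    ball of the algebra; the increments then have summable norms. *)
Lemma implicit_function (rho0 : R) : 0 < rho0 ->
  exists (r rho : R) (x : R -> R), 0 < r <= r0 /\ 0 < rho <= rho0 /\ rho <= 1/4 /\
    PS r rho x /\ x 0 = 0 /\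
    forall p, Rabs p <= r -> is_series (fun i => g i p * x p ^ i) 0.
Proof.
intros Hrho0. assert (HM := M_nonneg).
assert (HD : 0 < Rabs (/ d)) by (apply Rabs_pos_lt, Rinv_neq_0_compat, d_neq).
set (D := Rabs (/ d)) in *.
assert (HdP := Rabs_pos d).
(* First rho makes the nonlinear part a 1/4-contraction; then r does the same for
   the linear part and keeps T 0 within rho / 2, so that the increments
   rho / 2, rho / 4, ... never leave the ball of radius rho. *)
set (rho := Rmin rho0 (Rmin (1/4) (/ (32 * D * (M + 1))))).
assert (Hq : 0 < 32 * D * (M + 1)) by (repeat apply Rmult_lt_0_compat; lra).
assert (Hrho : 0 < rho).
{ unfold rho. repeat apply Rmin_glb_lt; try lra. now apply Rinv_0_lt_compat. }
assert (Hrho1 : rho <= rho0) by apply Rmin_l.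
assert (Hrho2 : rho <= 1/4) by (eapply Rle_trans; [apply Rmin_r|apply Rmin_l]).
assert (Hrho3 : rho <= / (32 * D * (M + 1))) by (eapply Rle_trans; [apply Rmin_r|apply Rmin_r]).
assert (HC2 : D * (8 * M * rho) <= 1/4).
{ apply Rle_trans with (8 * D * (M + 1) * rho).
  - replace (D * (8 * M * rho)) with (8 * D * M * rho) by ring.
    apply Rmult_le_compat_r; [lra|]. apply Rmult_le_compat_l; lra.
  - apply Rle_trans with (8 * D * (M + 1) * / (32 * D * (M + 1))).
    apply Rmult_le_compat_l; auto. repeat apply Rmult_le_pos; lra.
    right. field. lra. }
set (A := D * (M + Rabs d + 1)).
assert (HA : 0 < A) by (apply Rmult_lt_0_compat; lra).
set (r := r0 * Rmin 1 (rho / (4 * A))).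
assert (Hmin : 0 < Rmin 1 (rho / (4 * A))).
{ apply Rmin_glb_lt; [lra|]. apply Rdiv_lt_0_compat; lra. }
assert (Hr : 0 < r <= r0).
{ split. apply Rmult_lt_0_compat; auto. unfold r. rewrite <- (Rmult_1_r r0) at 2.
  apply Rmult_le_compat_l; [lra|apply Rmin_l]. }
assert (Hrr : r / r0 = Rmin 1 (rho / (4 * A))) by (unfold r; field; lra).
assert (HAr : A * (r / r0) <= rho / 4).
{ rewrite Hrr. apply Rle_trans with (A * (rho / (4 * A))).
  apply Rmult_le_compat_l; [lra|apply Rmin_r]. right; field; lra. }
assert (Hrp : 0 <= r / r0) by (rewrite Hrr; lra).
assert (HC1 : D * ((M + Rabs d) * (r / r0)) <= 1/4).
{ apply Rle_trans with (A * (r / r0)); [|lra]. unfold A.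
  rewrite <- Rmult_assoc. apply Rmult_le_compat_r; auto. apply Rmult_le_compat_l; lra. }
assert (HC0 : D * (M * (r / r0)) <= rho / 2).
{ apply Rle_trans with (A * (r / r0)); [|lra]. unfold A.
  rewrite <- Rmult_assoc. apply Rmult_le_compat_r; auto. apply Rmult_le_compat_l; lra. }
assert (HT := T_contracts r rho Hr (conj Hrho Hrho2) HC1 HC2).
set (X := fix X n := match n with O => fun _ : R => 0 | S n => fun p => T (X n p) p end).
assert (HX : forall n, PS r (rho * (1 - (1/2) ^ n)) (X n) /\
   PS r (rho * (1/2) ^ (S n)) (fun p => X (S n) p - X n p)).
{ assert (Hh : forall n, 0 < (1/2) ^ n) by (intros; apply pow_lt; lra).
  induction n as [|n [IH1 IH2]].
  - split.
    + apply PS_mono with (Rabs 0). rewrite Rabs_R0; simpl; lra. apply PS_const.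
    + apply PS_mono with (Rabs (- / d) * (M * (r / r0))).
      rewrite Rabs_Ropp. fold D. simpl; lra.
      apply PS_ext with (fun p => - / d * g 0%nat p).
      { intros p Hp. simpl. unfold T, S_.
        replace (Series (fun i => g i p * 0 ^ i)) with (g 0%nat p); [ring|].
        symmetry. apply is_series_unique.
        apply filterlim_ext with (fun _ : nat => g 0%nat p); [|apply filterlim_const].
        intros N. rewrite <- (sum_n_single (g 0%nat p) N) at 1. apply sum_n_ext.
        intros [|n]; simpl; ring. }
      apply PS_scal. apply PS_small with (r := r0); auto; lra.
  - assert (HS : PS r (rho * (1 - (1/2) ^ (S n))) (X (S n))).
    { apply PS_mono with (rho * (1 - (1/2) ^ n) + rho * (1/2) ^ (S n)).
      simpl; lra. apply PS_ext with (fun p => X n p + (X (S n) p - X n p)).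
      intros; ring. apply PS_plus; auto; lra. }
    split; auto.
    apply PS_mono with (rho * (1/2) ^ (S n) / 2). simpl; lra.
    assert (Hle : forall m, rho * (1 - (1/2) ^ m) <= rho).
    { intros m. specialize (Hh m). rewrite <- (Rmult_1_r rho) at 2.
      apply Rmult_le_compat_l; lra. }
    apply (HT (rho * (1/2) ^ (S n)) (X (S n)) (X n)); auto.
    + specialize (Hh (S n)). apply Rmult_le_pos; lra.
    + apply PS_mono with (2 := HS), Hle.
    + apply PS_mono with (2 := IH1), Hle. }
assert (Hhalf : Rabs (1/2) < 1) by (rewrite Rabs_pos_eq; lra).
assert (Hgeo : forall c, ex_series (fun n => c * (1/2) ^ n)) by (intros; now apply ex_series_geom_scal).
set (x := fun p => Series (fun n => X (S n) p - X n p)).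
assert (Htail : forall n, PS r (rho * (1/2) ^ n) (fun p => x p - X n p)).
{ intros n.
  assert (E : forall j, rho * (1/2) ^ (S (n + j)) = rho * (1/2) ^ (S n) * (1/2) ^ j).
  { intros j. rewrite Rmult_assoc, <- pow_add. f_equal. }
  apply PS_mono with (Series (fun j => rho * (1/2) ^ (S (n + j)))).
  { rewrite (Series_ext _ _ E), (Series_geom_scal _ _ Hhalf). right. simpl. field. }
  apply PS_ext with (fun p => Series (fun j => X (S (n + j)) p - X (n + j)%nat p)).
  { intros p Hp. unfold x.
    assert (ex : ex_series (fun n => X (S n) p - X n p)).
    { apply ex_series_dominated with (fun n => rho / 2 * (1/2) ^ n); auto.
      intros j. apply Rle_trans with (rho * (1/2) ^ (S j)). apply (PS_abs _ _ _ _ (proj2 (HX j)) Hp).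
      right; simpl; field. }
    assert (Htel : forall m, sum_f_R0 (fun n => X (S n) p - X n p) m = X (S m) p).
    { induction m as [|m IH]. simpl. ring. rewrite tech5, IH. ring. }
    destruct n as [|n].
    - simpl. rewrite Rminus_0_r. reflexivity.
    - rewrite (Series_incr_n (fun n => X (S n) p - X n p) (S n)) by (lia || auto).
      rewrite Nat.pred_succ, Htel.
      replace (Series (fun k => X (S (S n + k)) p - X (S n + k)%nat p)) with
        (Series (fun j => X (S (S n + j)) p - X (S n + j)%nat p)) by reflexivity.
      ring. }
  apply PS_series. lra. intros j. apply (proj2 (HX (n + j)%nat)).
  apply ex_series_ext with (fun j => rho * (1/2) ^ (S n) * (1/2) ^ j); auto. }
assert (Hx : PS r rho x).
{ apply PS_mono with (rho * (1/2) ^ 0). simpl; lra.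
  apply PS_ext with (2 := Htail 0%nat). intros; simpl; ring. }
exists r, rho, x. repeat (split; [assumption || lra|]). split.
- unfold x. rewrite (Series_ext _ (fun n => 0 * 1 ^ n)).
  rewrite Series_scal_l; ring.
  intros n. assert (H0 : forall m, X m 0 = 0).
  { induction m as [|m IH]; auto. simpl. rewrite IH. unfold T, S_.
    rewrite (Series_ext _ (fun n => 0 * 1 ^ n)). rewrite Series_scal_l; ring.
    intros [|j]. simpl. rewrite g0_0; ring. simpl; ring. }
  rewrite !H0; ring.
- intros p Hp.
  assert (Hxp : Rabs (x p) <= 1/4) by (assert (HH := PS_abs _ _ _ _ Hx Hp); lra).
  assert (Ex : ex_series (fun i => g i p * x p ^ i)) by (apply ex_series_S; auto; lra).
  assert (HTx : Rabs (T (x p) p - x p) <= 0).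
  { assert (Hn : forall n, Rabs (T (x p) p - x p) <= rho * (1/2) ^ n).
    { intros n. assert (Hh : 0 < (1/2) ^ n) by (apply pow_lt; lra).
      replace (T (x p) p - x p) with ((T (x p) p - T (X n p) p) + - (x p - X (S n) p))
        by (simpl; ring).
      eapply Rle_trans; [apply Rabs_triang|]. rewrite Rabs_Ropp.
      assert (Hpos : 0 <= rho * (1/2) ^ n) by (apply Rmult_le_pos; lra).
      assert (HXn : PS r rho (X n)).
      { apply PS_mono with (2 := proj1 (HX n)). rewrite <- (Rmult_1_r rho) at 2.
        apply Rmult_le_compat_l; lra. }
      assert (B1 := PS_abs _ _ _ _ (HT _ _ _ Hpos Hx HXn (Htail n)) Hp). cbv beta in B1.
      assert (B2 := PS_abs _ _ _ _ (Htail (S n)) Hp). simpl in B1, B2 |- *. lra. }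
    assert (Hl : is_lim_seq (fun n => rho * (1/2) ^ n) (rho * 0)).
    { apply (is_lim_seq_scal_l _ rho 0). now apply is_lim_seq_geom. }
    rewrite Rmult_0_r in Hl.
    assert (HH : Rbar_le (Rabs (T (x p) p - x p)) 0); [|exact HH].
    apply (is_lim_seq_le (fun _ => Rabs (T (x p) p - x p)) (fun n => rho * (1/2) ^ n)); auto.
    apply is_lim_seq_const. }
  assert (HS0 : S_ (x p) p = 0).
  { assert (Hz : T (x p) p - x p = 0).
    { destruct (Req_dec (T (x p) p - x p) 0) as [|Hne]; auto.
      apply Rabs_pos_lt in Hne; lra. }
    unfold T in Hz. assert (/ d * S_ (x p) p = 0) by lra.
    apply Rmult_integral in H. destruct H; auto.
    exfalso; revert H; now apply Rinv_neq_0_compat. }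
  rewrite <- HS0. apply (Series_correct _ Ex).
Qed.

End ImplicitFunction.

(** Summing the coefficients of each x^i over m first turns the sum of the f m into
    a single power series in x over the algebra. *)
Lemma implicit_function_series (r0 : R) (c : nat -> nat -> R -> R) (f : nat -> R -> R -> R)
    (K : nat -> R) (rho0 : R) :
  0 < r0 -> 0 < rho0 ->
  (forall m i, PS r0 (K m) (c m i)) -> ex_series K ->
  (forall m x p, is_series (fun i => c m i p * x ^ i) (f m x p)) ->
  Series (fun m => c m 0%nat 0) = 0 -> Series (fun m => c m 1%nat 0) <> 0 ->
  exists (r rho : R) (x : R -> R), 0 < r <= r0 /\ 0 < rho <= rho0 /\
    PS r rho x /\ x 0 = 0 /\
    forall p, Rabs p <= r -> Series (fun m => f m (x p) p) = 0.
Proof.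
intros Hr0 Hrho0 Hc HK Hf H0 H1.
destruct (implicit_function r0 (Series K) (fun i p => Series (fun m => c m i p)) Hr0)
  with (rho0 := rho0) as (r & rho & x & Hr & Hrho & Hrho4 & Hx & Hx0 & Hs); auto.
{ intros i. apply PS_series; auto; lra. }
exists r, rho, x. repeat (split; [assumption|]).
intros p Hp. specialize (Hs p Hp).
assert (HK0 : forall m, 0 <= K m) by (intros m; apply (PS_bound_nonneg r0 _ (c m 0%nat)); auto; lra).
assert (Hxp : Rabs (x p) <= 1/4) by (assert (HH := PS_abs _ _ _ _ Hx Hp); lra).
destruct (fubini_series (fun m i => c m i p * x p ^ i) (fun m => K m * 2)) as [_ [_ HF]].
- intros m N. apply Rle_trans with (Series (fun i => K m * (1/4) ^ i)).
  + eapply Rle_trans; [|apply sum_n_le_series with (N := N)].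
    * apply sum_n_m_le. intros i. rewrite Rabs_mult.
      apply Rmult_le_compat; try apply Rabs_pos; [|now apply pow_abs_le].
      apply PS_abs with r0; auto; lra.
    * intros i. apply Rmult_le_pos; auto. apply pow_le; lra.
    * apply ex_series_geom_scal; rewrite Rabs_pos_eq; lra.
  + rewrite Series_geom_scal by (rewrite Rabs_pos_eq; lra).
    apply Rmult_le_compat_l; auto. lra.
- apply (ex_series_scal_r 2), HK.
- transitivity (Series (fun m => Series (fun i => c m i p * x p ^ i))).
  + apply Series_ext. intros m. symmetry. apply is_series_unique, Hf.
  + rewrite <- (is_series_unique _ _ HF). rewrite <- (is_series_unique _ _ Hs).
    apply Series_ext. intros i. now rewrite Series_scal_r.
Qed.

(** * Sums over the integers *)

(** Pairing n with - n - 1 turns a sum over the integers into an ordinary series,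
    and makes the reflection n -> - n - 1, the symmetry of the odd theta series,
    hold term by term. *)
Definition zfold (g : Z -> R) (n : nat) : R := g (Z.of_nat n) + g (- Z.of_nat n - 1)%Z.
Definition zsum (g : Z -> R) : R := Series (zfold g).
Definition zsummable (g : Z -> R) : Prop := ex_series (zfold (fun n => Rabs (g n))).

Lemma zfold_abs g n : Rabs (zfold g n) <= zfold (fun n => Rabs (g n)) n.
Proof. unfold zfold. apply Rabs_triang. Qed.

Lemma zsummable_ex g : zsummable g -> ex_series (zfold g).
Proof. intros H. apply ex_series_dominated with (2 := H). apply zfold_abs. Qed.

Lemma zsum_ext g h : (forall n, g n = h n) -> zsum g = zsum h.
Proof. intros H. apply Series_ext. intros n. unfold zfold. now rewrite !H. Qed.

Lemma zsummable_ext g h : (forall n, g n = h n) -> zsummable g -> zsummable h.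
Proof. intros H. apply ex_series_ext. intros n. unfold zfold. now rewrite !H. Qed.

Lemma zsummable_dominated g b : (forall n, Rabs (g n) <= b n) -> zsummable b -> zsummable g.
Proof.
intros H Hb. apply ex_series_dominated with (2 := Hb). intros n. unfold zfold.
rewrite Rabs_pos_eq by (apply Rplus_le_le_0_compat; apply Rabs_pos).
apply Rplus_le_compat; eapply Rle_trans; try apply H; apply Rle_abs.
Qed.

Lemma zsummable_plus g h : zsummable g -> zsummable h -> zsummable (fun n => g n + h n).
Proof.
intros Hg Hh. apply ex_series_dominated with (2 := ex_series_plus _ _ Hg Hh).
intros n. unfold plus, zfold; simpl.
rewrite Rabs_pos_eq by (apply Rplus_le_le_0_compat; apply Rabs_pos).
assert (H1 := Rabs_triang (g (Z.of_nat n)) (h (Z.of_nat n))).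
assert (H2 := Rabs_triang (g (- Z.of_nat n - 1)%Z) (h (- Z.of_nat n - 1)%Z)). lra.
Qed.

Lemma zsummable_scal c g : zsummable g -> zsummable (fun n => c * g n).
Proof.
intros Hg. apply ex_series_ext with (fun n => scal (Rabs c) (zfold (fun n => Rabs (g n)) n)).
- intros n. unfold zfold, scal; simpl; unfold mult; simpl. rewrite !Rabs_mult. rring.
- apply (ex_series_scal_l (V := R_NormedModule)), Hg.
Qed.

Lemma zsum_plus g h : ex_series (zfold g) -> ex_series (zfold h) ->
  zsum (fun n => g n + h n) = zsum g + zsum h.
Proof.
intros Hg Hh. unfold zsum. rewrite <- Series_plus by auto.
apply Series_ext. intros n; unfold zfold; rring.
Qed.

Lemma zsum_minus g h : ex_series (zfold g) -> ex_series (zfold h) ->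
  zsum (fun n => g n - h n) = zsum g - zsum h.
Proof.
intros Hg Hh. unfold zsum. rewrite <- Series_minus by auto.
apply Series_ext. intros n; unfold zfold; rring.
Qed.

Lemma zsum_scal_l c g : zsum (fun n => c * g n) = c * zsum g.
Proof. unfold zsum. rewrite <- Series_scal_l. apply Series_ext. intros n; unfold zfold; rring. Qed.

Lemma zsum_scal_r c g : zsum (fun n => g n * c) = zsum g * c.
Proof. unfold zsum. rewrite <- Series_scal_r. apply Series_ext. intros n; unfold zfold; rring. Qed.

Lemma zsum_abs_le g b : (forall n, Rabs (g n) <= b n) -> zsummable b ->
  Rabs (zsum g) <= zsum b.
Proof.
intros H Hb. apply series_abs_le.
- intros n. eapply Rle_trans; [apply zfold_abs|]. apply Rplus_le_compat; apply H.
- now apply zsummable_ex.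
Qed.

Lemma zsum_triple g : (forall m, (1 < Z.abs m)%Z -> g m = 0) ->
  zsum g = g 0%Z + g 1%Z + g (-1)%Z.
Proof.
intros H.
apply is_series_unique. apply is_series_decr_1.
apply filterlim_ext with (fun _ : nat => g 1%Z).
- intros N. rewrite <- (sum_n_single (g 1%Z) N) at 1. apply sum_n_ext.
  intros [|n]; unfold zfold.
  + rewrite (H (- Z.of_nat 1 - 1)%Z) by lia. symmetry; apply Rplus_0_r.
  + rewrite !H by lia. symmetry; apply Rplus_0_r.
- match goal with |- filterlim _ _ (locally ?l) => replace l with (g 1%Z) end.
  apply filterlim_const. unfold zfold, plus, opp; simpl. ring.
Qed.

Lemma zsum_single g : (forall n, n <> 0%Z -> g n = 0) -> zsum g = g 0%Z.
Proof.
intros H. rewrite zsum_triple, (H 1%Z), (H (-1)%Z) by (intros; lia || (apply H; lia)). ring.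
Qed.

Lemma zsum_reflect g : zsum (fun n => g (- n - 1)%Z) = zsum g.
Proof.
apply Series_ext. intros n. unfold zfold.
replace (- (- Z.of_nat n - 1) - 1)%Z with (Z.of_nat n) by lia. rring.
Qed.

Lemma zsummable_reflect g : zsummable g -> zsummable (fun n => g (- n - 1)%Z).
Proof.
apply ex_series_ext. intros n. unfold zfold.
replace (- (- Z.of_nat n - 1) - 1)%Z with (Z.of_nat n) by lia. rring.
Qed.

Lemma zsummable_pos_half g : zsummable g -> ex_series (fun n => Rabs (g (Z.of_nat n))).
Proof.
intros H. apply ex_series_dominated with (2 := H). intros n. rewrite Rabs_Rabsolu.
unfold zfold. assert (HH := Rabs_pos (g (- Z.of_nat n - 1)%Z)). lra.
Qed.

Lemma zsummable_neg_half g : zsummable g -> ex_series (fun n => Rabs (g (- Z.of_nat n - 1)%Z)).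
Proof.
intros H. apply ex_series_dominated with (2 := H). intros n. rewrite Rabs_Rabsolu.
unfold zfold. assert (HH := Rabs_pos (g (Z.of_nat n))). lra.
Qed.

(** Partial sums of the shifted series differ from those of the original one by
    two boundary terms, which tend to 0. *)
Lemma zsum_shift_1 g : zsummable g ->
  zsummable (fun n => g (n + 1)%Z) /\ zsum (fun n => g (n + 1)%Z) = zsum g.
Proof.
intros H.
assert (H1 := zsummable_pos_half g H). assert (H2 := zsummable_neg_half g H).
assert (Hs : zsummable (fun n => g (n + 1)%Z)).
{ apply (ex_series_plus (V := R_NormedModule)).
  - apply ex_series_incr_1 in H1. apply ex_series_ext with (2 := H1).
    intros n. do 2 f_equal. lia.
  - apply (proj2 (ex_series_incr_1 (fun n => Rabs (g (- Z.of_nat n - 1 + 1)%Z)))).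
    apply ex_series_ext with (2 := H2). intros n. do 2 f_equal. lia. }
split; auto.
set (a := fun n : nat => g (Z.of_nat n) - g (- Z.of_nat n)%Z).
assert (Hsum : forall N, sum_n (zfold (fun n => g (n + 1)%Z)) N = sum_n (zfold g) N + a (S N)).
{ induction N as [|N IH].
  - rewrite !sum_O. unfold zfold, a. simpl. rring.
  - rewrite !sum_Sn, IH. unfold zfold, a.
    replace (Z.of_nat (S N) + 1)%Z with (Z.of_nat (S (S N))) by lia.
    replace (- Z.of_nat (S N) - 1 + 1)%Z with (- Z.of_nat (S N))%Z by lia.
    replace (- Z.of_nat (S N) - 1)%Z with (- Z.of_nat (S (S N)))%Z by lia.
    rring. }
assert (Ha : is_lim_seq (fun N => a (S N)) (0 - 0)).
{ unfold a. apply is_lim_seq_minus'.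
  - apply (is_lim_seq_incr_1 (fun n => g (Z.of_nat n))). apply is_lim_seq_abs_0.
    now apply ex_series_lim_0.
  - apply is_lim_seq_abs_0. apply is_lim_seq_ext with (2 := ex_series_lim_0 _ H2).
    intros n. do 2 f_equal. lia. }
apply is_series_unique.
replace (zsum g) with (zsum g + (0 - 0)) by rring.
change (is_lim_seq (sum_n (zfold (fun n => g (n + 1)%Z))) (zsum g + (0 - 0))).
apply (is_lim_seq_ext (fun N => sum_n (zfold g) N + a (S N))). auto.
apply is_lim_seq_plus'; auto.
apply (Series_correct _ (zsummable_ex _ H)).
Qed.

Lemma zsum_shift_nat g (k : nat) : zsummable g ->
  zsummable (fun n => g (n + Z.of_nat k)%Z) /\ zsum (fun n => g (n + Z.of_nat k)%Z) = zsum g.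
Proof.
intros H. induction k as [|k [IH1 IH2]].
- split. apply zsummable_ext with (2 := H). intros n; f_equal; lia.
  apply zsum_ext. intros n; f_equal; lia.
- destruct (zsum_shift_1 _ IH1) as [H1 H2]. split.
  + apply zsummable_ext with (2 := H1). intros n; f_equal; lia.
  + rewrite <- IH2, <- H2. apply zsum_ext. intros n; f_equal; lia.
Qed.

Lemma zsum_shift g (z : Z) : zsummable g ->
  zsummable (fun n => g (n + z)%Z) /\ zsum (fun n => g (n + z)%Z) = zsum g.
Proof.
intros H. destruct (Z_le_gt_dec 0 z) as [Hz|Hz].
- replace z with (Z.of_nat (Z.to_nat z)) by lia. now apply zsum_shift_nat.
- destruct (zsum_shift_nat _ (Z.to_nat (- z)) (zsummable_reflect g H)) as [H1 H2].
  apply zsummable_reflect in H1. rewrite <- zsum_reflect in H2.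
  assert (E : forall n, (- (- n - 1 + Z.of_nat (Z.to_nat (- z))) - 1 = n + z)%Z) by (intros; lia).
  split.
  + apply zsummable_ext with (2 := H1). intros n. now rewrite E.
  + rewrite <- (zsum_reflect g). rewrite <- H2. apply zsum_ext. intros n. now rewrite E.
Qed.

Lemma zsum_neg g : zsummable g ->
  zsummable (fun n => g (- n)%Z) /\ zsum (fun n => g (- n)%Z) = zsum g.
Proof.
intros H. destruct (zsum_shift_1 g H) as [H1 H2]. split.
- apply zsummable_ext with (2 := zsummable_reflect _ H1). intros n; f_equal; lia.
- rewrite <- H2, <- (zsum_reflect (fun n => g (n + 1)%Z)). apply zsum_ext. intros n; f_equal; lia.
Qed.

Lemma zsum_odd g : zsummable g -> (forall n, g (- n)%Z = - g n) -> zsum g = 0.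
Proof.
intros H Ho. assert (E := proj2 (zsum_neg g H)).
rewrite (zsum_ext _ (fun n => -1 * g n)), zsum_scal_l in E. lra.
intros n; rewrite Ho; rring.
Qed.

Lemma zsum_half_odd g : (forall n, g (- n - 1)%Z = - g n) -> zsum g = 0.
Proof.
intros Ho. assert (E := zsum_reflect g).
rewrite (zsum_ext _ (fun n => -1 * g n)), zsum_scal_l in E. lra.
intros n; rewrite Ho; rring.
Qed.

(** Every partial sum of the regrouped series is a partial sum of g. *)
Lemma zsum_even_odd g : ex_series (zfold g) ->
  is_series (zfold (fun j => g (2 * j)%Z + g (2 * j + 1)%Z)) (zsum g).
Proof.
intros H.
assert (Hsum : forall N, sum_n (zfold g) (2 * N + 1) =
   sum_n (zfold (fun j => g (2 * j)%Z + g (2 * j + 1)%Z)) N).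
{ induction N as [|N IH].
  - simpl. rewrite sum_Sn, !sum_O. unfold plus, zfold; simpl. rring.
  - replace (2 * S N + 1)%nat with (S (S (2 * N + 1))) by lia.
    rewrite !sum_Sn, IH. unfold zfold.
    replace (Z.of_nat (S (2 * N + 1))) with (2 * Z.of_nat (S N))%Z by lia.
    replace (Z.of_nat (S (S (2 * N + 1)))) with (2 * Z.of_nat (S N) + 1)%Z by lia.
    replace (- (2 * Z.of_nat (S N)) - 1)%Z with (2 * (- Z.of_nat (S N) - 1) + 1)%Z by lia.
    replace (- (2 * Z.of_nat (S N) + 1) - 1)%Z with (2 * (- Z.of_nat (S N) - 1))%Z by lia.
    rring. }
change (is_lim_seq (sum_n (zfold (fun j => g (2 * j)%Z + g (2 * j + 1)%Z))) (zsum g)).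
apply (is_lim_seq_ext (fun N => sum_n (zfold g) (2 * N + 1))); auto.
apply (is_lim_seq_subseq (sum_n (zfold g)) (zsum g) (fun N => (2 * N + 1)%nat)).
- apply eventually_subseq. intros n; lia.
- apply (Series_correct _ H).
Qed.

Lemma zsum_term_le b n : zsummable b -> Rabs (b n) <= zsum (fun n => Rabs (b n)).
Proof.
intros H.
assert (Hf : forall k, Rabs (b (Z.of_nat k)) + Rabs (b (- Z.of_nat k - 1)%Z) <=
     zsum (fun n => Rabs (b n))).
{ intros k. unfold zsum.
  eapply Rle_trans; [|apply sum_n_le_series with (N := k)].
  - destruct k as [|k]. rewrite sum_O. unfold zfold; lra.
    rewrite sum_Sn.
    match goal with |- ?x <= plus ?a ?b => change (x <= a + b) end.
    assert (0 <= sum_n (zfold (fun n0 => Rabs (b n0))) k).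
    { eapply Rle_trans; [apply (Rabs_pos (sum_n (zfold b) k))|].
      eapply Rle_trans; [apply sum_n_abs_le|]. apply sum_n_m_le. apply zfold_abs. }
    unfold zfold at 2. lra.
  - intros j. apply Rplus_le_le_0_compat; apply Rabs_pos.
  - apply H. }
destruct (Z_le_gt_dec 0 n) as [Hn|Hn].
- specialize (Hf (Z.to_nat n)). rewrite Z2Nat.id in Hf by auto.
  assert (HH := Rabs_pos (b (- n - 1)%Z)). lra.
- specialize (Hf (Z.to_nat (- n - 1))). rewrite Z2Nat.id in Hf by lia.
  replace (- (- n - 1) - 1)%Z with n in Hf by lia.
  assert (HH := Rabs_pos (b (- n - 1)%Z)). lra.
Qed.

Lemma zsum_fubini (g : Z -> Z -> R) (Bd : Z -> R) :
  (forall m, zsummable (g m)) -> (forall m, zsum (fun n => Rabs (g m n)) <= Bd m) ->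
  zsummable Bd ->
  ex_series (zfold (fun n => zsum (fun m => g m n))) /\
  zsum (fun m => zsum (g m)) = zsum (fun n => zsum (fun m => g m n)).
Proof.
intros Hg Hle HB.
assert (Habs : forall m n, Rabs (g m n) <= Bd m).
{ intros m n. eapply Rle_trans; [now apply zsum_term_le|apply Hle]. }
assert (Hcol : forall n, zsummable (fun m => g m n)).
{ intros n. now apply zsummable_dominated with Bd. }
set (a := fun i n => zfold (g (Z.of_nat i)) n + zfold (g (- Z.of_nat i - 1)%Z) n).
assert (Hrow : forall i, zfold (fun m => zsum (g m)) i = Series (a i)).
{ intros i. unfold zfold at 1, zsum, a. rewrite Series_plus; auto; now apply zsummable_ex. }
assert (Hc : forall n, zfold (fun n => zsum (fun m => g m n)) n = Series (fun i => a i n)).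
{ intros n. unfold zfold at 1, zsum.
  rewrite <- Series_plus by (now apply zsummable_ex).
  apply Series_ext. intros i. unfold a, zfold. rring. }
destruct (fubini_series a (zfold Bd)) as [_ [_ HF]].
- intros i N.
  assert (Hpos : forall m j, 0 <= zfold (fun n0 => Rabs (g m n0)) j).
  { intros m j. apply Rplus_le_le_0_compat; apply Rabs_pos. }
  apply Rle_trans with (sum_n (zfold (fun n => Rabs (g (Z.of_nat i) n))) N +
     sum_n (zfold (fun n => Rabs (g (- Z.of_nat i - 1)%Z n))) N).
  + match goal with |- _ <= ?a + ?b => change (a + b) with (plus a b) end.
    rewrite <- sum_n_plus. apply sum_n_m_le. intros n.
    unfold a. eapply Rle_trans; [apply Rabs_triang|].
    apply Rplus_le_compat; apply zfold_abs.
  + apply Rplus_le_compat; eapply Rle_trans; try apply Hle; apply sum_n_le_series; auto; apply Hg.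
- now apply zsummable_ex.
- split.
  + apply ex_series_ext with (fun n => Series (fun i => a i n)). auto. eexists; apply HF.
  + unfold zsum at 1. rewrite (Series_ext _ _ Hrow), <- (is_series_unique _ _ HF).
    symmetry. apply Series_ext, Hc.
Qed.

Lemma zsummable_abs a : zsummable a -> zsummable (fun n => Rabs (a n)).
Proof.
intros Ha. apply ex_series_ext with (2 := Ha). intros n. unfold zfold. now rewrite !Rabs_Rabsolu.
Qed.

Lemma zsummable_mult_bounded a b C : zsummable a -> (forall n, Rabs (b n) <= C) ->
  zsummable (fun n => a n * b n).
Proof.
intros Ha Hb. apply zsummable_dominated with (fun n => C * Rabs (a n)).
- intros n. rewrite Rabs_mult, Rmult_comm. apply Rmult_le_compat_r; auto. apply Rabs_pos.
- apply zsummable_scal. now apply zsummable_abs.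
Qed.

(** The change of variables m = l + j, n = l - j (and m = l + 1 + j) on the two
    cosets of pairs of integers with given parity of m + n. *)
Lemma zsum_product a b : zsummable a -> zsummable b ->
  is_series (zfold (fun l => zsum (fun j => a (l + j)%Z * b (l - j)%Z) +
                             zsum (fun j => a (l + 1 + j)%Z * b (l - j)%Z)))
            (zsum a * zsum b).
Proof.
intros Ha Hb.
assert (Hbr : forall m, zsummable (fun N => b (N - m)%Z) /\ zsum (fun N => b (N - m)%Z) = zsum b).
{ intros m. destruct (zsum_shift b (- m) Hb) as [H1 H2]. split.
  - apply zsummable_ext with (2 := H1). intros n; f_equal; lia.
  - rewrite <- H2. apply zsum_ext. intros n; f_equal; lia. }
assert (Hbra : forall m, zsum (fun N => Rabs (b (N - m)%Z)) = zsum (fun n => Rabs (b n))).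
{ intros m. rewrite <- (proj2 (zsum_shift _ (- m) (zsummable_abs b Hb))).
  apply zsum_ext. intros n; do 2 f_equal; lia. }
set (C := zsum (fun n => Rabs (b n))).
destruct (zsum_fubini (fun m N => a m * b (N - m)%Z) (fun m => C * Rabs (a m))) as [HE HF].
- intros m. apply zsummable_scal, Hbr.
- intros m. rewrite (zsum_ext _ (fun N => Rabs (a m) * Rabs (b (N - m)%Z))).
  rewrite zsum_scal_l, Hbra. fold C. lra. intros n. apply Rabs_mult.
- apply zsummable_scal. now apply zsummable_abs.
- replace (zsum a * zsum b) with (zsum (fun m => zsum (fun N => a m * b (N - m)%Z))).
  2:{ rewrite <- zsum_scal_r. apply zsum_ext. intros m. rewrite zsum_scal_l. f_equal.
      apply Hbr. }
  rewrite HF. apply is_series_ext with (2 := zsum_even_odd _ HE).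
  assert (HS : forall N, zsummable (fun m => a m * b (N - m)%Z)).
  { intros N. apply zsummable_mult_bounded with C; auto. intros n. now apply zsum_term_le. }
  assert (HL : forall l, zsum (fun m => a m * b (2 * l - m)%Z) +
      zsum (fun m => a m * b (2 * l + 1 - m)%Z) =
      zsum (fun j => a (l + j)%Z * b (l - j)%Z) + zsum (fun j => a (l + 1 + j)%Z * b (l - j)%Z)).
  { intros l. f_equal.
    + rewrite <- (proj2 (zsum_shift _ l (HS (2 * l)%Z))). apply zsum_ext.
      intros j. f_equal; f_equal; lia.
    + rewrite <- (proj2 (zsum_shift _ (l + 1) (HS (2 * l + 1)%Z))). apply zsum_ext.
      intros j. f_equal; f_equal; lia. }
  intros l. unfold zfold. now rewrite !HL.
Qed.

(** * Theta series *)

Lemma zsummable_trig c f : zsummable c -> (forall n : Z, Rabs (f n) <= 1) ->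
  zsummable (fun n => c n * f n).
Proof. intros H Hf. now apply zsummable_mult_bounded with 1. Qed.

Lemma abs_sin_le x : Rabs (sin x) <= 1.
Proof. apply Rabs_le, SIN_bound. Qed.

Lemma abs_cos_le x : Rabs (cos x) <= 1.
Proof. apply Rabs_le, COS_bound. Qed.

Lemma zsummable_shifted_product a b z : zsummable a -> zsummable b ->
  zsummable (fun j => a (z + j)%Z * b (z - j)%Z) /\
  forall l, zsummable (fun j => a (z + j)%Z * b (l - j)%Z).
Proof.
intros Ha Hb.
assert (Ha' : zsummable (fun j => a (z + j)%Z)).
{ apply zsummable_ext with (2 := proj1 (zsum_shift a z Ha)). intros n; f_equal; lia. }
assert (H : forall l, zsummable (fun j => a (z + j)%Z * b (l - j)%Z)).
{ intros l. apply zsummable_mult_bounded with (zsum (fun n => Rabs (b n))); auto.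
  intros n. now apply zsum_term_le. }
split; auto.
Qed.

(** Form in which the product of two trigonometric series is used below: with
    x = 0, or with y shifted by PI/2, it also covers products of a single pair of
    series. *)
Lemma zsum_product_sin a b (x y : Z -> R) : zsummable a -> zsummable b ->
  is_series (zfold (fun l =>
    zsum (fun j => a (l + j)%Z * b (l - j)%Z * sin (y (l - j)%Z - x (l + j)%Z)) +
    zsum (fun j => a (l + 1 + j)%Z * b (l - j)%Z * sin (y (l - j)%Z - x (l + 1 + j)%Z))))
    (zsum (fun m => a m * cos (x m)) * zsum (fun n => b n * sin (y n)) -
     zsum (fun m => a m * sin (x m)) * zsum (fun n => b n * cos (y n))).
Proof.
intros Ha Hb.
assert (H1 : zsummable (fun m => a m * cos (x m))) by (apply zsummable_trig; auto; intros; apply abs_cos_le).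
assert (H2 : zsummable (fun m => a m * sin (x m))) by (apply zsummable_trig; auto; intros; apply abs_sin_le).
assert (H3 : zsummable (fun m => b m * cos (y m))) by (apply zsummable_trig; auto; intros; apply abs_cos_le).
assert (H4 : zsummable (fun m => b m * sin (y m))) by (apply zsummable_trig; auto; intros; apply abs_sin_le).
assert (P1 := zsum_product _ _ H1 H4). assert (P2 := zsum_product _ _ H2 H3).
assert (P := is_series_minus _ _ _ _ P1 P2).
apply is_series_ext with (2 := P). clear P P1 P2.
assert (HL : forall z l,
  zsum (fun j => a (z + j)%Z * b (l - j)%Z * sin (y (l - j)%Z - x (z + j)%Z)) =
  zsum (fun j => a (z + j)%Z * cos (x (z + j)%Z) * (b (l - j)%Z * sin (y (l - j)%Z))) -
  zsum (fun j => a (z + j)%Z * sin (x (z + j)%Z) * (b (l - j)%Z * cos (y (l - j)%Z)))).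
{ intros z l. rewrite <- zsum_minus.
  - apply zsum_ext. intros j. rewrite sin_minus. ring.
  - apply zsummable_ex. apply (zsummable_shifted_product _ _ z H1 H4).
  - apply zsummable_ex. apply (zsummable_shifted_product _ _ z H2 H3). }
intros n. unfold zfold. rewrite !HL. unfold minus, plus, opp; simpl. rring.
Qed.

(** By the addition formula, since the sine series vanishes by parity in every
    application. *)
Lemma zsum_sin_shift v y x : zsummable v -> zsum (fun j => v j * sin (y j)) = 0 ->
  zsum (fun j => v j * sin (x + y j)) = sin x * zsum (fun j => v j * cos (y j)).
Proof.
intros Hv H0.
rewrite (zsum_ext _ (fun j => sin x * (v j * cos (y j)) + cos x * (v j * sin (y j)))).
2:{ intros j. rewrite sin_plus. ring. }
rewrite zsum_plus, !zsum_scal_l, H0. ring.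
- apply zsummable_ex, zsummable_scal, zsummable_trig; auto. intros; apply abs_cos_le.
- apply zsummable_ex, zsummable_scal, zsummable_trig; auto. intros; apply abs_sin_le.
Qed.

Definition sq (n : Z) : nat := Z.to_nat (n * n).
Definition tri (n : Z) : nat := Z.to_nat (n * (n + 1)).

Lemma sq_Z n : Z.of_nat (sq n) = (n * n)%Z.
Proof. unfold sq. apply Z2Nat.id. nia. Qed.

Lemma tri_Z n : Z.of_nat (tri n) = (n * (n + 1))%Z.
Proof. unfold tri. apply Z2Nat.id. nia. Qed.

Lemma sq_opp n : sq (- n) = sq n.
Proof. apply Nat2Z.inj. rewrite !sq_Z. ring. Qed.

Lemma tri_reflect n : tri (- n - 1) = tri n.
Proof. apply Nat2Z.inj. rewrite !tri_Z. ring. Qed.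

(** Distance of m to the pair {0, -1}, invariant under the reflection m -> - m - 1. *)
Definition zdeg (m : Z) : nat := Z.to_nat (if Z.leb 0 m then m else - m - 1).

Lemma zdeg_reflect m : zdeg (- m - 1) = zdeg m.
Proof. unfold zdeg. destruct (Z.leb_spec 0 m), (Z.leb_spec 0 (- m - 1)); lia. Qed.

Lemma zdeg_nat n : zdeg (Z.of_nat n) = n.
Proof. unfold zdeg. destruct (Z.leb_spec 0 (Z.of_nat n)); lia. Qed.

Lemma zdeg_sq m : (zdeg m <= sq m)%nat.
Proof. assert (H := sq_Z m). unfold zdeg. destruct (Z.leb_spec 0 m); nia. Qed.

Lemma zdeg_tri m : (zdeg m <= tri m)%nat.
Proof. assert (H := tri_Z m). unfold zdeg. destruct (Z.leb_spec 0 m); nia. Qed.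

Lemma zdeg_abs m : Rabs (IZR m) <= INR (zdeg m) + 1.
Proof.
rewrite <- abs_IZR, INR_IZR_INZ. rewrite <- plus_IZR. apply IZR_le.
unfold zdeg. destruct (Z.leb_spec 0 m); lia.
Qed.

Lemma zsummable_geometric_ratio C x c : 0 <= x < 1 ->
  (forall m, Rabs (c m) <= C * x ^ zdeg m) -> zsummable c.
Proof.
intros Hx H. apply ex_series_dominated with (fun n => 2 * C * x ^ n).
- intros n. unfold zfold.
  rewrite Rabs_pos_eq by (apply Rplus_le_le_0_compat; apply Rabs_pos).
  assert (H1 := H (Z.of_nat n)). assert (H2 := H (- Z.of_nat n - 1)%Z).
  rewrite zdeg_reflect in H2. rewrite zdeg_nat in H1, H2. lra.
- apply (ex_series_scal_l (V := R_NormedModule)). exists (/ (1 - x)).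
  apply is_series_geom. rewrite Rabs_pos_eq; lra.
Qed.

Lemma zsummable_geometric C c :
  (forall m, Rabs (c m) <= C * (1/2) ^ zdeg m) -> zsummable c.
Proof. apply zsummable_geometric_ratio; lra. Qed.

Lemma exp_INR_mult n x : exp (INR n * x) = exp x ^ n.
Proof.
induction n as [|n IH]. simpl. rewrite Rmult_0_l, exp_0; auto.
rewrite S_INR. replace ((INR n + 1) * x) with (x + INR n * x) by ring.
rewrite exp_plus, IH. reflexivity.
Qed.

Lemma exp_ge_1 x : 0 <= x -> 1 <= exp x.
Proof. intros H. apply Rle_trans with (1 + x). lra. apply exp_ineq1_le. Qed.

Lemma exp_le_mono x y : x <= y -> exp x <= exp y.
Proof. intros [H|H]. left; now apply exp_increasing. right; now rewrite H. Qed.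

Lemma odd_abs m : Rabs (2 * IZR m + 1) = 2 * INR (zdeg m) + 1.
Proof.
unfold zdeg. rewrite INR_IZR_INZ, Z2Nat.id by (destruct (Z.leb_spec 0 m); lia).
rewrite <- !mult_IZR, <- !plus_IZR, <- abs_IZR. f_equal.
destruct (Z.leb_spec 0 m); lia.
Qed.

Ltac zdeg_lra m := generalize (zdeg_abs m) (pos_INR (zdeg m)); unfold Rabs;
  repeat destruct Rcase_abs; lra.

(** The elementary estimate behind every convergence statement below: a power
    of q of at least linear degree beats an exponential of linear growth once
    q is small. *)
Lemma weight_bound r A n d : 0 <= r -> 0 <= A -> r * exp (2 * A) <= 1/2 -> (n <= d)%nat ->
  r ^ d * exp ((2 * INR n + 1) * A) <= exp A * (1/2) ^ n.
Proof.
intros Hr HA Hq Hd.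
assert (He : 1 <= exp (2 * A)) by (apply exp_ge_1; lra).
assert (Hr1 : r <= 1).
{ apply Rle_trans with (r * exp (2 * A)); [|lra].
  rewrite <- (Rmult_1_r r) at 1. apply Rmult_le_compat_l; auto. }
assert (Hpow : r ^ d <= r ^ n).
{ replace d with (n + (d - n))%nat by lia. rewrite pow_add.
  rewrite <- (Rmult_1_r (r ^ n)) at 2. apply Rmult_le_compat_l; [now apply pow_le|].
  rewrite <- (pow1 (d - n)). apply pow_incr; lra. }
replace ((2 * INR n + 1) * A) with (A + INR n * (2 * A)) by ring.
rewrite exp_plus, exp_INR_mult.
apply Rle_trans with (r ^ n * (exp A * exp (2 * A) ^ n)).
{ apply Rmult_le_compat_r; auto. apply Rmult_le_pos; [left; apply exp_pos|].
  apply pow_le; lra. }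
replace (r ^ n * (exp A * exp (2 * A) ^ n)) with (exp A * (r * exp (2 * A)) ^ n)
  by (rewrite Rpow_mult_distr; ring).
apply Rmult_le_compat_l. left; apply exp_pos.
apply pow_incr. split; auto. apply Rmult_le_pos; lra.
Qed.

Lemma theta_coef_bound q A (d : Z -> nat) (mu : Z -> R) :
  0 <= A -> Rabs q * exp (2 * A) <= 1/2 ->
  (forall m, (zdeg m <= d m)%nat) ->
  (forall m, Rabs (mu m) <= (2 * INR (zdeg m) + 1) * A) ->
  forall m, Rabs (q ^ d m * exp (mu m)) <= exp A * (1/2) ^ zdeg m.
Proof.
intros HA Hq Hd Hmu m.
eapply Rle_trans; [|apply (weight_bound (Rabs q) A (zdeg m) (d m)); auto; apply Rabs_pos].
rewrite Rabs_mult, <- RPow_abs. apply Rmult_le_compat_l. apply pow_le, Rabs_pos.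
rewrite (Rabs_pos_eq (exp _)) by (left; apply exp_pos).
apply exp_le_mono. eapply Rle_trans; [apply Rle_abs|apply Hmu].
Qed.

Lemma theta_coef_bound0 q A (d : Z -> nat) :
  0 <= A -> Rabs q * exp (2 * A) <= 1/2 ->
  (forall m, (zdeg m <= d m)%nat) ->
  forall m, Rabs (q ^ d m) <= exp A * (1/2) ^ zdeg m.
Proof.
intros HA Hq Hd m. replace (q ^ d m) with (q ^ d m * exp 0) by (rewrite exp_0; ring).
apply (theta_coef_bound q A d (fun _ => 0)); auto.
intros n. rewrite Rabs_R0. apply Rmult_le_pos; auto.
assert (HH := pos_INR (zdeg n)). lra.
Qed.

(** Every exponent of the theta series below is s times an integer form in m of
    this size, so A >= 4 |s| makes it admissible for weight_bound. *)
Lemma linear_exponent_bound m s A (x : R) : 4 * Rabs s <= A -> Rabs x <= 4 * INR (zdeg m) + 4 ->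
  Rabs (x * s) <= (2 * INR (zdeg m) + 1) * A.
Proof.
intros HA Hx. rewrite Rabs_mult. assert (H0 := Rabs_pos s). assert (HI := pos_INR (zdeg m)).
apply Rle_trans with ((4 * INR (zdeg m) + 4) * Rabs s).
apply Rmult_le_compat_r; auto.
apply Rle_trans with ((2 * INR (zdeg m) + 1) * (4 * Rabs s)).
replace ((2 * INR (zdeg m) + 1) * (4 * Rabs s)) with ((8 * INR (zdeg m) + 4) * Rabs s) by ring.
apply Rmult_le_compat_r; lra.
apply Rmult_le_compat_l; lra.
Qed.

(** In terms of complex numbers N1 + i N2 is e^(i t) theta_3(kap t + i s), and Th,
    Ev, Od are theta_4, theta_3, theta_2 with nomes q, q^2, q^2, up to the
    power of q that would make the exponents of Od squares; Gf is, up to the same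
    kind of factor, the imaginary part of e^(i d) theta_2(kap d + i s), and Hf is
    theta_2(i s). U and V are the coefficients of the bracket of N with its
    translate by d on the basis Ev, Od of second-order theta functions. *)
Definition N1 (kap s q t : R) : R :=
  zsum (fun m => q ^ sq m * exp (2 * IZR m * s) * cos ((1 - 2 * IZR m * kap) * t)).
Definition N2 (kap s q t : R) : R :=
  zsum (fun m => q ^ sq m * exp (2 * IZR m * s) * sin ((1 - 2 * IZR m * kap) * t)).
Definition Th (kap q t : R) : R :=
  zsum (fun m => (- q) ^ sq m * cos (2 * IZR m * kap * t)).
Definition Ev (kap q x : R) : R :=
  zsum (fun j => q ^ (2 * sq j) * cos (2 * IZR j * kap * x)).
Definition Od (kap q x : R) : R :=
  zsum (fun j => q ^ (2 * tri j) * cos ((2 * IZR j + 1) * kap * x)).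
Definition U (kap s q d : R) : R :=
  zsum (fun l => q ^ (2 * sq l) * exp (4 * IZR l * s) * sin ((1 - 2 * IZR l * kap) * d)).
Definition V (kap s q d : R) : R :=
  zsum (fun l => q ^ (2 * tri l) * exp ((4 * IZR l + 2) * s) *
                 sin ((1 - (2 * IZR l + 1) * kap) * d)).
Definition Gf (kap s q d : R) : R :=
  zsum (fun m => q ^ tri m * exp ((2 * IZR m + 1) * s) *
                 sin ((1 - (2 * IZR m + 1) * kap) * d)).
Definition Hf (s q : R) : R :=
  zsum (fun m => q ^ tri m * exp ((2 * IZR m + 1) * s)).

Lemma pow_zdeg_double (f : Z -> nat) : (forall m, (zdeg m <= f m)%nat) ->
  forall m, (zdeg m <= 2 * f m)%nat.
Proof. intros H m; specialize (H m); lia. Qed.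

Lemma pow_opp_even q n : (- q) ^ (2 * n) = q ^ (2 * n).
Proof. rewrite !pow_mult. f_equal. ring. Qed.

(** * Addition formulas *)

Ltac theta_exponent := apply Nat2Z.inj;
  rewrite ?Nat2Z.inj_add, ?Nat2Z.inj_mul, ?sq_Z, ?tri_Z; simpl Z.of_nat; ring.

Ltac theta_phase := match goal with |- _ * sin ?w = _ * (_ * sin ?w') =>
  replace w with w' by (rewrite ?plus_IZR, ?minus_IZR; field) end.

(* Collects a product of two weights q^a exp u, q^b exp v into q^n exp x. *)
Ltac theta_merge n x :=
  match goal with |- ?q ^ ?a * exp ?u * (?q ^ ?b * exp ?v) * _ = _ =>
    replace (q ^ a * exp u * (q ^ b * exp v)) with (q ^ (n) * exp x);
    [rewrite !pow_add, ?pow_1; theta_phase; ring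
    |transitivity (q ^ (a + b) * exp (u + v));
      [f_equal; f_equal; [theta_exponent|rewrite ?plus_IZR, ?minus_IZR; ring]
      |rewrite pow_add, exp_plus; ring]] end.

Section ThetaIdentities.
Variables (kap s q A : R).
Hypothesis A_pos : 0 <= A.
Hypothesis s_small : 4 * Rabs s <= A.
Hypothesis q_small : Rabs q * exp (2 * A) <= 1/2.

Lemma bound_N m : Rabs (q ^ sq m * exp (2 * IZR m * s)) <= exp A * (1/2) ^ zdeg m.
Proof.
apply (theta_coef_bound q A sq (fun m => 2 * IZR m * s)); auto. apply zdeg_sq.
intros n. apply linear_exponent_bound; auto. zdeg_lra n.
Qed.

Lemma bound_Th m : Rabs ((- q) ^ sq m) <= exp A * (1/2) ^ zdeg m.
Proof. apply theta_coef_bound0; auto. now rewrite Rabs_Ropp. apply zdeg_sq. Qed.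

Lemma bound_Ev m : Rabs (q ^ (2 * sq m)) <= exp A * (1/2) ^ zdeg m.
Proof. apply (theta_coef_bound0 q A (fun m => 2 * sq m)%nat); auto. apply pow_zdeg_double, zdeg_sq. Qed.

Lemma bound_Od m : Rabs (q ^ (2 * tri m)) <= exp A * (1/2) ^ zdeg m.
Proof. apply (theta_coef_bound0 q A (fun m => 2 * tri m)%nat); auto. apply pow_zdeg_double, zdeg_tri. Qed.

Lemma bound_U m : Rabs (q ^ (2 * sq m) * exp (4 * IZR m * s)) <= exp A * (1/2) ^ zdeg m.
Proof.
apply (theta_coef_bound q A (fun m => 2 * sq m)%nat (fun m => 4 * IZR m * s)); auto.
apply pow_zdeg_double, zdeg_sq. intros n. apply linear_exponent_bound; auto. zdeg_lra n.
Qed.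

Lemma bound_V m : Rabs (q ^ (2 * tri m) * exp ((4 * IZR m + 2) * s)) <= exp A * (1/2) ^ zdeg m.
Proof.
apply (theta_coef_bound q A (fun m => 2 * tri m)%nat (fun m => (4 * IZR m + 2) * s)); auto.
apply pow_zdeg_double, zdeg_tri. intros n. apply linear_exponent_bound; auto.
replace (4 * IZR n + 2) with (2 * (2 * IZR n + 1)) by ring.
rewrite Rabs_mult, odd_abs, Rabs_pos_eq; lra.
Qed.

Lemma bound_H m : Rabs (q ^ tri m * exp ((2 * IZR m + 1) * s)) <= exp A * (1/2) ^ zdeg m.
Proof.
apply (theta_coef_bound q A tri (fun m => (2 * IZR m + 1) * s)); auto. apply zdeg_tri.
intros n. apply linear_exponent_bound; auto. zdeg_lra n.
Qed.

Definition sum_N := zsummable_geometric _ _ bound_N.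
Definition sum_Th := zsummable_geometric _ _ bound_Th.
Definition sum_Ev := zsummable_geometric _ _ bound_Ev.
Definition sum_Od := zsummable_geometric _ _ bound_Od.
Definition sum_U := zsummable_geometric _ _ bound_U.
Definition sum_V := zsummable_geometric _ _ bound_V.
Definition sum_H := zsummable_geometric _ _ bound_H.

Lemma Ev_sin_zero x : zsum (fun j => q ^ (2 * sq j) * sin (2 * IZR j * kap * x)) = 0.
Proof.
apply zsum_odd.
- apply zsummable_trig. apply sum_Ev. intros; apply abs_sin_le.
- intros n. rewrite sq_opp, opp_IZR.
  replace (2 * - IZR n * kap * x) with (- (2 * IZR n * kap * x)) by ring.
  rewrite sin_neg. ring.
Qed.

Lemma Od_sin_zero x : zsum (fun j => q ^ (2 * tri j) * sin ((2 * IZR j + 1) * kap * x)) = 0.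
Proof.
apply zsum_half_odd.
intros n. rewrite tri_reflect, minus_IZR, opp_IZR.
replace ((2 * (- IZR n - 1) + 1) * kap * x) with (- ((2 * IZR n + 1) * kap * x)) by ring.
rewrite sin_neg. ring.
Qed.

Lemma inner_Ev (T : Z -> R) c w y :
  (forall j, T j = c * (q ^ (2 * sq j) * sin (w + 2 * IZR j * kap * y))) ->
  zsum T = c * sin w * Ev kap q y.
Proof.
intros H. rewrite (zsum_ext _ _ H), zsum_scal_l, Rmult_assoc. f_equal.
apply (zsum_sin_shift (fun j => q ^ (2 * sq j)) (fun j => 2 * IZR j * kap * y)).
apply sum_Ev. apply Ev_sin_zero.
Qed.

Lemma inner_Od (T : Z -> R) c w y :
  (forall j, T j = c * (q ^ (2 * tri j) * sin (w + (2 * IZR j + 1) * kap * y))) ->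
  zsum T = c * sin w * Od kap q y.
Proof.
intros H. rewrite (zsum_ext _ _ H), zsum_scal_l, Rmult_assoc. f_equal.
apply (zsum_sin_shift (fun j => q ^ (2 * tri j)) (fun j => (2 * IZR j + 1) * kap * y)).
apply sum_Od. apply Od_sin_zero.
Qed.

Lemma zsum_of_is_series g l : is_series (zfold g) l -> zsum g = l.
Proof. apply is_series_unique. Qed.

Lemma zsum_combine u v X Y : zsummable u -> zsummable v ->
  zsum (fun l => u l * X + v l * Y) = zsum u * X + zsum v * Y.
Proof.
intros Hu Hv. rewrite zsum_plus, !zsum_scal_r. reflexivity.
- apply zsummable_ex. apply zsummable_ext with (fun l => X * u l). intros; ring. now apply zsummable_scal.
- apply zsummable_ex. apply zsummable_ext with (fun l => Y * v l). intros; ring. now apply zsummable_scal.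
Qed.

Lemma sum_U_sin d : zsummable (fun l => q ^ (2 * sq l) * exp (4 * IZR l * s) *
  sin ((1 - 2 * IZR l * kap) * d)).
Proof. apply zsummable_trig. apply sum_U. intros; apply abs_sin_le. Qed.

Lemma sum_V_sin d : zsummable (fun l => q ^ (2 * tri l) * exp ((4 * IZR l + 2) * s) *
                 sin ((1 - (2 * IZR l + 1) * kap) * d)).
Proof. apply zsummable_trig. apply sum_V. intros; apply abs_sin_le. Qed.

(** In both parity classes of m + n the double sum separates: the weight is a
    function of l times a function of j, and the phase is a multiple of t' - t
    indexed by l plus a multiple of t + t' indexed by j. *)
Lemma bracket_N t t' :
  N1 kap s q t * N2 kap s q t' - N2 kap s q t * N1 kap s q t' =
  U kap s q (t' - t) * Ev kap q (t + t') + q * V kap s q (t' - t) * Od kap q (t + t').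
Proof.
unfold N1, N2.
rewrite <- (zsum_of_is_series _ _ (zsum_product_sin _ _ (fun m => (1 - 2 * IZR m * kap) * t)
   (fun n => (1 - 2 * IZR n * kap) * t') sum_N sum_N)).
rewrite (Rmult_comm q), Rmult_assoc. unfold U, V.
rewrite <- (zsum_combine _ _ _ _ (sum_U_sin _) (sum_V_sin _)).
apply zsum_ext. intros l. f_equal.
- rewrite (inner_Ev _ (q ^ (2 * sq l) * exp (4 * IZR l * s)) ((1 - 2 * IZR l * kap) * (t' - t)) (t + t')).
  ring. intros j. theta_merge (2 * sq l + 2 * sq j)%nat (4 * IZR l * s).
- rewrite (inner_Od _ (q * (q ^ (2 * tri l) * exp ((4 * IZR l + 2) * s)))
    ((1 - (2 * IZR l + 1) * kap) * (t' - t)) (t + t')).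
  ring. intros j. theta_merge (1 + (2 * tri l + 2 * tri j))%nat ((4 * IZR l + 2) * s).
Qed.

(** The sign (-1)^(m^2 + n^2) is the parity of m + n, so only the odd class
    changes sign. *)
Lemma product_Th t t' :
  Th kap q t * Th kap q t' =
  Ev kap q (t' - t) * Ev kap q (t + t') - q * Od kap q (t' - t) * Od kap q (t + t').
Proof.
assert (Hz : zsum (fun m => (- q) ^ sq m * sin (2 * IZR m * kap * t)) = 0).
{ apply zsum_odd. apply zsummable_trig. apply sum_Th. intros; apply abs_sin_le.
  intros n. rewrite sq_opp, opp_IZR.
  replace (2 * - IZR n * kap * t) with (- (2 * IZR n * kap * t)) by ring.
  rewrite sin_neg. ring. }
assert (Ev_even : Ev kap q (- (t + t')) = Ev kap q (t + t')).
{ apply zsum_ext. intros j. f_equal. rewrite <- cos_neg. f_equal. ring. }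
assert (Od_even : Od kap q (- (t + t')) = Od kap q (t + t')).
{ apply zsum_ext. intros j. f_equal. rewrite <- cos_neg. f_equal. ring. }
(* The second factor is written with sines shifted by PI/2; the products of
   sines that the addition formula then calls for vanish by Hz. *)
assert (P := zsum_of_is_series _ _ (zsum_product_sin _ _ (fun m => 2 * IZR m * kap * t)
   (fun n => PI / 2 + 2 * IZR n * kap * t') sum_Th sum_Th)).
cbv beta in P. rewrite Hz in P.
replace (zsum (fun n => (- q) ^ sq n * sin (PI / 2 + 2 * IZR n * kap * t'))) with (Th kap q t') in P.
2:{ apply zsum_ext. intros n. now rewrite cos_sin. }
rewrite Rmult_0_l, Rminus_0_r in P.
change (zsum (fun m => (- q) ^ sq m * cos (2 * IZR m * kap * t))) with (Th kap q t) in P.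
rewrite <- P.
transitivity (zsum (fun j => q ^ (2 * sq j) * cos (2 * IZR j * kap * (t' - t))) * Ev kap q (t + t') +
  zsum (fun j => q ^ (2 * tri j) * cos ((2 * IZR j + 1) * kap * (t' - t))) * (- q * Od kap q (t + t'))).
2:{ unfold Ev, Od. ring. }
rewrite <- zsum_combine.
2:{ apply zsummable_trig. apply sum_Ev. intros; apply abs_cos_le. }
2:{ apply zsummable_trig. apply sum_Od. intros; apply abs_cos_le. }
apply zsum_ext. intros l. f_equal.
- rewrite (inner_Ev _ (q ^ (2 * sq l)) (PI / 2 + 2 * IZR l * kap * (t' - t)) (- (t + t'))).
  rewrite <- cos_sin, Ev_even. ring. intros j.
  rewrite <- pow_add. replace (sq (l + j) + sq (l - j))%nat with (2 * sq l + 2 * sq j)%nat by theta_exponent.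
  rewrite pow_add, !pow_opp_even. theta_phase. ring.
- rewrite (inner_Od _ (- q * q ^ (2 * tri l)) (PI / 2 + (2 * IZR l + 1) * kap * (t' - t)) (- (t + t'))).
  rewrite <- cos_sin, Od_even. ring. intros j.
  rewrite <- pow_add.
  replace (sq (l + 1 + j) + sq (l - j))%nat with (1 + (2 * tri l + 2 * tri j))%nat by theta_exponent.
  rewrite pow_add, pow_1, pow_add, !pow_opp_even. theta_phase. ring.
Qed.

(** This identity makes the bracket of N proportional to Th t * Th t' when Gf
    vanishes at t' - t. *)
Lemma UV_relation d :
  U kap s q d * Od kap q d + V kap s q d * Ev kap q d = Hf s q * Gf kap s q d.
Proof.
(* Here odd m + n produces the weights of U shifted by one. *)
assert (P := zsum_of_is_series _ _ (zsum_product_sin _ _ (fun m => 0)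
   (fun n => (1 - (2 * IZR n + 1) * kap) * d) sum_H sum_H)).
cbv beta in P. replace (zsum (fun m => q ^ tri m * exp ((2 * IZR m + 1) * s) * sin 0)) with 0 in P.
2:{ rewrite (zsum_ext _ (fun m => 0 * 1)). rewrite zsum_scal_l; ring. intros; rewrite sin_0; ring. }
replace (zsum (fun m => q ^ tri m * exp ((2 * IZR m + 1) * s) * cos 0)) with (Hf s q) in P.
2:{ apply zsum_ext. intros; rewrite cos_0; ring. }
change (zsum (fun n => q ^ tri n * exp ((2 * IZR n + 1) * s) *
  sin ((1 - (2 * IZR n + 1) * kap) * d))) with (Gf kap s q d) in P.
rewrite Rmult_0_l, Rminus_0_r in P. rewrite <- P.
destruct (zsum_shift_1 _ (sum_U_sin d)) as [Hs1 Hs2].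
unfold U. rewrite <- Hs2. unfold V. rewrite Rplus_comm.
rewrite <- (zsum_combine _ _ _ _ (sum_V_sin _) Hs1).
apply zsum_ext. intros l. symmetry. f_equal.
- rewrite (inner_Ev _ (q ^ (2 * tri l) * exp ((4 * IZR l + 2) * s)) ((1 - (2 * IZR l + 1) * kap) * d) d).
  ring. intros j. theta_merge (2 * tri l + 2 * sq j)%nat ((4 * IZR l + 2) * s).
- rewrite (inner_Od _ (q ^ (2 * sq (l + 1)) * exp (4 * IZR (l + 1) * s)) ((1 - 2 * IZR (l + 1) * kap) * d) d).
  ring. intros j. theta_merge (2 * sq (l + 1) + 2 * tri j)%nat (4 * IZR (l + 1) * s).
Qed.

End ThetaIdentities.

(** * Derivatives of trigonometric series *)

Lemma is_derive_quadratic (f : R -> R) (t l K delta : R) : 0 < delta ->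
  (forall h, Rabs h < delta -> Rabs (f (t + h) - f t - h * l) <= K * h ^ 2) ->
  is_derive f t l.
Proof.
intros Hd H. apply is_derive_Reals. intros eps Heps.
assert (HK : 0 < Rabs K + 1) by (generalize (Rabs_pos K); lra).
assert (Hd' : 0 < Rmin delta (eps / (Rabs K + 1))).
{ apply Rmin_glb_lt; auto. now apply Rdiv_lt_0_compat. }
exists (mkposreal _ Hd'). intros h Hh Hlt. simpl in Hlt.
assert (H1 : Rabs h < delta) by (eapply Rlt_le_trans; [apply Hlt|apply Rmin_l]).
assert (H2 : Rabs h < eps / (Rabs K + 1)) by (eapply Rlt_le_trans; [apply Hlt|apply Rmin_r]).
specialize (H h H1).
replace ((f (t + h) - f t) / h - l) with ((f (t + h) - f t - h * l) / h) by (field; auto).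
unfold Rdiv. rewrite Rabs_mult, Rabs_inv.
assert (Hh0 : 0 < Rabs h) by (now apply Rabs_pos_lt).
apply Rmult_lt_reg_r with (Rabs h); auto.
rewrite Rmult_assoc, Rinv_l, Rmult_1_r by lra.
apply Rle_lt_trans with (Rabs K * Rabs h * Rabs h).
- eapply Rle_trans; [apply H|]. rewrite <- (pow2_abs h).
  replace (Rabs K * Rabs h * Rabs h) with (Rabs K * Rabs h ^ 2) by ring.
  apply Rmult_le_compat_r. apply pow_le; lra. apply Rle_abs.
- apply Rmult_lt_compat_r; auto.
  apply Rle_lt_trans with ((Rabs K + 1) * Rabs h).
  apply Rmult_le_compat_r; lra.
  apply Rlt_le_trans with ((Rabs K + 1) * (eps / (Rabs K + 1))).
  apply Rmult_lt_compat_l; auto. right; field; lra.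
Qed.

Lemma is_derive_inj (f : R -> R) (x l1 l2 : R) :
  is_derive f x l1 -> is_derive f x l2 -> l1 = l2.
Proof.
intros H1 H2. now rewrite <- (is_derive_unique _ _ _ H1), <- (is_derive_unique _ _ _ H2).
Qed.

Lemma PS_ex_derive r B f : 0 < r -> PS r B f -> ex_derive f 0.
Proof.
intros Hr H. assert (HB := PS_bound_nonneg r B f (Rlt_le _ _ Hr) H).
destruct H as [a [H1 H2]].
assert (Hpos : forall n, 0 <= Rabs (a n) * r ^ n).
{ intros n. apply Rmult_le_pos; [apply Rabs_pos|apply pow_le; lra]. }
assert (Hs : ex_series (fun n => Rabs (a n) * r ^ n)) by now apply ex_series_of_bounded_sums with B.
assert (Htail : Series (fun n => Rabs (a (2 + n)%nat) * r ^ (2 + n)) <= B).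
{ apply Rle_trans with (Series (fun n => Rabs (a n) * r ^ n)); [|now apply series_le_of_sums].
  rewrite (Series_incr_n (fun n => Rabs (a n) * r ^ n) 2) by (lia || auto). simpl sum_f_R0.
  generalize (Hpos 0%nat) (Hpos 1%nat); simpl; lra. }
assert (E : forall p, Rabs p <= r ->
  f p = a 0%nat + a 1%nat * p + Series (fun n => a (2 + n)%nat * p ^ (2 + n))).
{ intros p Hp. rewrite <- (is_series_unique _ _ (H2 p Hp)), (Series_incr_n _ 2).
  simpl. ring. lia. eexists. now apply H2. }
exists (a 1%nat). apply is_derive_quadratic with (B / r ^ 2) r; auto. intros h Hh.
rewrite Rplus_0_l, (E h), (E 0) by (rewrite ?Rabs_R0; lra).
rewrite (Series_ext (fun n => a (2 + n)%nat * 0 ^ (2 + n)) (fun n => 0 * 0)) by (intros; simpl; ring).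
rewrite Series_scal_l.
match goal with |- Rabs ?x <= _ => replace x with (Series (fun n => a (2 + n)%nat * h ^ (2 + n))) by ring end.
apply Rle_trans with (h ^ 2 / r ^ 2 * Series (fun n => Rabs (a (2 + n)%nat) * r ^ (2 + n))).
- rewrite <- Series_scal_l. apply series_abs_le.
  + intros n. rewrite Rabs_mult, !pow_add, Rabs_mult, (Rabs_pos_eq (h ^ 2)) by apply pow2_ge_0.
    replace (h ^ 2 / r ^ 2 * (Rabs (a (2 + n)%nat) * (r ^ 2 * r ^ n)))
      with (Rabs (a (2 + n)%nat) * (h ^ 2 * r ^ n)) by (field; lra).
    apply Rmult_le_compat_l; [apply Rabs_pos|]. apply Rmult_le_compat_l; [apply pow2_ge_0|].
    apply pow_abs_le; lra.
  + apply (ex_series_scal_l (V := R_NormedModule)).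
    now apply (ex_series_incr_n (fun n => Rabs (a n) * r ^ n) 2).
- replace (B / r ^ 2 * h ^ 2) with (h ^ 2 / r ^ 2 * B) by (field; lra).
  apply Rmult_le_compat_l; auto. apply Rdiv_le_0_compat; [apply pow2_ge_0|now apply pow_lt].
Qed.

Lemma cos_lipschitz x h : Rabs (cos (x + h) - cos x) <= Rabs h.
Proof.
destruct (MVT_gen cos x (x + h) (fun c => - sin c)) as [c [_ Hc]].
- intros c _. auto_derive; auto; ring.
- intros c _. apply continuity_cos.
- rewrite Hc. replace (x + h - x) with h by ring. rewrite Rabs_mult, Rabs_Ropp.
  rewrite <- (Rmult_1_l (Rabs h)) at 2. apply Rmult_le_compat_r. apply Rabs_pos. apply abs_sin_le.
Qed.

Lemma sin_taylor x h : Rabs (sin (x + h) - sin x - h * cos x) <= h ^ 2.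
Proof.
destruct (MVT_gen sin x (x + h) cos) as [c [Hr Hc]].
- intros c _. auto_derive; auto; ring.
- intros c _. apply continuity_sin.
- rewrite Hc. replace (cos c * (x + h - x) - h * cos x) with (h * (cos (x + (c - x)) - cos x)).
  2:{ replace (x + (c - x)) with c by ring. ring. }
  rewrite Rabs_mult, <- (pow2_abs h). simpl. rewrite Rmult_1_r.
  apply Rmult_le_compat_l. apply Rabs_pos.
  eapply Rle_trans; [apply cos_lipschitz|].
  unfold Rmin, Rmax in Hr. unfold Rabs.
  destruct (Rle_dec x (x + h)); repeat destruct Rcase_abs; lra.
Qed.

(** Termwise differentiation: the second-order Taylor bound of each sine is
    summable, so the difference quotient converges with an O(h) error. *)
Lemma is_derive_zsum_sin (c om ph : Z -> R) t :
  zsummable c -> zsummable (fun m => c m * om m) -> zsummable (fun m => c m * om m ^ 2) ->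
  is_derive (fun t => zsum (fun m => c m * sin (om m * t + ph m))) t
            (zsum (fun m => c m * om m * cos (om m * t + ph m))).
Proof.
intros H0 H1 H2.
assert (S0 : forall t, zsummable (fun m => c m * sin (om m * t + ph m))).
{ intros; apply zsummable_trig; auto. intros; apply abs_sin_le. }
assert (S1 : forall t, zsummable (fun m => c m * om m * cos (om m * t + ph m))).
{ intros; apply zsummable_trig; auto. intros; apply abs_cos_le. }
apply is_derive_quadratic with (K := zsum (fun m => Rabs (c m * om m ^ 2))) (delta := 1).
lra. intros h _.
rewrite <- zsum_minus by (now apply zsummable_ex).
rewrite <- zsum_scal_l.
rewrite <- zsum_minus.
2:{ apply zsummable_ex. apply zsummable_ext with (fun m => c m * sin (om m * (t + h) + ph m) + (-1) * (c m * sin (om m * t + ph m))).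
    intros; ring. apply zsummable_plus; auto. now apply zsummable_scal. }
2:{ now apply zsummable_ex, zsummable_scal. }
rewrite <- zsum_scal_r. apply zsum_abs_le.
- intros m.
  replace (c m * sin (om m * (t + h) + ph m) - c m * sin (om m * t + ph m) -
    h * (c m * om m * cos (om m * t + ph m))) with
   (c m * (sin ((om m * t + ph m) + om m * h) - sin (om m * t + ph m) - (om m * h) * cos (om m * t + ph m))).
  2:{ replace (om m * (t + h) + ph m) with (om m * t + ph m + om m * h) by ring. ring. }
  rewrite (Rabs_mult (c m) (om m ^ 2)), (Rmult_assoc (Rabs (c m)) (Rabs (om m ^ 2))), (Rabs_mult (c m) (_ - _)). apply Rmult_le_compat_l. apply Rabs_pos.
  eapply Rle_trans; [apply sin_taylor|].
  rewrite Rpow_mult_distr. right. f_equal. symmetry; apply Rabs_pos_eq, pow2_ge_0.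
- apply zsummable_ext with (fun m => h ^ 2 * Rabs (c m * om m ^ 2)). intros; ring.
  now apply zsummable_scal, zsummable_abs.
Qed.

(** * Smooth functions *)

(** n-fold differentiability, peeling off the first derivative: unlike the n-th
    derivative itself, this recursion passes through products and inverses by the
    Leibniz and quotient rules. *)
Fixpoint diffn (n : nat) (f : R -> R) : Prop :=
  match n with
  | O => True
  | S n => (forall t, ex_derive f t) /\ diffn n (Derive f)
  end.

Lemma diffn_ex_derive_n n f : (forall n, diffn n f) -> forall t, ex_derive_n f n t.
Proof.
assert (H : forall n f, diffn (S n) f -> forall t, ex_derive_n f (S n) t).
{ clear. induction n as [|n IH]; intros f [H1 H2] t. apply H1.
  simpl. apply ex_derive_ext with (Derive_n (Derive f) n).
  - intros u. transitivity (Derive_n f (n + 1) u).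
    apply (Derive_n_comp f n 1). now rewrite Nat.add_comm.
  - apply (IH (Derive f) H2 t). }
intros Hf t. destruct n as [|n]. exact I. apply H, Hf.
Qed.

Lemma diffn_pred n f : diffn (S n) f -> diffn n f.
Proof.
revert f. induction n as [|n IH]; intros f H. exact I.
destruct H as [H1 H2]. split; auto.
Qed.

Lemma diffn_plus n f g : diffn n f -> diffn n g -> diffn n (fun t => f t + g t).
Proof.
revert f g. induction n as [|n IH]; intros f g Hf Hg. exact I.
destruct Hf as [F1 F2], Hg as [G1 G2]. split.
- intros t. apply (ex_derive_plus (V := R_NormedModule)); auto.
- replace (Derive (fun t => f t + g t)) with (fun t => Derive f t + Derive g t).
  now apply IH. apply functional_extensionality; intros t. now rewrite Derive_plus.
Qed.

Lemma diffn_mult n f g : diffn n f -> diffn n g -> diffn n (fun t => f t * g t).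
Proof.
revert f g. induction n as [|n IH]; intros f g Hf Hg. exact I.
assert (Hf' := diffn_pred n f Hf). assert (Hg' := diffn_pred n g Hg).
destruct Hf as [F1 F2], Hg as [G1 G2]. split.
- intros t. apply ex_derive_mult; auto.
- replace (Derive (fun t => f t * g t)) with (fun t => Derive f t * g t + f t * Derive g t).
  apply diffn_plus; now apply IH. apply functional_extensionality; intros t. now rewrite Derive_mult.
Qed.

Lemma diffn_const n c : diffn n (fun _ => c).
Proof.
revert c. induction n as [|n IH]; intros c. exact I. split.
- intros t. apply ex_derive_const.
- replace (Derive (fun _ : R => c)) with (fun _ : R => 0). apply IH.
  apply functional_extensionality; intros t. now rewrite Derive_const.
Qed.

Lemma diffn_inv n f : (forall t, f t <> 0) -> diffn n f -> diffn n (fun t => / f t).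
Proof.
intros H0. induction n as [|n IH]; intros Hf. exact I.
assert (Hf' := diffn_pred n f Hf). destruct Hf as [F1 F2]. split.
- intros t. apply ex_derive_inv; auto.
- replace (Derive (fun t => / f t)) with (fun t => (-1) * Derive f t * (/ f t * / f t)).
  + apply diffn_mult. apply diffn_mult; auto. apply diffn_const. apply diffn_mult; auto.
  + apply functional_extensionality; intros t. rewrite Derive_inv; auto. field. auto.
Qed.

Lemma diffn_sin_affine n w ph : diffn n (fun t => sin (w * t + ph)).
Proof.
revert ph. induction n as [|n IH]; intros ph. exact I. split.
- intros t. auto_derive; auto.
- replace (Derive (fun t => sin (w * t + ph))) with (fun t => w * sin (w * t + (ph + PI / 2))).
  apply diffn_mult; auto. apply diffn_const.
  apply functional_extensionality; intros t. symmetry. apply is_derive_unique.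
  auto_derive; auto. replace (w * t + (ph + PI / 2)) with (PI / 2 + (w * t + ph)) by ring.
  rewrite <- cos_sin. rring.
Qed.

Lemma diffn_sin n w : diffn n (fun t => sin (w * t)).
Proof.
replace (fun t => sin (w * t)) with (fun t => sin (w * t + 0)). apply diffn_sin_affine.
apply functional_extensionality; intros t. now rewrite Rplus_0_r.
Qed.

Lemma diffn_cos n w : diffn n (fun t => cos (w * t)).
Proof.
replace (fun t => cos (w * t)) with (fun t => sin (w * t + PI / 2)). apply diffn_sin_affine.
apply functional_extensionality; intros t. rewrite cos_sin. f_equal; ring.
Qed.

Lemma diffn_cos_1 n : diffn n cos.
Proof.
replace cos with (fun t => cos (1 * t)). apply diffn_cos.
apply functional_extensionality; intros t. now rewrite Rmult_1_l.
Qed.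

Lemma diffn_sin_1 n : diffn n sin.
Proof.
replace sin with (fun t => sin (1 * t)). apply diffn_sin.
apply functional_extensionality; intros t. now rewrite Rmult_1_l.
Qed.

Definition rapid (c om : Z -> R) : Prop := forall j, zsummable (fun m => c m * om m ^ j).

Lemma diffn_zsum_sin n c om ph : rapid c om ->
  diffn n (fun t => zsum (fun m => c m * sin (om m * t + ph m))).
Proof.
revert c ph. induction n as [|n IH]; intros c ph H. exact I.
assert (D : forall t, is_derive (fun t => zsum (fun m => c m * sin (om m * t + ph m))) t
            (zsum (fun m => c m * om m * cos (om m * t + ph m)))).
{ intros t. apply is_derive_zsum_sin.
  - apply zsummable_ext with (2 := H 0%nat). intros; ring.
  - apply zsummable_ext with (2 := H 1%nat). intros; ring.
  - apply (H 2%nat). }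
split.
- intros t. eexists; apply D.
- replace (Derive _) with
    (fun t => zsum (fun m => (c m * om m) * sin (om m * t + (ph m + PI / 2)))).
  + apply (IH (fun m => c m * om m) (fun m => ph m + PI / 2)).
    intros j. apply zsummable_ext with (2 := H (S j)). intros; simpl; ring.
  + apply functional_extensionality; intros t.
    transitivity (zsum (fun m => c m * om m * cos (om m * t + ph m))).
    2:{ symmetry. apply is_derive_unique, D. }
    apply zsum_ext. intros m. rewrite cos_sin. do 2 f_equal. ring.
Qed.

Lemma diffn_zsum_cos n c om ph : rapid c om ->
  diffn n (fun t => zsum (fun m => c m * cos (om m * t + ph m))).
Proof.
intros H. replace (fun t => zsum (fun m => c m * cos (om m * t + ph m))) with
  (fun t => zsum (fun m => c m * sin (om m * t + (ph m + PI / 2)))).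
apply (diffn_zsum_sin n c om (fun m => ph m + PI / 2) H).
apply functional_extensionality; intros t. apply zsum_ext. intros m.
rewrite cos_sin. do 2 f_equal. ring.
Qed.

Lemma pow_le_fact_exp x j : 0 <= x -> x ^ j <= INR (fact j) * exp x.
Proof.
intros Hx.
assert (Hp : forall n, 0 <= / INR (fact n) * x ^ n).
{ intros n. apply Rmult_le_pos; [left; apply Rinv_0_lt_compat, INR_fact_lt_0|now apply pow_le]. }
assert (He := is_series_exp x).
assert (Hle : / INR (fact j) * x ^ j <= exp x).
{ rewrite <- (is_series_unique _ _ He). eapply Rle_trans; [|apply sum_n_le_series with (N := j); auto; eexists; apply He].
  destruct j as [|j]. rewrite sum_O; lra. rewrite sum_Sn.
  match goal with |- ?a <= plus ?b ?c => change (a <= b + c) end.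
  assert (0 <= sum_n (fun i => / INR (fact i) * x ^ i) j); [|lra].
  apply Rle_trans with (Rabs (sum_n (fun i => / INR (fact i) * x ^ i) j)). apply Rabs_pos.
  eapply Rle_trans; [apply sum_n_abs_le|].
  apply sum_n_m_le. intros i. rewrite Rabs_pos_eq; auto. apply Rle_refl. }
apply Rmult_le_reg_l with (/ INR (fact j)). apply Rinv_0_lt_compat, INR_fact_lt_0.
rewrite <- Rmult_assoc, Rinv_l, Rmult_1_l; auto. apply INR_fact_neq_0.
Qed.

Lemma exp_half_lt_2 : exp (1/2) < 2.
Proof.
apply Rnot_le_lt. intros H.
assert (E : exp (1/2) * exp (1/2) = exp 1) by (rewrite <- exp_plus; f_equal; field).
assert (H3 := exp_le_3). nra.
Qed.

(** The j-th power of a frequency is at most a constant times exp(zdeg m / 2), and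
    exp(1/2) < 2. *)
Lemma rapid_geometric C K c om : 0 <= C ->
  (forall m, Rabs (c m) <= C * (1/2) ^ zdeg m) ->
  (forall m, Rabs (om m) <= K * (INR (zdeg m) + 1)) -> rapid c om.
Proof.
intros HC Hc Hom j.
assert (HK : 0 <= K).
{ assert (HH := Hom 0%Z). assert (HP := Rabs_pos (om 0%Z)).
  unfold zdeg in HH; simpl in HH. lra. }
set (P := INR (fact j) * (2 * K) ^ j * exp (1/2)).
assert (He := exp_pos (1/2)). assert (He2 := exp_half_lt_2).
apply zsummable_geometric_ratio with (C := C * P) (x := exp (1/2) / 2). lra.
intros m. rewrite Rabs_mult, <- RPow_abs.
assert (HI := pos_INR (zdeg m)).
assert (Hp : Rabs (om m) ^ j <= P * exp (1/2) ^ zdeg m).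
{ apply Rle_trans with ((2 * K) ^ j * ((INR (zdeg m) + 1) / 2) ^ j).
  - rewrite <- Rpow_mult_distr. apply pow_incr. split. apply Rabs_pos.
    eapply Rle_trans; [apply Hom|]. right; field.
  - unfold P. replace (INR (fact j) * (2 * K) ^ j * exp (1/2) * exp (1/2) ^ zdeg m) with
     ((2 * K) ^ j * (INR (fact j) * exp ((INR (zdeg m) + 1) / 2))).
    + apply Rmult_le_compat_l. apply pow_le; lra. apply pow_le_fact_exp. lra.
    + replace ((INR (zdeg m) + 1) / 2) with (1/2 + INR (zdeg m) * (1/2)) by field.
      rewrite exp_plus, exp_INR_mult. ring. }
replace (C * P * (exp (1/2) / 2) ^ zdeg m) with ((C * (1/2) ^ zdeg m) * (P * exp (1/2) ^ zdeg m)).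
apply Rmult_le_compat; auto. apply Rabs_pos. apply pow_le, Rabs_pos.
unfold Rdiv. rewrite (Rpow_mult_distr (exp (1 * / 2)) (/ 2)). 
replace (1 * / 2) with (/ 2) by ring. ring.
Qed.

(** * The curve attached to a nome *)

(** Derivatives of U, V, Gf at d = 0. *)
Definition Ud (kap s q : R) : R :=
  zsum (fun l => q ^ (2 * sq l) * exp (4 * IZR l * s) * (1 - 2 * IZR l * kap)).
Definition Vd (kap s q : R) : R :=
  zsum (fun l => q ^ (2 * tri l) * exp ((4 * IZR l + 2) * s) * (1 - (2 * IZR l + 1) * kap)).
Definition Gd (kap s q : R) : R :=
  zsum (fun m => q ^ tri m * exp ((2 * IZR m + 1) * s) * (1 - (2 * IZR m + 1) * kap)).

Lemma frequency_bound (kap : R) (b : R) m : Rabs b <= 1 ->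
  Rabs (1 - (2 * IZR m + b) * kap) <= (1 + 3 * Rabs kap) * (INR (zdeg m) + 1).
Proof.
intros Hb. assert (HI := pos_INR (zdeg m)). assert (Hz := zdeg_abs m). assert (Hk := Rabs_pos kap).
apply Rle_trans with (1 + 3 * (INR (zdeg m) + 1) * Rabs kap).
- unfold Rminus. eapply Rle_trans; [apply Rabs_triang|]. rewrite Rabs_R1, Rabs_Ropp, Rabs_mult.
  apply Rplus_le_compat_l, Rmult_le_compat_r; auto.
  eapply Rle_trans; [apply Rabs_triang|]. rewrite Rabs_mult, (Rabs_pos_eq 2) by lra. lra.
- nra.
Qed.

Lemma frequency_bound0 kap m :
  Rabs (1 - 2 * IZR m * kap) <= (1 + 3 * Rabs kap) * (INR (zdeg m) + 1).
Proof.
replace (2 * IZR m) with (2 * IZR m + 0) by ring.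
apply frequency_bound. rewrite Rabs_R0; lra.
Qed.

Lemma frequency_bound_theta kap b m : Rabs b <= 1 ->
  Rabs ((2 * IZR m + b) * kap) <= (1 + 3 * Rabs kap) * (INR (zdeg m) + 1).
Proof.
intros Hb. assert (HI := pos_INR (zdeg m)). assert (Hz := zdeg_abs m). assert (Hk := Rabs_pos kap).
apply Rle_trans with (3 * (INR (zdeg m) + 1) * Rabs kap).
- rewrite Rabs_mult. apply Rmult_le_compat_r; auto.
  eapply Rle_trans; [apply Rabs_triang|]. rewrite Rabs_mult, (Rabs_pos_eq 2) by lra. lra.
- nra.
Qed.

Lemma frequency_bound_even kap m :
  Rabs (2 * IZR m * kap) <= (1 + 3 * Rabs kap) * (INR (zdeg m) + 1).
Proof.
replace (2 * IZR m) with (2 * IZR m + 0) by ring.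
apply frequency_bound_theta. rewrite Rabs_R0; lra.
Qed.

Lemma rapid_summable c om :
  rapid c om -> zsummable c /\ zsummable (fun m => c m * om m) /\ zsummable (fun m => c m * om m ^ 2).
Proof.
intros H. repeat split.
- apply zsummable_ext with (2 := H 0%nat). intros; ring.
- apply zsummable_ext with (2 := H 1%nat). intros; ring.
- apply H.
Qed.

Lemma is_derive_sin_series c om t : rapid c om ->
  is_derive (fun t => zsum (fun m => c m * sin (om m * t))) t
            (zsum (fun m => c m * om m * cos (om m * t))).
Proof.
intros H. destruct (rapid_summable _ _ H) as (H0 & H1 & H2).
replace (zsum (fun m => c m * om m * cos (om m * t))) with
  (zsum (fun m => c m * om m * cos (om m * t + 0))).
2:{ apply zsum_ext; intros; now rewrite Rplus_0_r. }
apply is_derive_ext with (fun t => zsum (fun m => c m * sin (om m * t + 0))).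
intros u. apply zsum_ext; intros; now rewrite Rplus_0_r.
now apply (is_derive_zsum_sin c om (fun _ => 0)).
Qed.

Lemma diffn_sin_series n c om : rapid c om -> diffn n (fun t => zsum (fun m => c m * sin (om m * t))).
Proof.
intros H. replace (fun t => zsum (fun m => c m * sin (om m * t))) with
  (fun t => zsum (fun m => c m * sin (om m * t + 0))).
now apply (diffn_zsum_sin n c om (fun _ => 0)).
apply functional_extensionality; intros t. apply zsum_ext; intros; now rewrite Rplus_0_r.
Qed.

Lemma diffn_cos_series n c om : rapid c om -> diffn n (fun t => zsum (fun m => c m * cos (om m * t))).
Proof.
intros H. replace (fun t => zsum (fun m => c m * cos (om m * t))) with
  (fun t => zsum (fun m => c m * cos (om m * t + 0))).
now apply (diffn_zsum_cos n c om (fun _ => 0)).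
apply functional_extensionality; intros t. apply zsum_ext; intros; now rewrite Rplus_0_r.
Qed.

Section FixedNome.
Variables (kap s q A : R).
Hypothesis A_pos : 0 <= A.
Hypothesis s_small : 4 * Rabs s <= A.
Hypothesis q_small : Rabs q * exp (2 * A) <= 1/2.

Lemma rapid_N : rapid (fun m => q ^ sq m * exp (2 * IZR m * s)) (fun m => 1 - 2 * IZR m * kap).
Proof.
apply rapid_geometric with (2 := bound_N s q A A_pos s_small q_small) (3 := frequency_bound0 kap).
left; apply exp_pos.
Qed.

Lemma rapid_Th : rapid (fun m => (- q) ^ sq m) (fun m => 2 * IZR m * kap).
Proof.
apply rapid_geometric with (2 := bound_Th q A A_pos q_small) (3 := frequency_bound_even kap).
left; apply exp_pos.
Qed.

Lemma rapid_Ev : rapid (fun m => q ^ (2 * sq m)) (fun m => 2 * IZR m * kap).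
Proof.
apply rapid_geometric with (2 := bound_Ev q A A_pos q_small) (3 := frequency_bound_even kap).
left; apply exp_pos.
Qed.

Lemma rapid_Od : rapid (fun m => q ^ (2 * tri m)) (fun m => (2 * IZR m + 1) * kap).
Proof.
apply rapid_geometric with (2 := bound_Od q A A_pos q_small) (K := 1 + 3 * Rabs kap).
left; apply exp_pos. intros m. apply frequency_bound_theta. rewrite Rabs_R1; lra.
Qed.

Lemma rapid_U : rapid (fun m => q ^ (2 * sq m) * exp (4 * IZR m * s)) (fun m => 1 - 2 * IZR m * kap).
Proof.
apply rapid_geometric with (2 := bound_U s q A A_pos s_small q_small) (3 := frequency_bound0 kap).
left; apply exp_pos.
Qed.

Lemma rapid_V : rapid (fun m => q ^ (2 * tri m) * exp ((4 * IZR m + 2) * s))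
  (fun m => 1 - (2 * IZR m + 1) * kap).
Proof.
apply rapid_geometric with (2 := bound_V s q A A_pos s_small q_small) (K := 1 + 3 * Rabs kap).
left; apply exp_pos. intros m. apply frequency_bound. rewrite Rabs_R1; lra.
Qed.

Lemma rapid_G : rapid (fun m => q ^ tri m * exp ((2 * IZR m + 1) * s))
  (fun m => 1 - (2 * IZR m + 1) * kap).
Proof.
apply rapid_geometric with (2 := bound_H s q A A_pos s_small q_small) (K := 1 + 3 * Rabs kap).
left; apply exp_pos. intros m. apply frequency_bound. rewrite Rabs_R1; lra.
Qed.

Lemma series_at_0 c om : zsum (fun m => c m * sin (om m * 0)) = 0.
Proof.
rewrite (zsum_ext _ (fun m => 0 * 1)). rewrite zsum_scal_l; ring.
intros m. rewrite Rmult_0_r, sin_0. ring.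
Qed.

Lemma is_derive_sin_series_0 c om : rapid c om ->
  is_derive (fun t => zsum (fun m => c m * sin (om m * t))) 0 (zsum (fun m => c m * om m)).
Proof.
intros H. replace (zsum (fun m => c m * om m)) with (zsum (fun m => c m * om m * cos (om m * 0))).
now apply is_derive_sin_series.
apply zsum_ext; intros m. rewrite Rmult_0_r, cos_0. ring.
Qed.

Lemma U_0 : U kap s q 0 = 0. Proof. apply series_at_0. Qed.
Lemma V_0 : V kap s q 0 = 0. Proof. apply series_at_0. Qed.
Lemma is_derive_U_0 : is_derive (U kap s q) 0 (Ud kap s q).
Proof. apply is_derive_sin_series_0, rapid_U. Qed.
Lemma is_derive_V_0 : is_derive (V kap s q) 0 (Vd kap s q).
Proof. apply is_derive_sin_series_0, rapid_V. Qed.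
Lemma is_derive_G_0 : is_derive (Gf kap s q) 0 (Gd kap s q).
Proof. apply is_derive_sin_series_0, rapid_G. Qed.

Lemma ex_derive_Ev t : ex_derive (Ev kap q) t.
Proof. apply (diffn_cos_series 1 _ _ rapid_Ev). Qed.
Lemma ex_derive_Od t : ex_derive (Od kap q) t.
Proof. apply (diffn_cos_series 1 _ _ rapid_Od). Qed.
Lemma diffn_N1 n : diffn n (N1 kap s q).
Proof. apply (diffn_cos_series n _ _ rapid_N). Qed.
Lemma diffn_N2 n : diffn n (N2 kap s q).
Proof. apply (diffn_sin_series n _ _ rapid_N). Qed.
Lemma diffn_Th n : diffn n (Th kap q).
Proof. apply (diffn_cos_series n _ _ rapid_Th). Qed.

(** The infinitesimal form at d = 0 of the relation between U, V and Gf. *)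
Lemma Ud_Vd_relation : Ud kap s q * Od kap q 0 + Vd kap s q * Ev kap q 0 = Hf s q * Gd kap s q.
Proof.
assert (D1 : is_derive (fun d => U kap s q d * Od kap q d + V kap s q d * Ev kap q d) 0
  ((Ud kap s q * Od kap q 0 + U kap s q 0 * Derive (Od kap q) 0) +
   (Vd kap s q * Ev kap q 0 + V kap s q 0 * Derive (Ev kap q) 0))).
{ apply (is_derive_plus (V := R_NormedModule)).
  - apply (is_derive_mult (U kap s q) (Od kap q)). apply is_derive_U_0.
    apply Derive_correct, ex_derive_Od. intros; apply Rmult_comm.
  - apply (is_derive_mult (V kap s q) (Ev kap q)). apply is_derive_V_0.
    apply Derive_correct, ex_derive_Ev. intros; apply Rmult_comm. }
assert (D2 : is_derive (fun d => Hf s q * Gf kap s q d) 0 (Hf s q * Gd kap s q)).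
{ apply is_derive_scal, is_derive_G_0. }
apply is_derive_ext with (g := fun d => Hf s q * Gf kap s q d) in D1.
2:{ intros d. apply UV_relation with A; auto. }
rewrite (is_derive_inj _ _ _ _ D2 D1), U_0, V_0. ring.
Qed.

(** Derivative of bracket_N in t' at t' = t. *)
Lemma wronskian_N t :
  N1 kap s q t * Derive (N2 kap s q) t - N2 kap s q t * Derive (N1 kap s q) t =
  Ud kap s q * Ev kap q (t + t) + q * Vd kap s q * Od kap q (t + t).
Proof.
assert (E1 : ex_derive (N1 kap s q) t) by apply (diffn_N1 1).
assert (E2 : ex_derive (N2 kap s q) t) by apply (diffn_N2 1).
assert (D1 : is_derive (fun t' => N1 kap s q t * N2 kap s q t' - N2 kap s q t * N1 kap s q t') t
  (N1 kap s q t * Derive (N2 kap s q) t - N2 kap s q t * Derive (N1 kap s q) t)).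
{ apply (is_derive_minus (V := R_NormedModule)); apply is_derive_scal; now apply Derive_correct. }
apply is_derive_ext with
  (g := fun t' => U kap s q (t' - t) * Ev kap q (t + t') + q * (V kap s q (t' - t) * Od kap q (t + t'))) in D1.
2:{ intros t'. rewrite bracket_N with (A := A); auto. rring. }
assert (Dm : is_derive (fun t' => t' - t) t 1) by (auto_derive; auto; rring).
assert (Dp : is_derive (fun t' => t + t') t 1) by (auto_derive; auto; rring).
assert (Hc : forall F l, is_derive F 0 l -> is_derive (fun t' => F (t' - t)) t (1 * l)).
{ intros F l H. apply (is_derive_comp F (fun t' => t' - t)); auto.
  now replace (t - t) with 0 by ring. }
assert (Hp : forall F, ex_derive F (t + t) -> is_derive (fun t' => F (t + t')) t (1 * Derive F (t + t))).
{ intros F H. apply (is_derive_comp F (fun t' => t + t')); auto. now apply Derive_correct. }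
assert (D2 : is_derive (fun t' => U kap s q (t' - t) * Ev kap q (t + t') + q * (V kap s q (t' - t) * Od kap q (t + t'))) t
   ((1 * Ud kap s q * Ev kap q (t + t) + U kap s q (t - t) * (1 * Derive (Ev kap q) (t + t))) +
    q * (1 * Vd kap s q * Od kap q (t + t) + V kap s q (t - t) * (1 * Derive (Od kap q) (t + t))))).
{ apply (is_derive_plus (V := R_NormedModule)).
  - apply (is_derive_mult (fun t' => U kap s q (t' - t)) (fun t' => Ev kap q (t + t'))).
    apply Hc, is_derive_U_0. apply Hp, ex_derive_Ev. intros; apply Rmult_comm.
  - apply is_derive_scal.
    apply (is_derive_mult (fun t' => V kap s q (t' - t)) (fun t' => Od kap q (t + t'))).
    apply Hc, is_derive_V_0. apply Hp, ex_derive_Od. intros; apply Rmult_comm. }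
rewrite (is_derive_inj _ _ _ _ D1 D2). replace (t - t) with 0 by ring. rewrite U_0, V_0. ring.
Qed.

Definition theta_curve (lam t : R) : vec :=
  (lam * (N1 kap s q t * / Th kap q t), lam * (N2 kap s q t * / Th kap q t)).

Hypothesis Th_neq : forall t, Th kap q t <> 0.

Lemma theta_curve_smooth lam : smooth (theta_curve lam).
Proof.
assert (Hf : forall F, (forall n, diffn n F) -> forall n t,
   ex_derive_n (fun t => lam * (F t * / Th kap q t)) n t).
{ intros F HF n. apply diffn_ex_derive_n. intros m. apply diffn_mult. apply diffn_const.
  apply diffn_mult; auto. apply diffn_inv; auto. apply diffn_Th. }
intros n t. split; simpl.
- apply (Hf (N1 kap s q) diffn_N1).
- apply (Hf (N2 kap s q) diffn_N2).
Qed.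

(** When Gd = 0 the Wronskian of N is a multiple of Th^2, with factor Ud / Ev 0. *)
Lemma theta_curve_centroaffine lam : Ev kap q 0 <> 0 -> Gd kap s q = 0 ->
  lam ^ 2 * Ud kap s q = Ev kap q 0 -> centroaffine (theta_curve lam).
Proof.
intros HE HG Hl. split. apply theta_curve_smooth. intros t.
assert (E1 : ex_derive (N1 kap s q) t) by apply (diffn_N1 1).
assert (E2 : ex_derive (N2 kap s q) t) by apply (diffn_N2 1).
assert (E3 : ex_derive (Th kap q) t) by apply (diffn_Th 1).
assert (HT := Th_neq t).
unfold bracket, velocity, theta_curve. simpl fst. simpl snd.
assert (HD : forall F, ex_derive F t -> Derive (fun t => lam * (F t * / Th kap q t)) t =
   lam * (Derive F t * / Th kap q t + F t * (- Derive (Th kap q) t / Th kap q t ^ 2))).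
{ intros F HF. rewrite Derive_scal, Derive_mult, Derive_inv; auto. now apply ex_derive_inv. }
rewrite !HD by auto.
assert (HW := wronskian_N t). assert (HR := Ud_Vd_relation). rewrite HG, Rmult_0_r in HR.
assert (HTT := product_Th kap q A A_pos q_small t t).
replace (t - t) with 0 in HTT by ring.
assert (HV : Vd kap s q = - Ud kap s q * Od kap q 0 / Ev kap q 0).
{ apply Rmult_eq_reg_r with (Ev kap q 0); auto. unfold Rdiv. rewrite Rmult_assoc, Rinv_l; auto. lra. }
assert (HW2 : Ev kap q 0 * (Ud kap s q * Ev kap q (t + t) + q * Vd kap s q * Od kap q (t + t)) =
   Ud kap s q * (Th kap q t * Th kap q t)).
{ rewrite HTT, HV. field. auto. }
rewrite <- HW in HW2.
apply Rmult_eq_reg_l with (Ev kap q 0); auto.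
transitivity (lam ^ 2 * (Ev kap q 0 * (N1 kap s q t * Derive (N2 kap s q) t - N2 kap s q t * Derive (N1 kap s q) t))
   / Th kap q t ^ 2).
- field. auto.
- rewrite HW2.
  transitivity (lam ^ 2 * Ud kap s q). field; auto. rewrite Hl. ring.
Qed.

(** When Gf al = 0 the bracket of N with its translate is a multiple of
    Th t * Th (t + al), and the theta factors cancel. *)
Lemma theta_curve_bracket lam al : Ev kap q al <> 0 -> Gf kap s q al = 0 ->
  forall t, bracket (theta_curve lam t) (theta_curve lam (t + al)) =
    lam ^ 2 * (U kap s q al * / Ev kap q al).
Proof.
intros HE HG t.
assert (HB := bracket_N kap s q A A_pos s_small q_small t (t + al)).
assert (HTT := product_Th kap q A A_pos q_small t (t + al)).
assert (HR := UV_relation kap s q A A_pos s_small q_small al). rewrite HG, Rmult_0_r in HR.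
replace (t + al - t) with al in * by ring.
assert (HV : V kap s q al = - U kap s q al * Od kap q al / Ev kap q al).
{ apply Rmult_eq_reg_r with (Ev kap q al); auto. unfold Rdiv. rewrite Rmult_assoc, Rinv_l; auto. lra. }
rewrite HV in HB.
unfold bracket, theta_curve. simpl fst. simpl snd.
assert (H1 := Th_neq t). assert (H2 := Th_neq (t + al)).
transitivity (lam ^ 2 * (N1 kap s q t * N2 kap s q (t + al) - N2 kap s q t * N1 kap s q (t + al))
   / (Th kap q t * Th kap q (t + al))).
field; auto. rewrite HB, HTT.
assert (H3 : Th kap q t * Th kap q (t + al) <> 0) by (apply Rmult_integral_contrapositive; auto).
rewrite HTT in H3. field. split; auto.
Qed.

End FixedNome.

(** Anti-periodicity is visible on the frequencies: those of N are odd and those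
    of Th even when kap is an integer. *)
Lemma theta_curve_anti_periodic (k : nat) s q lam :
  anti_periodic (theta_curve (INR k) s q lam).
Proof.
intros t.
assert (H2 : forall z x, sin (x + 2 * IZR z * PI) = sin x /\ cos (x + 2 * IZR z * PI) = cos x).
{ intros z x. destruct (Z_le_gt_dec 0 z) as [Hz|Hz].
  - rewrite <- (Z2Nat.id z Hz), <- INR_IZR_INZ. split. apply sin_period. apply cos_period.
  - assert (E : x = (x + 2 * IZR z * PI) + 2 * INR (Z.to_nat (- z)) * PI).
    { rewrite INR_IZR_INZ, Z2Nat.id, opp_IZR by lia. ring. }
    split. rewrite E at 2. now rewrite sin_period. rewrite E at 2. now rewrite cos_period. }
assert (Hodd : forall m, sin ((1 - 2 * IZR m * INR k) * (t + PI)) = - sin ((1 - 2 * IZR m * INR k) * t) /\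
                         cos ((1 - 2 * IZR m * INR k) * (t + PI)) = - cos ((1 - 2 * IZR m * INR k) * t)).
{ intros m. replace ((1 - 2 * IZR m * INR k) * (t + PI)) with
    ((1 - 2 * IZR m * INR k) * t + PI + 2 * IZR (- (m * Z.of_nat k)) * PI).
  - destruct (H2 (- (m * Z.of_nat k))%Z ((1 - 2 * IZR m * INR k) * t + PI)) as [-> ->].
    split. apply neg_sin. apply neg_cos.
  - rewrite opp_IZR, mult_IZR, <- INR_IZR_INZ. ring. }
assert (HT : Th (INR k) q (t + PI) = Th (INR k) q t).
{ apply zsum_ext. intros m. f_equal.
  replace (2 * IZR m * INR k * (t + PI)) with (2 * IZR m * INR k * t + 2 * IZR (m * Z.of_nat k) * PI).
  apply H2. rewrite mult_IZR, <- INR_IZR_INZ. ring. }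
assert (HN1 : N1 (INR k) s q (t + PI) = - N1 (INR k) s q t).
{ unfold N1. rewrite (zsum_ext _ (fun m => -1 * (q ^ sq m * exp (2 * IZR m * s) * cos ((1 - 2 * IZR m * INR k) * t)))).
  rewrite zsum_scal_l; ring. intros m. rewrite (proj2 (Hodd m)). ring. }
assert (HN2 : N2 (INR k) s q (t + PI) = - N2 (INR k) s q t).
{ unfold N2. rewrite (zsum_ext _ (fun m => -1 * (q ^ sq m * exp (2 * IZR m * s) * sin ((1 - 2 * IZR m * INR k) * t)))).
  rewrite zsum_scal_l; ring. intros m. rewrite (proj1 (Hodd m)). ring. }
unfold theta_curve, vscal. simpl. rewrite HT, HN1, HN2. f_equal; ring.
Qed.

(** * The parameters as analytic functions of the nome *)

Lemma half_lt_1 : Rabs (1/2) < 1.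
Proof. rewrite Rabs_pos_eq; lra. Qed.

Lemma PS_zsum r C (g : Z -> R -> R) : 0 <= r ->
  (forall m, PS r (C * (1/2) ^ zdeg m) (g m)) ->
  PS r (4 * C) (fun q => zsum (fun m => g m q)).
Proof.
intros Hr H. apply PS_mono with (Series (fun n => 2 * C * (1/2) ^ n)).
{ rewrite Series_geom_scal by apply half_lt_1. right; field. }
apply (PS_series r _ (fun n q => zfold (fun m => g m q) n)); auto.
- intros n. unfold zfold.
  apply PS_mono with (C * (1/2) ^ n + C * (1/2) ^ n). right; ring.
  apply PS_plus; auto.
  + assert (HH := H (Z.of_nat n)). now rewrite zdeg_nat in HH.
  + assert (HH := H (- Z.of_nat n - 1)%Z). now rewrite zdeg_reflect, zdeg_nat in HH.
- apply ex_series_geom_scal, half_lt_1.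
Qed.

Lemma implicit_function_zsum (r0 C rho0 : R) (c : Z -> nat -> R -> R) (f : Z -> R -> R -> R) :
  0 < r0 -> 0 < rho0 ->
  (forall m i, PS r0 (C * (1/2) ^ zdeg m) (c m i)) ->
  (forall m x p, is_series (fun i => c m i p * x ^ i) (f m x p)) ->
  (forall m i, m <> 0%Z -> m <> (-1)%Z -> c m i 0 = 0) ->
  c 0%Z 0%nat 0 + c (-1)%Z 0%nat 0 = 0 -> c 0%Z 1%nat 0 + c (-1)%Z 1%nat 0 <> 0 ->
  exists (r rho : R) (x : R -> R), 0 < r <= r0 /\ 0 < rho <= rho0 /\
    PS r rho x /\ x 0 = 0 /\
    forall p, Rabs p <= r -> zsum (fun m => f m (x p) p) = 0.
Proof.
intros Hr Hrho Hc Hf Hz H0 H1.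
apply (implicit_function_series r0 (fun n i p => zfold (fun m => c m i p) n)
   (fun n x p => zfold (fun m => f m x p) n) (fun n => 2 * C * (1/2) ^ n) rho0); auto.
- intros n i. unfold zfold.
  apply PS_mono with (C * (1/2) ^ n + C * (1/2) ^ n). right; ring.
  apply PS_plus; [lra| |].
  + assert (HH := Hc (Z.of_nat n) i). now rewrite zdeg_nat in HH.
  + assert (HH := Hc (- Z.of_nat n - 1)%Z i). now rewrite zdeg_reflect, zdeg_nat in HH.
- apply ex_series_geom_scal, half_lt_1.
- intros n x p. unfold zfold.
  apply is_series_ext with (fun i => plus (c (Z.of_nat n) i p * x ^ i)
     (c (- Z.of_nat n - 1)%Z i p * x ^ i)).
  intros i. rring.
  apply (is_series_plus (V := R_NormedModule)); apply Hf.
- change (zsum (fun m => c m 0%nat 0) = 0). rewrite zsum_triple, (Hz 1%Z), Rplus_0_r by (intros; lia || (apply Hz; lia)). auto.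
- change (zsum (fun m => c m 1%nat 0) <> 0). rewrite zsum_triple, (Hz 1%Z), Rplus_0_r by (intros; lia || (apply Hz; lia)). auto.
Qed.

Lemma PS_theta_term r A (n d : nat) f : 0 <= r -> 0 <= A -> r * exp (2 * A) <= 1/2 ->
  (n <= d)%nat -> PS r (exp ((2 * INR n + 1) * A)) f ->
  PS r (exp A * (1/2) ^ n) (fun q => q ^ d * f q).
Proof.
intros Hr HA Hq Hd Hf. apply PS_mono with (r ^ d * exp ((2 * INR n + 1) * A)).
now apply weight_bound. now apply PS_monomial.
Qed.

Definition small_radius (A : R) : R := exp (- (2 * A)) / 2.

Lemma small_radius_pos A : 0 < small_radius A.
Proof. unfold small_radius. generalize (exp_pos (- (2 * A))); lra. Qed.

Lemma small_radius_spec A r : r <= small_radius A -> r * exp (2 * A) <= 1/2.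
Proof.
intros H. apply Rle_trans with (small_radius A * exp (2 * A)).
apply Rmult_le_compat_r; auto. left; apply exp_pos.
unfold small_radius. right. rewrite exp_Ropp. field. apply Rgt_not_eq, exp_pos.
Qed.

Lemma tri_eq_0 m : m <> 0%Z -> m <> (-1)%Z -> forall x, 0 ^ tri m * x = 0.
Proof.
intros H0 H1 x. rewrite pow_i. ring. assert (H := tri_Z m).
assert (m * (m + 1) <> 0)%Z by nia. lia.
Qed.

Lemma sq_eq_0 m : m <> 0%Z -> (0 < sq m)%nat.
Proof. intros H0. assert (H := sq_Z m). assert (m * m <> 0)%Z by nia. lia. Qed.

Lemma pow_div_fact_le x i : Rabs (x ^ i * / INR (fact i)) <= exp (Rabs x).
Proof.
rewrite Rabs_mult, <- RPow_abs, (Rabs_pos_eq (/ _)) by (left; apply inv_fact_pos).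
apply Rmult_le_reg_r with (INR (fact i)). apply INR_fact_lt_0.
rewrite Rmult_assoc, Rinv_l, Rmult_1_r by apply INR_fact_neq_0.
rewrite Rmult_comm. apply pow_le_fact_exp, Rabs_pos.
Qed.

Lemma exp_ge_id x : x <= exp x.
Proof. generalize (exp_ineq1_le x); lra. Qed.

(** At q = 0 the equation Gd = 0 reads tanh s = 1/kap, and its derivative in s does
    not vanish there. *)
Lemma solve_s kap s0 : 1 < kap -> 0 <= s0 ->
  (1 - kap) * exp s0 + (1 + kap) * exp (- s0) = 0 ->
  exists (r rho : R) (x : R -> R), 0 < r /\ 0 < rho <= 1 /\ PS r rho x /\ x 0 = 0 /\
    forall q, Rabs q <= r -> Gd kap (s0 + x q) q = 0.
Proof.
intros Hk Hs0 Heq. set (A := kap + s0 + 1).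
assert (HA : 0 <= A) by (unfold A; lra).
set (om := fun m => 1 - (2 * IZR m + 1) * kap).
set (mu := fun m => 2 * IZR m + 1).
destruct (implicit_function_zsum (small_radius A) (exp A) 1
  (fun m i q => q ^ tri m * (om m * exp (mu m * s0) * (mu m ^ i * / INR (fact i))))
  (fun m x q => q ^ tri m * exp (mu m * (s0 + x)) * om m)) as (r & rho & x & Hr & Hrho & Hx & Hx0 & Hz).
- apply small_radius_pos.
- lra.
- intros m i. apply PS_theta_term.
  + left; apply small_radius_pos.
  + auto.
  + apply small_radius_spec; lra.
  + apply zdeg_tri.
  + eapply PS_mono; [|apply PS_const].
    rewrite !Rabs_mult with (x := om m * _), Rabs_mult.
    assert (E : exp ((2 * INR (zdeg m) + 1) * A) = exp (Rabs (mu m) * kap) * exp (Rabs (mu m) * s0) * exp (Rabs (mu m))).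
    { rewrite <- !exp_plus. f_equal. unfold mu. rewrite odd_abs. unfold A. ring. }
    rewrite E. apply Rmult_le_compat; try apply Rabs_pos; [|apply Rmult_le_compat; try apply Rabs_pos|].
    * apply Rmult_le_pos; apply Rabs_pos.
    * unfold om. eapply Rle_trans; [|apply exp_ineq1_le].
      unfold Rminus. eapply Rle_trans; [apply Rabs_triang|].
      rewrite Rabs_R1, Rabs_Ropp, Rabs_mult, (Rabs_pos_eq kap) by lra. fold (mu m). lra.
    * rewrite Rabs_pos_eq by (left; apply exp_pos). apply exp_le_mono.
      eapply Rle_trans; [apply Rle_abs|]. rewrite Rabs_mult, (Rabs_pos_eq s0); lra.
    * apply pow_div_fact_le.
- intros m y p.
  apply is_series_ext with (fun i => scal (p ^ tri m * (om m * exp (mu m * s0))) (/ INR (fact i) * (mu m * y) ^ i)).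
  { intros i. unfold scal; simpl; unfold mult; simpl. rewrite Rpow_mult_distr. rring. }
  replace (p ^ tri m * exp (mu m * (s0 + y)) * om m) with
    (scal (p ^ tri m * (om m * exp (mu m * s0))) (exp (mu m * y))).
  apply (is_series_scal_l (V := R_NormedModule)), is_series_exp.
  unfold scal; simpl; unfold mult; simpl. rewrite Rmult_plus_distr_l, exp_plus. ring.
- intros m i H0 H1. now apply tri_eq_0.
- unfold om, mu. simpl. rewrite Rinv_1.
  replace ((2 * 0 + 1) * s0) with s0 by ring. replace ((2 * -1 + 1) * s0) with (- s0) by ring. lra.
- unfold om, mu. simpl. rewrite Rinv_1.
  replace ((2 * 0 + 1) * s0) with s0 by ring. replace ((2 * -1 + 1) * s0) with (- s0) by ring.
  assert (He := exp_pos s0). assert (He' := exp_pos (- s0)).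
  assert (0 < (kap - 1) * exp s0) by (apply Rmult_lt_0_compat; lra).
  assert (0 < (1 + kap) * exp (- s0)) by (apply Rmult_lt_0_compat; lra).
  intros E. ring_simplify in E. lra.
- exists r, rho, x. repeat (split; [assumption || lra|]). exact Hz.
Qed.

(** The rotation number: at q = 0 the equation Gf = 0 is
    sin (kap a) cos a = kap cos (kap a) sin a. *)
Lemma solve_alpha kap a0 r1 S s : 0 < r1 -> 0 <= kap ->
  PS r1 S s ->
  exp (s 0) * sin ((1 - kap) * a0) + exp (- s 0) * sin ((1 + kap) * a0) = 0 ->
  exp (s 0) * ((1 - kap) * cos ((1 - kap) * a0)) + exp (- s 0) * ((1 + kap) * cos ((1 + kap) * a0)) <> 0 ->
  exists (r rho : R) (y : R -> R), 0 < r <= r1 /\ 0 < rho <= 1 /\ PS r rho y /\ y 0 = 0 /\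
    forall q, Rabs q <= r -> Gf kap (s q) q (a0 + y q) = 0.
Proof.
intros Hr1 Hk Hs Heq Hne.
assert (HS : 0 <= S) by (apply (PS_bound_nonneg r1 S s); auto; lra).
set (A := S + 1 + kap).
assert (HA : 0 <= A) by (unfold A; lra).
set (om := fun m => 1 - (2 * IZR m + 1) * kap).
set (mu := fun m => 2 * IZR m + 1).
set (r0 := Rmin r1 (small_radius A)).
assert (Hr0 : 0 < r0) by (apply Rmin_glb_lt; auto; apply small_radius_pos).
assert (Hr01 : r0 <= r1) by apply Rmin_l.
set (cc := fun m i => sin (om m * a0 + INR i * (PI / 2)) * / INR (fact i) * om m ^ i).
destruct (implicit_function_zsum r0 (exp A) 1
  (fun m i q => q ^ tri m * (cc m i * exp (mu m * s q)))
  (fun m x q => q ^ tri m * exp (mu m * s q) * sin (om m * (a0 + x)))) as (r & rho & x & Hr & Hrho & Hx & Hx0 & Hz); auto.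
- lra.
- intros m i. apply PS_theta_term.
  + lra.
  + auto.
  + apply small_radius_spec, Rmin_r.
  + apply zdeg_tri.
  + assert (E : exp ((2 * INR (zdeg m) + 1) * A) = exp (Rabs (mu m) * (1 + kap)) * exp (Rabs (mu m) * S)).
    { rewrite <- !exp_plus. f_equal. unfold mu. rewrite odd_abs. unfold A. ring. }
    rewrite E. apply PS_mono with (Rabs (cc m i) * exp (Rabs (mu m) * S)).
    * apply Rmult_le_compat_r. left; apply exp_pos.
      apply Rle_trans with (exp (Rabs (om m))).
      -- unfold cc. rewrite Rmult_assoc, Rabs_mult. rewrite <- (Rmult_1_l (exp _)).
         apply Rmult_le_compat; try apply Rabs_pos. apply abs_sin_le.
         rewrite (Rmult_comm (/ _)). apply pow_div_fact_le.
      -- apply exp_le_mono. unfold om, Rminus. eapply Rle_trans; [apply Rabs_triang|].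
         rewrite Rabs_R1, Rabs_Ropp, Rabs_mult, (Rabs_pos_eq kap) by lra.
         unfold mu. rewrite odd_abs. generalize (pos_INR (zdeg m)); intros. nra.
    * apply PS_scal. apply PS_exp. lra. apply PS_scal.
      apply PS_radius with r1; auto; lra.
- intros m y p.
  apply is_series_ext with (fun i => scal (p ^ tri m * exp (mu m * s p))
     (sin (om m * a0 + INR i * (PI / 2)) * / INR (fact i) * (om m * y) ^ i)).
  { intros i. unfold scal; simpl; unfold mult; simpl. unfold cc. rewrite Rpow_mult_distr. rring. }
  replace (p ^ tri m * exp (mu m * s p) * sin (om m * (a0 + y))) with
    (scal (p ^ tri m * exp (mu m * s p)) (sin (om m * a0 + om m * y))).
  apply (is_series_scal_l (V := R_NormedModule)), is_series_sin.
  unfold scal; simpl; unfold mult; simpl. now rewrite Rmult_plus_distr_l.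
- intros m i H0 H1. now apply tri_eq_0.
- unfold cc, om, mu. simpl. rewrite Rinv_1, !Rmult_0_l, !Rplus_0_r.
  replace (2 * 0 + 1) with 1 by ring. replace (2 * -1 + 1) with (-1) by ring.
  rewrite !Rmult_1_l, !Rmult_1_r. replace (-1 * s 0) with (- s 0) by ring.
  replace (1 - -1 * kap) with (1 + kap) by ring. lra.
- unfold cc, om, mu. simpl. rewrite Rinv_1.
  replace (2 * 0 + 1) with 1 by ring. replace (2 * -1 + 1) with (-1) by ring.
  rewrite !Rmult_1_l, !Rmult_1_r. replace (-1 * s 0) with (- s 0) by ring.
  replace (1 - -1 * kap) with (1 + kap) by ring.
  rewrite !(Rplus_comm _ (PI / 2)), <- !cos_sin.
  intros E. apply Hne. etransitivity; [|exact E]. ring.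
- exists r, rho, x. split; [lra|]. repeat (split; [assumption|]). exact Hz.
Qed.

(** Makes a function close to 1 invertible; the radius depends on the bound only,
    hence is uniform in t for Th. *)
Lemma PS_half r B : 0 < r -> 0 <= B ->
  exists r', 0 < r' <= r /\ forall r'' f, 0 <= r'' <= r' -> PS r B f -> f 0 = 0 -> PS r'' (1/2) f.
Proof.
intros Hr HB. exists (r / (2 * B + 1)).
assert (H1 : 0 < r / (2 * B + 1)) by (apply Rdiv_lt_0_compat; lra).
assert (H2 : r / (2 * B + 1) <= r).
{ rewrite <- (Rmult_1_r r) at 2. apply Rmult_le_compat_l. lra.
  rewrite <- Rinv_1. apply Rinv_le_contravar; lra. }
split; [lra|]. intros r'' f Hr'' Hf H0.
apply PS_mono with (B * (r'' / r)).
- apply Rle_trans with (B * (/ (2 * B + 1))).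
  + apply Rmult_le_compat_l; auto. apply Rmult_le_reg_r with r; auto.
    unfold Rdiv. rewrite Rmult_assoc, Rinv_l, Rmult_1_r by lra.
    rewrite Rmult_comm. apply Hr''.
  + apply Rmult_le_reg_r with (2 * B + 1). lra.
    rewrite Rmult_assoc, Rinv_l by lra. lra.
- apply PS_small; auto; lra.
Qed.

Lemma PS_scal_r r B f c : Rabs c <= 1 -> 0 <= r -> PS r B f -> PS r B (fun q => f q * c).
Proof.
intros Hc Hr Hf. assert (HB := PS_bound_nonneg _ _ _ Hr Hf).
apply PS_mono with (Rabs c * B).
rewrite <- (Rmult_1_l B) at 2. now apply Rmult_le_compat_r.
apply PS_ext with (fun q => c * f q). intros; ring. now apply PS_scal.
Qed.

Section Family.
Variables (kap r A S a : R) (s al : R -> R).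
Hypothesis r_pos : 0 < r.
Hypothesis r_small : r * exp (2 * A) <= 1/2.
Hypothesis s_PS : PS r S s.
Hypothesis al_PS : PS r a al.
Hypothesis A_large : 4 * S + (1 + 3 * Rabs kap) * (a + 1) <= A.

Lemma S_nonneg : 0 <= S.
Proof. apply (PS_bound_nonneg r S s); auto; lra. Qed.

Lemma a_nonneg : 0 <= a.
Proof. apply (PS_bound_nonneg r a al); auto; lra. Qed.

Lemma A_parts : 0 <= 4 * S /\ 0 <= (1 + 3 * Rabs kap) * a /\ 0 <= 1 + 3 * Rabs kap /\
  4 * S + (1 + 3 * Rabs kap) * a + (1 + 3 * Rabs kap) <= A.
Proof.
assert (HS := S_nonneg). assert (Ha := a_nonneg). assert (Hk := Rabs_pos kap).
assert (0 <= (1 + 3 * Rabs kap) * a) by (apply Rmult_le_pos; lra). lra.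
Qed.

Lemma A_nonneg : 0 <= A.
Proof. generalize A_parts; lra. Qed.

Lemma exp_weight_le m x : x <= A -> exp ((2 * INR (zdeg m) + 1) * x) <= exp ((2 * INR (zdeg m) + 1) * A).
Proof.
intros H. apply exp_le_mono. apply Rmult_le_compat_l; auto.
generalize (pos_INR (zdeg m)); lra.
Qed.

Lemma PS_exp_linear m b : Rabs b <= 4 * INR (zdeg m) + 4 ->
  PS r (exp ((2 * INR (zdeg m) + 1) * (4 * S))) (fun q => exp (b * s q)).
Proof.
intros Hb. apply PS_mono with (exp (Rabs b * S)).
- apply exp_le_mono. assert (HS := S_nonneg). generalize (pos_INR (zdeg m)); intros.
  apply Rle_trans with ((4 * INR (zdeg m) + 4) * S). now apply Rmult_le_compat_r. nra.
- apply PS_exp. lra. now apply PS_scal.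
Qed.

Lemma PS_trig_linear m b : Rabs b <= (1 + 3 * Rabs kap) * (INR (zdeg m) + 1) ->
  PS r (exp ((2 * INR (zdeg m) + 1) * ((1 + 3 * Rabs kap) * a))) (fun q => sin (b * al q)) /\
  PS r (exp ((2 * INR (zdeg m) + 1) * ((1 + 3 * Rabs kap) * a))) (fun q => cos (b * al q)).
Proof.
intros Hb. assert (Ha := a_nonneg). destruct A_parts as (_ & HP & _ & _).
assert (Hle : exp (Rabs b * a) <= exp ((2 * INR (zdeg m) + 1) * ((1 + 3 * Rabs kap) * a))).
{ apply exp_le_mono. apply Rle_trans with ((1 + 3 * Rabs kap) * (INR (zdeg m) + 1) * a).
  now apply Rmult_le_compat_r. generalize (pos_INR (zdeg m)); intros. nra. }
assert (Hr : 0 <= r) by lra.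
split; (eapply PS_mono; [exact Hle|]).
- apply PS_ext with (2 := PS_sin r _ _ 0 Hr (PS_scal r a b al al_PS)).
  intros; now rewrite Rplus_0_l.
- apply PS_ext with (2 := PS_cos r _ _ 0 Hr (PS_scal r a b al al_PS)).
  intros; now rewrite Rplus_0_l.
Qed.

Ltac theta_term := apply PS_theta_term;
  [lra|apply A_nonneg|auto|first [apply zdeg_sq|apply zdeg_tri|apply pow_zdeg_double, zdeg_sq|apply pow_zdeg_double, zdeg_tri]|].

Lemma PS_N (f : R -> R) t : (forall x, Rabs (f x) <= 1) ->
  PS r (4 * exp A) (fun q => zsum (fun m =>
    q ^ sq m * exp (2 * IZR m * s q) * f ((1 - 2 * IZR m * kap) * t))).
Proof.
intros Hf. apply PS_zsum. lra. intros m.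
apply PS_ext with (fun q => q ^ sq m * (exp (2 * IZR m * s q) * f ((1 - 2 * IZR m * kap) * t))).
intros; ring. theta_term.
eapply PS_mono; [apply (exp_weight_le m (4 * S)); generalize A_parts; lra|].
apply PS_scal_r; auto. lra. apply PS_exp_linear. zdeg_lra m.
Qed.

Lemma PS_const_weight m c : Rabs c <= 1 -> PS r (exp ((2 * INR (zdeg m) + 1) * A)) (fun _ => c).
Proof.
intros Hc. apply PS_mono with (2 := PS_const r c).
apply Rle_trans with 1; auto. apply exp_ge_1. apply Rmult_le_pos.
generalize (pos_INR (zdeg m)); lra. apply A_nonneg.
Qed.

Lemma PS_Th t : PS r (4 * exp A) (fun q => Th kap q t).
Proof.
apply PS_zsum. lra. intros m.
apply PS_ext with (fun q => q ^ sq m * ((-1) ^ sq m * cos (2 * IZR m * kap * t))).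
{ intros q _. replace (- q) with (-1 * q) by ring. rewrite (Rpow_mult_distr (-1)). ring. }
theta_term. apply PS_const_weight. rewrite Rabs_mult, pow_1_abs, Rmult_1_l. apply abs_cos_le.
Qed.

Lemma PS_Ev0 : PS r (4 * exp A) (fun q => Ev kap q 0).
Proof.
apply PS_zsum. lra. intros m. theta_term. apply PS_const_weight, abs_cos_le.
Qed.

Lemma PS_Ev_al : PS r (4 * exp A) (fun q => Ev kap q (al q)).
Proof.
apply PS_zsum. lra. intros m. theta_term.
eapply PS_mono; [apply (exp_weight_le m ((1 + 3 * Rabs kap) * a)); generalize A_parts; lra|].
apply (proj2 (PS_trig_linear m _ (frequency_bound_even kap m))).
Qed.

Lemma PS_Ud : PS r (4 * exp A) (fun q => Ud kap (s q) q).
Proof.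
apply PS_zsum. lra. intros m.
apply PS_ext with (fun q => q ^ (2 * sq m) * ((1 - 2 * IZR m * kap) * exp (4 * IZR m * s q))).
intros; ring. theta_term.
apply PS_mono with (exp ((2 * INR (zdeg m) + 1) * (1 + 3 * Rabs kap)) * exp ((2 * INR (zdeg m) + 1) * (4 * S))).
{ rewrite <- exp_plus, <- Rmult_plus_distr_l. apply exp_weight_le. generalize A_parts; lra. }
eapply PS_mono; [|apply PS_scal, (PS_exp_linear m); zdeg_lra m].
apply Rmult_le_compat_r. left; apply exp_pos.
eapply Rle_trans; [apply frequency_bound0|]. eapply Rle_trans; [|apply exp_ge_id].
generalize (pos_INR (zdeg m)) (Rabs_pos kap); intros; nra.
Qed.

Lemma PS_U_al : PS r (4 * exp A) (fun q => U kap (s q) q (al q)).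
Proof.
apply PS_zsum. lra. intros m.
apply PS_ext with (fun q => q ^ (2 * sq m) * (exp (4 * IZR m * s q) * sin ((1 - 2 * IZR m * kap) * al q))).
intros; ring. theta_term.
apply PS_mono with (exp ((2 * INR (zdeg m) + 1) * (4 * S)) * exp ((2 * INR (zdeg m) + 1) * ((1 + 3 * Rabs kap) * a))).
{ rewrite <- exp_plus, <- Rmult_plus_distr_l. apply exp_weight_le. generalize A_parts; lra. }
apply PS_mult. lra. apply PS_exp_linear; zdeg_lra m. apply (proj1 (PS_trig_linear m _ (frequency_bound0 kap m))).
Qed.

End Family.

Lemma double_sq_pos m : m <> 0%Z -> (0 < 2 * sq m)%nat.
Proof. intros H. generalize (sq_eq_0 m H). lia. Qed.

Lemma Th_at_0 kap t : Th kap 0 t = 1.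
Proof.
unfold Th. rewrite zsum_single. simpl. replace (2 * 0 * kap * t) with 0 by ring. rewrite cos_0; ring.
intros n Hn. rewrite Ropp_0, pow_i. ring. now apply sq_eq_0.
Qed.

Lemma Ev_at_0 kap x : Ev kap 0 x = 1.
Proof.
unfold Ev. rewrite zsum_single. simpl. replace (2 * 0 * kap * x) with 0 by ring. rewrite cos_0; ring.
intros n Hn. rewrite pow_i. ring. now apply double_sq_pos.
Qed.

Lemma Ud_at_0 kap s : Ud kap s 0 = 1.
Proof.
unfold Ud. rewrite zsum_single. simpl. replace (4 * 0 * s) with 0 by ring. rewrite exp_0; ring.
intros n Hn. rewrite pow_i. ring. now apply double_sq_pos.
Qed.

Lemma U_at_0 kap s d : U kap s 0 d = sin d.
Proof.
unfold U. rewrite zsum_single. simpl. replace (4 * 0 * s) with 0 by ring. rewrite exp_0.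
replace ((1 - 2 * 0 * kap) * d) with d by ring. ring.
intros n Hn. rewrite pow_i. ring. now apply double_sq_pos.
Qed.

Lemma N1_at_0 kap s t : N1 kap s 0 t = cos t.
Proof.
unfold N1. rewrite zsum_single. simpl. replace (2 * 0 * s) with 0 by ring. rewrite exp_0.
replace ((1 - 2 * 0 * kap) * t) with t by ring. ring.
intros n Hn. rewrite pow_i. ring. now apply sq_eq_0.
Qed.

Lemma N2_at_0 kap s t : N2 kap s 0 t = sin t.
Proof.
unfold N2. rewrite zsum_single. simpl. replace (2 * 0 * s) with 0 by ring. rewrite exp_0.
replace ((1 - 2 * 0 * kap) * t) with t by ring. ring.
intros n Hn. rewrite pow_i. ring. now apply sq_eq_0.
Qed.

Lemma PS_inverse_near_1 r f : 0 <= r -> PS r (1/2) (fun q => f q - 1) ->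
  PS r 2 (fun q => / f q) /\ forall q, Rabs q <= r -> f q <> 0.
Proof.
intros Hr H. split.
- apply PS_ext with (2 := PS_inv r _ Hr H). intros q _. f_equal; ring.
- intros q Hq E. assert (HH := PS_abs _ _ _ _ H Hq). simpl in HH. rewrite E in HH.
  rewrite Rabs_left in HH; lra.
Qed.

(** What the construction needs from the parameters s, al, lam as functions of the
    nome: analyticity, the equations that make the theta curve centroaffine and
    its bracket constant, and uniform bounds on the ingredients of the curve. *)
Definition family_spec (kap a0 s0 r A S B : R) (s al lam : R -> R) : Prop :=
  0 < r /\ 0 <= A /\ r * exp (2 * A) <= 1/2 /\ 4 * S <= A /\ PS r S s /\ PS r B al /\ PS r B lam /\
  s 0 = s0 /\ al 0 = a0 /\ lam 0 = 1 /\
  (forall q, Rabs q <= r -> Gd kap (s q) q = 0 /\ Gf kap (s q) q (al q) = 0 /\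
     Ev kap q 0 <> 0 /\ Ev kap q (al q) <> 0 /\ (forall t, Th kap q t <> 0) /\
     lam q ^ 2 * Ud kap (s q) q = Ev kap q 0) /\
  (forall t, PS r B (fun q => N1 kap (s q) q t) /\ PS r B (fun q => N2 kap (s q) q t) /\
     PS r 2 (fun q => / Th kap q t)) /\
  PS r B (fun q => U kap (s q) q (al q)) /\ PS r 2 (fun q => / Ev kap q (al q)).

Lemma family_exists kap a0 s0 : 1 < kap -> 0 <= s0 ->
  (1 - kap) * exp s0 + (1 + kap) * exp (- s0) = 0 ->
  exp s0 * sin ((1 - kap) * a0) + exp (- s0) * sin ((1 + kap) * a0) = 0 ->
  exp s0 * ((1 - kap) * cos ((1 - kap) * a0)) + exp (- s0) * ((1 + kap) * cos ((1 + kap) * a0)) <> 0 ->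
  exists r A S B s al lam, family_spec kap a0 s0 r A S B s al lam.
Proof.
intros Hk Hs0 Hs Ha Hane.
destruct (solve_s kap s0 Hk Hs0 Hs) as (r1 & rho1 & x & Hr1 & Hrho1 & Hx & Hx0 & HG).
set (s := fun q => s0 + x q). set (S := s0 + 1).
assert (sPS : PS r1 S s).
{ apply PS_mono with (Rabs s0 + rho1). unfold S. rewrite Rabs_pos_eq; lra.
  apply PS_plus; auto. lra. apply PS_const. }
assert (Hs00 : s 0 = s0) by (unfold s; rewrite Hx0; ring).
destruct (solve_alpha kap a0 r1 S s Hr1) as (r2 & rho2 & y & Hr2 & Hrho2 & Hy & Hy0 & HGf); auto.
lra. now rewrite Hs00. now rewrite Hs00.
set (al := fun q => a0 + y q). set (a := Rabs a0 + 1).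
assert (alPS : PS r2 a al).
{ apply PS_mono with (Rabs a0 + rho2). unfold a; lra.
  apply PS_plus; auto. lra. apply PS_const. }
set (A := 4 * S + (1 + 3 * Rabs kap) * (a + 1)).
set (r3 := Rmin r2 (small_radius A)).
assert (Hr3 : 0 < r3) by (apply Rmin_glb_lt; [lra|apply small_radius_pos]).
assert (Hr32 : r3 <= r2) by apply Rmin_l.
assert (HAr : r3 * exp (2 * A) <= 1/2) by apply small_radius_spec, Rmin_r.
assert (sPS3 : PS r3 S s) by (apply PS_radius with r1; auto; lra).
assert (alPS3 : PS r3 a al) by (apply PS_radius with r2; auto; lra).
assert (HA : 4 * S + (1 + 3 * Rabs kap) * (a + 1) <= A) by (unfold A; lra).
assert (HA0 : 0 <= A) by (apply (A_nonneg kap r3 A S a s al); auto).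
assert (He := exp_pos A).
assert (P1 := fun t => PS_N kap r3 A S a s al Hr3 HAr sPS3 alPS3 HA cos t abs_cos_le).
assert (P2 := fun t => PS_N kap r3 A S a s al Hr3 HAr sPS3 alPS3 HA sin t abs_sin_le).
assert (P3 := PS_Th kap r3 A S a s al Hr3 HAr sPS3 alPS3 HA).
assert (P4 := PS_Ev0 kap r3 A S a s al Hr3 HAr sPS3 alPS3 HA).
assert (P5 := PS_Ev_al kap r3 A S a s al Hr3 HAr sPS3 alPS3 HA).
assert (P6 := PS_Ud kap r3 A S a s al Hr3 HAr sPS3 alPS3 HA).
assert (P7 := PS_U_al kap r3 A S a s al Hr3 HAr sPS3 alPS3 HA).
destruct (PS_half r3 (4 * exp A + 1) Hr3) as (r4 & Hr4 & Hhalf). lra.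
assert (Hsub : forall r f, 0 <= r <= r4 -> PS r3 (4 * exp A) f -> f 0 = 1 -> PS r (1/2) (fun q => f q - 1)).
{ intros r f Hr Hf H0. apply Hhalf; auto. 2: rewrite H0; ring.
  apply PS_mono with (4 * exp A + Rabs 1). rewrite Rabs_R1; lra.
  apply PS_minus; auto. lra. apply PS_const. }
(* The normalisation 1 + x solves Ud (1 + x)^2 = Ev 0, a polynomial equation in x
   whose coefficients are analytic in q. *)
set (g := fun (i : nat) q => match i with
  | O => Ud kap (s q) q - Ev kap q 0 | 1%nat => 2 * Ud kap (s q) q | 2%nat => Ud kap (s q) q
  | _ => 0 end).
destruct (implicit_function r3 (8 * exp A) g Hr3) with (rho0 := 1) as (r5 & rho5 & z & Hr5 & Hrho5 & Hrho5' & Hz & Hz0 & Hlam).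
{ intros [|[|[|i]]]; unfold g.
  - apply PS_mono with (4 * exp A + 4 * exp A). lra. apply PS_minus; auto; lra.
  - apply PS_mono with (Rabs 2 * (4 * exp A)). rewrite Rabs_pos_eq; lra. now apply PS_scal.
  - apply PS_mono with (4 * exp A); auto; lra.
  - apply PS_mono with (Rabs 0). rewrite Rabs_R0; lra. apply PS_const. }
{ unfold g. rewrite Ud_at_0, Ev_at_0. ring. }
{ unfold g. rewrite Ud_at_0. lra. }
{ lra. }
set (r := Rmin r4 r5).
assert (Hr : 0 < r) by (apply Rmin_glb_lt; lra).
assert (Hrr4 : r <= r4) by apply Rmin_l. assert (Hrr5 : r <= r5) by apply Rmin_r.
set (B := 4 * exp A + a + 2).
assert (Ha0 : 0 <= a) by (unfold a; generalize (Rabs_pos a0); lra).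
exists r, A, S, B, s, al, (fun q => 1 + z q).
unfold family_spec. repeat match goal with |- _ /\ _ => split end; auto.
- apply Rle_trans with (r3 * exp (2 * A)); auto. apply Rmult_le_compat_r. left; apply exp_pos. lra.
- generalize (A_parts kap r3 A S a s al Hr3 sPS3 alPS3 HA); lra.
- apply PS_radius with r3; auto; lra.
- apply PS_mono with a. unfold B; lra. apply PS_radius with r3; auto; lra.
- apply PS_mono with (Rabs 1 + rho5). rewrite Rabs_R1; unfold B; lra.
  apply PS_plus. lra. apply PS_const. apply PS_radius with r5; auto; lra.
- unfold al; rewrite Hy0; ring.
- rewrite Hz0; ring.
- intros q Hq.
  assert (Hrange : 0 <= r <= r4) by lra.
  repeat split.
  + apply HG. lra.
  + apply HGf. lra.
  + apply (proj2 (PS_inverse_near_1 r _ (Rlt_le _ _ Hr) (Hsub r _ Hrange P4 (Ev_at_0 kap 0)))); auto.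
  + apply (proj2 (PS_inverse_near_1 r _ (Rlt_le _ _ Hr) (Hsub r _ Hrange P5 (Ev_at_0 kap _)))); auto.
  + intros t. apply (proj2 (PS_inverse_near_1 r _ (Rlt_le _ _ Hr) (Hsub r _ Hrange (P3 t) (Th_at_0 kap t)))); auto.
  + assert (Hq5 : Rabs q <= r5) by lra. specialize (Hlam q Hq5).
    assert (E : is_series (fun i => g i q * z q ^ i)
      (Ud kap (s q) q - Ev kap q 0 + 2 * Ud kap (s q) q * z q + Ud kap (s q) q * z q ^ 2)).
    { apply (is_series_decr_n _ 3); [lia|].
      apply filterlim_ext with (fun _ : nat => 0).
      2:{ match goal with |- filterlim _ _ (locally ?l) => replace l with 0 end. apply filterlim_const.
          simpl pred. rewrite !sum_Sn, sum_O. unfold plus, opp; simpl. ring. }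
      intros N. rewrite (sum_n_ext _ (fun _ => 0)). rewrite sum_n_const; rring.
      intros n. simpl. ring. }
    assert (E0 := is_series_unique _ _ E). rewrite (is_series_unique _ _ Hlam) in E0. nra.
- intros t. assert (Hrange : 0 <= r <= r4) by lra. split; [|split].
  + apply PS_mono with (4 * exp A). unfold B; lra. apply PS_radius with r3. lra. apply P1.
  + apply PS_mono with (4 * exp A). unfold B; lra. apply PS_radius with r3. lra. apply P2.
  + apply (PS_inverse_near_1 r _ (Rlt_le _ _ Hr) (Hsub r _ Hrange (P3 t) (Th_at_0 kap t))).
- apply PS_mono with (4 * exp A). unfold B; lra. apply PS_radius with r3; auto; lra.
- assert (Hrange : 0 <= r <= r4) by lra.
  apply (PS_inverse_near_1 r _ (Rlt_le _ _ Hr) (Hsub r _ Hrange P5 (Ev_at_0 kap _))).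
Qed.

(** * First order in the nome *)

Lemma is_derive_remainder (f h : R -> R) (l K delta : R) : 0 < delta ->
  (forall e, Rabs e < delta -> Rabs (f e - h e) <= K * e ^ 2) ->
  is_derive h 0 l -> is_derive f 0 l.
Proof.
intros Hd H Hh.
assert (H0 : f 0 - h 0 = 0).
{ assert (H1 := H 0). rewrite Rabs_R0 in H1. specialize (H1 Hd).
  replace (K * 0 ^ 2) with 0 in H1 by ring.
  destruct (Req_dec (f 0 - h 0) 0) as [|Hne]; auto. apply Rabs_pos_lt in Hne; lra. }
assert (D : is_derive (fun e => f e - h e) 0 0).
{ apply is_derive_quadratic with K delta; auto. intros e He.
  rewrite Rplus_0_l, H0, Rmult_0_r, !Rminus_0_r. now apply H. }
apply is_derive_ext with (fun e => (f e - h e) + h e).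
intros; rring.
replace l with (plus 0 l) by (apply Rplus_0_l).
now apply (is_derive_plus (V := R_NormedModule)).
Qed.

Lemma eq_mod_eps2_derive f h a b : eq_mod_eps2 f h -> is_derive f 0 a -> is_derive h 0 b -> a = b.
Proof.
intros (K & delta & Hd & H) Hf Hh.
apply (is_derive_inj f 0); auto. now apply is_derive_remainder with h K delta.
Qed.

Lemma zsum_split (p : Z -> bool) g : zsummable g ->
  zsum g = zsum (fun m => if p m then g m else 0) + zsum (fun m => if p m then 0 else g m).
Proof.
intros H.
assert (H1 : zsummable (fun m => if p m then g m else 0)).
{ apply zsummable_dominated with (fun m => Rabs (g m)); [|now apply zsummable_abs].
  intros n. destruct (p n). lra. rewrite Rabs_R0; apply Rabs_pos. }
assert (H2 : zsummable (fun m => if p m then 0 else g m)).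
{ apply zsummable_dominated with (fun m => Rabs (g m)); [|now apply zsummable_abs].
  intros n. destruct (p n). rewrite Rabs_R0; apply Rabs_pos. lra. }
rewrite <- zsum_plus by now apply zsummable_ex.
apply zsum_ext. intros n. destruct (p n); ring.
Qed.

Lemma zsum_geometric C : zsum (fun m => C * (1/2) ^ zdeg m) = 4 * C.
Proof.
unfold zsum. rewrite (Series_ext _ (fun n => 2 * C * (1/2) ^ n)).
rewrite Series_geom_scal by apply half_lt_1. field.
intros n. unfold zfold. rewrite zdeg_reflect, zdeg_nat. ring.
Qed.

(** The discarded terms all contain the factor q^2, and the series of what is left
    of them is bounded on the whole disc. *)
Lemma theta_remainder r A q (p : Z -> bool) (d : Z -> nat) (f : Z -> R) :
  0 < r -> 0 <= A -> r * exp (2 * A) <= 1/2 -> Rabs q <= r ->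
  (forall m, (zdeg m <= d m)%nat) ->
  (forall m, Rabs (f m) <= exp ((2 * INR (zdeg m) + 1) * A)) ->
  (forall m, p m = false -> (2 <= d m)%nat) ->
  Rabs (zsum (fun m => q ^ d m * f m) - zsum (fun m => if p m then q ^ d m * f m else 0))
    <= 4 * (exp A / r ^ 2) * q ^ 2.
Proof.
intros Hr HA Hq Hqr Hd Hf Hp.
assert (Hb : forall m, r ^ d m * Rabs (f m) <= exp A * (1/2) ^ zdeg m).
{ intros m. apply Rle_trans with (r ^ d m * exp ((2 * INR (zdeg m) + 1) * A)).
  apply Rmult_le_compat_l; auto. apply pow_le; lra. apply weight_bound; auto; lra. }
rewrite (zsum_split p).
2:{ apply zsummable_geometric with (exp A). intros m.
    eapply Rle_trans; [|apply Hb]. rewrite Rabs_mult. apply Rmult_le_compat_r. apply Rabs_pos.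
    now apply pow_abs_le. }
match goal with |- Rabs (?a + ?b - ?a) <= _ => replace (a + b - a) with b by ring end.
replace (4 * (exp A / r ^ 2) * q ^ 2) with (4 * (exp A / r ^ 2 * q ^ 2)) by ring.
rewrite <- zsum_geometric. apply zsum_abs_le.
- intros m. destruct (p m) eqn:E.
  + rewrite Rabs_R0. apply Rmult_le_pos. 2: apply pow_le; lra.
    apply Rmult_le_pos. 2: apply pow2_ge_0. apply Rlt_le, Rdiv_lt_0_compat. apply exp_pos. now apply pow_lt.
  + specialize (Hp m E). rewrite Rabs_mult.
    replace (d m) with (2 + (d m - 2))%nat by lia. rewrite pow_add, Rabs_mult.
    rewrite (Rabs_pos_eq (q ^ 2)) by apply pow2_ge_0.
    apply Rle_trans with (q ^ 2 * (r ^ (d m - 2) * Rabs (f m))).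
    * rewrite Rmult_assoc. apply Rmult_le_compat_l. apply pow2_ge_0.
      apply Rmult_le_compat_r. apply Rabs_pos. now apply pow_abs_le.
    * replace (exp A / r ^ 2 * q ^ 2 * (1/2) ^ zdeg m) with (q ^ 2 * (exp A * (1/2) ^ zdeg m / r ^ 2))
        by (field; lra).
      apply Rmult_le_compat_l. apply pow2_ge_0.
      apply Rmult_le_reg_r with (r ^ 2). now apply pow_lt.
      unfold Rdiv. rewrite (Rmult_assoc (exp A * _)), Rinv_l, Rmult_1_r by (apply pow_nonzero; lra).
      eapply Rle_trans; [|apply Hb]. right.
      replace (d m) with (2 + (d m - 2))%nat at 2 by lia. rewrite pow_add. ring.
- apply zsummable_geometric with (exp A / r ^ 2 * q ^ 2). intros m. rewrite Rabs_pos_eq. lra.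
  apply Rmult_le_pos. 2: apply pow_le; lra.
  apply Rmult_le_pos. 2: apply pow2_ge_0. apply Rlt_le, Rdiv_lt_0_compat. apply exp_pos. now apply pow_lt.
Qed.

Definition center1 (m : Z) : bool := (Z.abs m <=? 1)%Z.
Definition center0 (m : Z) : bool := (m =? 0)%Z.

Lemma sq_ge_2 m : center1 m = false -> (2 <= sq m)%nat.
Proof. unfold center1. intros H. apply Z.leb_gt in H. assert (E := sq_Z m). nia. Qed.

Lemma double_sq_ge_2 m : center0 m = false -> (2 <= 2 * sq m)%nat.
Proof. unfold center0. intros H. apply Z.eqb_neq in H. generalize (sq_eq_0 m H). lia. Qed.

Lemma zsum_center0 g : zsum (fun m => if center0 m then g m else 0) = g 0%Z.
Proof.
rewrite zsum_single. reflexivity. intros m Hm. unfold center0.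
now rewrite (proj2 (Z.eqb_neq m 0) Hm).
Qed.

Lemma zsum_center1 g : zsum (fun m => if center1 m then g m else 0) = g 0%Z + g 1%Z + g (-1)%Z.
Proof.
rewrite zsum_triple. reflexivity. intros m Hm. unfold center1.
now rewrite (proj2 (Z.leb_gt _ _) Hm).
Qed.

Section FirstOrder.
Variables (kap a0 s0 r A S B : R) (s al lam : R -> R).
Hypothesis spec : family_spec kap a0 s0 r A S B s al lam.

Lemma s_bound q : Rabs q <= r -> 4 * Rabs (s q) <= A.
Proof.
destruct spec as (Hr & HA & Hq & HS & Hs & _). intros Hqr.
assert (HH := PS_abs _ _ _ _ Hs Hqr). lra.
Qed.

Lemma exp_s_bound m b q : Rabs q <= r -> Rabs b <= 4 * INR (zdeg m) + 4 ->
  exp (b * s q) <= exp ((2 * INR (zdeg m) + 1) * A).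
Proof.
intros Hq Hb. apply exp_le_mono. eapply Rle_trans; [apply Rle_abs|].
apply linear_exponent_bound; auto. now apply s_bound.
Qed.

Lemma exp_s_trig_bound m b q c : Rabs q <= r -> Rabs b <= 4 * INR (zdeg m) + 4 -> Rabs c <= 1 ->
  Rabs (exp (b * s q) * c) <= exp ((2 * INR (zdeg m) + 1) * A).
Proof.
intros Hq Hb Hc. rewrite Rabs_mult, (Rabs_pos_eq (exp _)) by (left; apply exp_pos).
rewrite <- (Rmult_1_r (exp ((2 * INR (zdeg m) + 1) * A))).
apply Rmult_le_compat; auto. left; apply exp_pos. apply Rabs_pos. now apply exp_s_bound.
Qed.

Lemma is_derive_theta_center b c1 c2 c3 :
  is_derive (fun q => c1 + q * exp (b * s q) * c2 + q * exp (- b * s q) * c3) 0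
    (exp (b * s 0) * c2 + exp (- b * s 0) * c3).
Proof.
assert (Hs : ex_derive s 0) by (destruct spec as (Hr & _ & _ & _ & Hs & _); apply (PS_ex_derive r S s Hr Hs)).
auto_derive; auto. rring.
Qed.

Lemma is_derive_N (f : R -> R) t : (forall x, Rabs (f x) <= 1) ->
  is_derive (fun q => zsum (fun m =>
    q ^ sq m * exp (2 * IZR m * s q) * f ((1 - 2 * IZR m * kap) * t))) 0
  (exp (2 * s0) * f ((1 - 2 * kap) * t) + exp (- (2 * s0)) * f ((1 + 2 * kap) * t)).
Proof.
intros Hf. destruct spec as (Hr & HA & Hq & HS & Hs & _ & _ & Hs0 & _).
rewrite <- Hs0. replace (- (2 * s 0)) with (- 2 * s 0) by ring.
eapply is_derive_remainder with (3 := is_derive_theta_center 2 (f t) _ _). exact Hr.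
intros q Hqr.
eapply Rle_trans; [|apply (theta_remainder r A q center1 sq
  (fun m => exp (2 * IZR m * s q) * f ((1 - 2 * IZR m * kap) * t)))]; auto; try lra.
- rewrite zsum_center1. change (sq 0) with 0%nat. change (sq 1) with 1%nat.
  change (sq (-1)) with 1%nat. rewrite pow_O, pow_1. right. f_equal.
  rewrite (zsum_ext _ (fun m => q ^ sq m * (exp (2 * IZR m * s q) * f ((1 - 2 * IZR m * kap) * t))))
    by (intros; ring).
  apply (f_equal (fun z => _ - z)).
  replace (2 * 0 * s q) with 0 by ring. rewrite exp_0.
  replace ((1 - 2 * 0 * kap) * t) with t by ring.
  replace (2 * 1 * s q) with (2 * s q) by ring. replace (2 * -1 * s q) with (- (2) * s q) by ring.
  replace ((1 - 2 * 1 * kap) * t) with ((1 - 2 * kap) * t) by ring.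
  replace ((1 - 2 * -1 * kap) * t) with ((1 + 2 * kap) * t) by ring. ring.
- apply zdeg_sq.
- intros m. apply exp_s_trig_bound; auto. lra. zdeg_lra m.
- apply sq_ge_2.
Qed.

Lemma trig_weight m c : Rabs c <= 1 -> Rabs c <= exp ((2 * INR (zdeg m) + 1) * A).
Proof.
destruct spec as (Hr & HA & _). intros Hc. apply Rle_trans with 1; auto.
apply exp_ge_1, Rmult_le_pos; auto. generalize (pos_INR (zdeg m)); lra.
Qed.

Lemma is_derive_Th t : is_derive (fun q => Th kap q t) 0 (- 2 * cos (2 * kap * t)).
Proof.
destruct spec as (Hr & HA & Hq & HS & Hs & _ & _ & Hs0 & _).
apply is_derive_remainder with (h := fun q => 1 + q * (- 2 * cos (2 * kap * t)))
  (K := 4 * (exp A / r ^ 2)) (delta := r); auto.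
- intros q Hqr.
  assert (HR := theta_remainder r A (- q) center1 sq (fun m => cos (2 * IZR m * kap * t)) Hr HA Hq).
  replace (q ^ 2) with ((- q) ^ 2) by ring.
  eapply Rle_trans; [|apply HR].
  + rewrite zsum_center1. change (sq 0) with 0%nat. change (sq 1) with 1%nat. change (sq (-1)) with 1%nat. rewrite pow_O, pow_1.
    right. apply (f_equal Rabs), (f_equal (fun z => _ - z)).
    replace (2 * 0 * kap * t) with 0 by ring. rewrite cos_0.
    replace (2 * 1 * kap * t) with (2 * kap * t) by ring.
    replace (2 * -1 * kap * t) with (- (2 * kap * t)) by ring. rewrite cos_neg. ring.
  + rewrite Rabs_Ropp; lra.
  + apply zdeg_sq.
  + intros m. apply trig_weight, abs_cos_le.
  + apply sq_ge_2.
- auto_derive; auto; rring.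
Qed.

Lemma Ev_quadratic : exists K, forall q, Rabs q <= r -> Rabs (Ev kap q 0 - 1) <= K * q ^ 2.
Proof.
destruct spec as (Hr & HA & Hq & HS & Hs & _).
exists (4 * (exp A / r ^ 2)). intros q Hqr.
eapply Rle_trans; [|apply (theta_remainder r A q center0 (fun m => 2 * sq m)%nat
   (fun m => cos (2 * IZR m * kap * 0)))]; auto.
- rewrite zsum_center0. simpl. right. do 2 f_equal.
  rewrite Rmult_0_r, cos_0. ring.
- apply pow_zdeg_double, zdeg_sq.
- intros m. apply trig_weight, abs_cos_le.
- apply double_sq_ge_2.
Qed.

Lemma Ud_quadratic : exists K r', 0 < r' <= r /\ forall q, Rabs q <= r' -> Rabs (Ud kap (s q) q - 1) <= K * q ^ 2.
Proof.
destruct spec as (Hr & HA & Hq & HS & Hs & _).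
set (C := 1 + 3 * Rabs kap).
assert (HC : 1 <= C) by (unfold C; generalize (Rabs_pos kap); lra).
(* The linear factor 1 - 2 l kap is absorbed by a larger exponent on a smaller
   disc. *)
set (A' := A + C). set (r' := Rmin r (small_radius A')).
assert (Hr' : 0 < r') by (apply Rmin_glb_lt; auto; apply small_radius_pos).
assert (Hr'r : r' <= r) by apply Rmin_l.
exists (4 * (exp A' / r' ^ 2)), r'. split; [lra|]. intros q Hqr. assert (Hqr1 : Rabs q <= r) by (eapply Rle_trans; [apply Hqr|apply Rmin_l]).
  eapply Rle_trans; [|apply (theta_remainder r' A' q center0 (fun m => 2 * sq m)%nat
   (fun m => exp (4 * IZR m * s q) * (1 - 2 * IZR m * kap)))]; auto.
  - rewrite zsum_center0. right. f_equal. unfold Ud.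
    rewrite (zsum_ext _ (fun m => q ^ (2 * sq m) * (exp (4 * IZR m * s q) * (1 - 2 * IZR m * kap))))
      by (intros; ring).
    f_equal. simpl. replace (4 * 0 * s q) with 0 by ring. rewrite exp_0. ring.
  - unfold A'; lra.
  - apply small_radius_spec, Rmin_r.
  - apply pow_zdeg_double, zdeg_sq.
  - intros m. unfold A'. rewrite Rmult_plus_distr_l, exp_plus, Rabs_mult, (Rabs_pos_eq (exp _)) by (left; apply exp_pos).
    apply Rmult_le_compat. left; apply exp_pos. apply Rabs_pos.
    apply exp_s_bound; auto. zdeg_lra m.
    eapply Rle_trans; [apply frequency_bound0|]. eapply Rle_trans; [|apply exp_ge_id].
    fold C. generalize (pos_INR (zdeg m)); intros; nra.
  - apply double_sq_ge_2.
Qed.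

End FirstOrder.

(** * The deformation of the circle *)

Lemma unit_circle_self_backlund a : 0 < a < PI -> self_backlund unit_circle a (sin a).
Proof.
intros Ha. split; [split|split; [|split; [auto|split]]].
- intros n t. split.
  + apply (diffn_ex_derive_n n cos diffn_cos_1).
  + apply (diffn_ex_derive_n n sin diffn_sin_1).
- intros t. unfold bracket, velocity, unit_circle. simpl fst. simpl snd.
  replace (Derive (fun s => sin s) t) with (cos t).
  replace (Derive (fun s => cos s) t) with (- sin t).
  assert (H := sin2_cos2 t). unfold Rsqr in H. lra.
  symmetry. apply is_derive_unique. auto_derive; auto; rring.
  symmetry. apply is_derive_unique. auto_derive; auto; rring.
- intros t. unfold unit_circle, vscal. simpl. rewrite neg_cos, neg_sin. f_equal; ring.
- apply Rgt_not_eq, sin_gt_0; lra.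
- intros t. unfold bracket, unit_circle. simpl.
  replace a with ((t + a) - t) at 3 by ring. rewrite sin_minus. ring.
Qed.

Section Deformation.
Variables (k : nat) (a0 s0 r A S B : R) (s al lam : R -> R).
Let kap := INR k.
Hypothesis spec : family_spec kap a0 s0 r A S B s al lam.
Hypothesis a0_range : 0 < a0 < PI.

Let gam (t e : R) : vec := theta_curve kap (s e) e (lam e) t.

Let ct (e : R) : R := lam e ^ 2 * (U kap (s e) e (al e) * / Ev kap e (al e)).

Lemma gam_at_0 t : gam t 0 = unit_circle t.
Proof.
destruct spec as (_ & _ & _ & _ & _ & _ & _ & _ & _ & Hl & _).
unfold gam, theta_curve, unit_circle. rewrite N1_at_0, N2_at_0, Th_at_0, Hl, Rinv_1.
f_equal; ring.
Qed.

Lemma theta_analytic_deformation :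
  analytic_deformation unit_circle a0 (sin a0) r gam al ct.
Proof.
assert (spec' := spec).
destruct spec' as (Hr & HA & Hq & HS & Hs & Hal & Hlam & Hs0 & Hal0 & Hl0 & Hfix & HN & HU & HE).
assert (HB : 0 <= B) by (apply (PS_bound_nonneg r B al); auto; lra).
split; [|split; [|split]].
- split; [now apply unit_circle_self_backlund|]. split; [auto|]. split; [|split; [|split]].
  + intros e He.
    destruct (Hfix e (Rlt_le _ _ He)) as (HG & HGf & HE0 & HEal & HT & Hl).
    assert (Hse : 4 * Rabs (s e) <= A) by (apply (s_bound kap a0 s0 r A S B s al lam spec); lra).
    assert (Hqe : Rabs e * exp (2 * A) <= 1/2).
    { apply Rle_trans with (r * exp (2 * A)); auto. apply Rmult_le_compat_r. left; apply exp_pos. lra. }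
    split; [|split].
    * apply (theta_curve_centroaffine kap (s e) e A); auto.
    * apply theta_curve_anti_periodic.
    * intros t. apply (theta_curve_bracket kap (s e) e A); auto.
  + intros t. apply gam_at_0.
  + auto.
  + unfold ct. rewrite Hl0, Hal0, U_at_0, Ev_at_0, Rinv_1. ring.
- assert (Hc : forall F, PS r B F -> forall t, PS r (B * (B * 2)) (fun e => lam e * (F e * / Th kap e t))).
  { intros F HF t. apply PS_mult; auto. lra. apply PS_mult; auto. lra. apply HN. }
  apply PS_analytic_family with (B * (B * 2)); intros t; destruct (HN t) as (HN1 & HN2 & _).
  + exact (Hc _ HN1 t).
  + exact (Hc _ HN2 t).
- now apply PS_analytic with B.
- apply PS_analytic with (B ^ 2 * (B * 2)). apply PS_mult. lra. apply PS_pow; auto; lra.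
  apply PS_mult; auto; lra.
Qed.

(** Ev 0 and Ud are 1 + O(q^2), so the normalisation lam contributes nothing at
    first order. *)
Lemma is_derive_lam : is_derive lam 0 0.
Proof.
assert (spec' := spec).
destruct spec' as (Hr & HA & Hq & HS & Hs & Hal & Hlam & Hs0 & Hal0 & Hl0 & Hfix & HN & HU & HE).
destruct (Ev_quadratic kap a0 s0 r A S B s al lam spec) as [K1 HK1].
destruct (Ud_quadratic kap a0 s0 r A S B s al lam spec) as (K2 & r' & Hr' & HK2).
assert (D1 : is_derive (fun q => Ev kap q 0) 0 0).
{ apply is_derive_remainder with (fun _ => 1) K1 r; auto. intros q Hqr. apply HK1; lra.
  apply (is_derive_const (V := R_NormedModule)). }
assert (D2 : is_derive (fun q => Ud kap (s q) q) 0 0).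
{ apply is_derive_remainder with (fun _ => 1) K2 r'; [lra| |]. intros q Hqr. apply HK2; lra.
  apply (is_derive_const (V := R_NormedModule)). }
assert (D3 := Derive_correct lam 0 (PS_ex_derive r B lam Hr Hlam)).
assert (D4 := is_derive_mult (fun q => lam q ^ 2) (fun q => Ud kap (s q) q) 0 _ _
  (is_derive_pow lam 2 0 _ D3) D2 Rmult_comm).
assert (E : Derive lam 0 = 0).
{ assert (D5 : is_derive (fun q => Ev kap q 0) 0
    (plus (mult (INR 2 * Derive lam 0 * lam 0 ^ 1) (Ud kap (s 0) 0)) (mult (lam 0 ^ 2) 0))).
  { apply is_derive_ext_loc with (2 := D4).
    exists (mkposreal r Hr). intros q Hb. apply Hfix.
    change (Rabs (q - 0) < r) in Hb. rewrite Rminus_0_r in Hb. lra. }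
  apply (is_derive_inj _ _ _ _ D1) in D5.
  unfold plus, mult in D5; simpl in D5. rewrite Ud_at_0, Hl0 in D5. lra. }
rewrite E in D3. exact D3.
Qed.

(** To first order in q, N is e^(i t) (1 + 2 q cos(2 kap t + 2 i s0)) and Th is
    1 - 2 q cos(2 kap t); with tanh s0 = 1/kap the quotient has the form below. *)
Lemma associated_theta t : exp s0 * exp s0 = (kap + 1) / (kap - 1) -> 1 < kap ->
  associated_infinitesimal gam t =
  (4 * kap / (kap ^ 2 - 1) * (kap * cos (2 * kap * t) * cos t + sin (2 * kap * t) * sin t),
   4 * kap / (kap ^ 2 - 1) * (kap * cos (2 * kap * t) * sin t - sin (2 * kap * t) * cos t)).
Proof.
intros Hexp Hk.
assert (Hl0 : lam 0 = 1) by apply spec.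
assert (E1 : exp (2 * s0) = (kap + 1) / (kap - 1)).
{ replace (2 * s0) with (s0 + s0) by ring. now rewrite exp_plus. }
assert (E2 : exp (- (2 * s0)) = (kap - 1) / (kap + 1)).
{ rewrite exp_Ropp, E1. field. lra. }
assert (Hgen : forall F l, is_derive F 0 l ->
  Derive (fun e => lam e * (F e * / Th kap e t)) 0 = l + F 0 * (2 * cos (2 * kap * t))).
{ intros F l HF. apply is_derive_unique.
  assert (DT := is_derive_Th kap a0 s0 r A S B s al lam spec t).
  assert (HT0 : Th kap 0 t = 1) by apply Th_at_0.
  assert (DI := is_derive_inv (fun q => Th kap q t) 0 _ DT).
  cbv beta in DI. rewrite HT0 in DI. specialize (DI R1_neq_R0).
  assert (DF := is_derive_mult F (fun q => / Th kap q t) 0 _ _ HF DI Rmult_comm).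
  assert (DL := is_derive_mult lam (fun q => F q * / Th kap q t) 0 _ _ is_derive_lam DF Rmult_comm).
  match type of DL with is_derive _ _ ?v => replace (l + F 0 * (2 * cos (2 * kap * t))) with v end.
  exact DL. unfold plus, mult; simpl. rewrite HT0, Hl0. field. }
unfold associated_infinitesimal, gam, theta_curve. simpl fst. simpl snd.
rewrite (Hgen (fun q => N1 kap (s q) q t) _ (is_derive_N kap a0 s0 r A S B s al lam spec cos t abs_cos_le)).
rewrite (Hgen (fun q => N2 kap (s q) q t) _ (is_derive_N kap a0 s0 r A S B s al lam spec sin t abs_sin_le)).
rewrite N1_at_0, N2_at_0, E1, E2.
replace ((1 - 2 * kap) * t) with (t - 2 * kap * t) by ring.
replace ((1 + 2 * kap) * t) with (t + 2 * kap * t) by ring.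
rewrite cos_minus, cos_plus, sin_minus, sin_plus.
f_equal; field; repeat split; nra.
Qed.

End Deformation.

(** * Trivial and non-trivial infinitesimal deformations *)

Lemma exp_series_first_order (b : nat -> R) M L : 0 <= M -> 0 <= L ->
  (forall n, Rabs (b n) <= M * L ^ n) ->
  exists K, forall e, Rabs e < 1 ->
    Rabs (Series (fun n => e ^ n / INR (fact n) * b n) - (b 0%nat + e * b 1%nat)) <= K * e ^ 2.
Proof.
intros HM HL Hb.
set (maj := fun n => M * (/ INR (fact n) * L ^ n)).
assert (Hmaj : ex_series maj).
{ apply (ex_series_scal_l (V := R_NormedModule) M). exists (exp L). apply is_series_exp. }
assert (Hmaj2 : ex_series (fun n => maj (2 + n)%nat)).
{ now apply (ex_series_incr_n maj 2). }
exists (Series (fun n => maj (2 + n)%nat)). intros e He.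
assert (He1 : forall n, Rabs (e ^ n) <= 1).
{ intros n. rewrite <- RPow_abs. rewrite <- (pow1 n). apply pow_incr. split. apply Rabs_pos. lra. }
assert (Hterm : forall n, Rabs (/ INR (fact n) * b n) <= maj n).
{ intros n. rewrite Rabs_mult, (Rabs_pos_eq (/ _)) by (left; apply inv_fact_pos).
  unfold maj. replace (M * (/ INR (fact n) * L ^ n)) with (/ INR (fact n) * (M * L ^ n)) by ring.
  apply Rmult_le_compat_l; auto. left; apply inv_fact_pos. }
assert (Hex : ex_series (fun n => e ^ n / INR (fact n) * b n)).
{ apply ex_series_dominated with maj; auto. intros n.
  replace (e ^ n / INR (fact n) * b n) with (e ^ n * (/ INR (fact n) * b n)) by (unfold Rdiv; ring).
  rewrite Rabs_mult. rewrite <- (Rmult_1_l (maj n)).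
  apply Rmult_le_compat; auto; apply Rabs_pos. }
rewrite (Series_incr_n _ 2) by (lia || auto).
simpl pred. simpl sum_f_R0.
replace (1 / 1 * b 0%nat + e * 1 / 1 * b 1%nat +
   Series (fun k => e ^ (2 + k) / INR (fact (2 + k)) * b (2 + k)%nat) - (b 0%nat + e * b 1%nat))
  with (Series (fun k => e ^ (2 + k) / INR (fact (2 + k)) * b (2 + k)%nat)) by field.
rewrite Rmult_comm, <- Series_scal_l. apply series_abs_le.
- intros n.
  replace (e ^ (2 + n) / INR (fact (2 + n)) * b (2 + n)%nat) with
    (e ^ 2 * (e ^ n * (/ INR (fact (2 + n)) * b (2 + n)%nat))) by (rewrite pow_add; unfold Rdiv; ring).
  rewrite Rabs_mult, (Rabs_pos_eq (e ^ 2)) by apply pow2_ge_0.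
  apply Rmult_le_compat_l. apply pow2_ge_0.
  rewrite Rabs_mult. rewrite <- (Rmult_1_l (maj (2 + n)%nat)).
  apply Rmult_le_compat; auto; apply Rabs_pos.
- now apply (ex_series_scal_l (V := R_NormedModule) (e ^ 2)).
Qed.

Lemma mact_iter_bound A v : exists M L, 0 <= M /\ 0 <= L /\
  forall n, Rabs (fst (Nat.iter n (mact A) v)) <= M * L ^ n /\
            Rabs (snd (Nat.iter n (mact A) v)) <= M * L ^ n.
Proof.
set (L := Rabs (m00 A) + Rabs (m01 A) + Rabs (m10 A) + Rabs (m11 A)).
set (M := Rabs (fst v) + Rabs (snd v)).
assert (P := Rabs_pos). 
assert (HL : 0 <= L) by (unfold L; generalize (P (m00 A)) (P (m01 A)) (P (m10 A)) (P (m11 A)); lra).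
assert (HM : 0 <= M) by (unfold M; generalize (P (fst v)) (P (snd v)); lra).
exists M, L. split; auto. split; auto.
induction n as [|n [IH1 IH2]].
- simpl. unfold M. generalize (P (fst v)) (P (snd v)); lra.
- simpl Nat.iter. set (w := Nat.iter n (mact A) v) in *. simpl pow.
  assert (HX : 0 <= M * L ^ n) by (apply Rmult_le_pos; auto; now apply pow_le).
  assert (Hlin : forall a b, Rabs a + Rabs b <= L -> Rabs (a * fst w + b * snd w) <= M * (L * L ^ n)).
  { intros a b Hab. eapply Rle_trans; [apply Rabs_triang|]. rewrite !Rabs_mult.
    apply Rle_trans with ((Rabs a + Rabs b) * (M * L ^ n)).
    - generalize (P a) (P b); intros. nra.
    - replace (M * (L * L ^ n)) with (L * (M * L ^ n)) by ring. now apply Rmult_le_compat_r. }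
  split; simpl; apply Hlin; unfold L; generalize (P (m00 A)) (P (m01 A)) (P (m10 A)) (P (m11 A)); lra.
Qed.

Lemma exp_act_first_order A v : exists K,
  forall e, Rabs e < 1 ->
   Rabs (fst (exp_act e A v) - (fst v + e * fst (mact A v))) <= K * e ^ 2 /\
   Rabs (snd (exp_act e A v) - (snd v + e * snd (mact A v))) <= K * e ^ 2.
Proof.
destruct (mact_iter_bound A v) as (M & L & HM & HL & Hb).
destruct (exp_series_first_order (fun n => fst (Nat.iter n (mact A) v)) M L) as [K1 H1]; auto.
{ intros n; apply Hb. }
destruct (exp_series_first_order (fun n => snd (Nat.iter n (mact A) v)) M L) as [K2 H2]; auto.
{ intros n; apply Hb. }
exists (Rmax K1 K2). intros e He. split.
- eapply Rle_trans; [apply (H1 e He)|]. apply Rmult_le_compat_r. apply pow2_ge_0. apply Rmax_l.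
- eapply Rle_trans; [apply (H2 e He)|]. apply Rmult_le_compat_r. apply pow2_ge_0. apply Rmax_r.
Qed.

Lemma is_derive_affine a b : is_derive (fun e => a + e * b) 0 b.
Proof. auto_derive; auto; rring. Qed.

Lemma trivial_of_sl2 g g1 A : in_sl2 A -> (forall t, g1 t = mact A (g t)) ->
  trivial_infinitesimal g g1.
Proof.
intros HA Hg. right. exists A. split; auto. intros t.
destruct (exp_act_first_order A (g t)) as [K HK].
split; exists K, 1; (split; [lra|]); intros e He; destruct (HK e He) as [H1 H2];
  unfold first_order, vadd, vscal; simpl fst; simpl snd; rewrite Hg, Rabs_minus_sym; auto.
Qed.

(** For the circle shifts are rotations, so both kinds of trivial deformation
    come from sl_2. *)
Lemma sl2_of_trivial g1 : trivial_infinitesimal unit_circle g1 ->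
  exists A, forall t, g1 t = mact A (unit_circle t).
Proof.
intros [[a Ha]|[A [_ HA]]].
- exists (Mat2 0 (- a) a 0). intros t. destruct (Ha t) as [H1 H2].
  unfold first_order, vadd, vscal, unit_circle in H1, H2. simpl in H1, H2.
  rewrite (surjective_pairing (g1 t)). unfold mact, unit_circle. simpl.
  assert (E1 : fst (g1 t) = - a * sin t).
  { apply (eq_mod_eps2_derive _ _ _ _ H1). apply is_derive_affine.
    auto_derive; auto. rewrite Rmult_0_r, Rplus_0_r. rring. }
  assert (E2 : snd (g1 t) = a * cos t).
  { apply (eq_mod_eps2_derive _ _ _ _ H2). apply is_derive_affine.
    auto_derive; auto. rewrite Rmult_0_r, Rplus_0_r. rring. }
  rewrite E1, E2. f_equal; ring.
- exists A. intros t. destruct (HA t) as [H1 H2].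
  destruct (exp_act_first_order A (unit_circle t)) as [K HK].
  rewrite (surjective_pairing (g1 t)), (surjective_pairing (mact A (unit_circle t))).
  f_equal.
  + apply (eq_mod_eps2_derive _ _ _ _ H1). apply is_derive_affine.
    apply is_derive_remainder with (h := fun e => fst (unit_circle t) + e * fst (mact A (unit_circle t)))
      (K := K) (delta := 1).
    lra. intros e He. apply (HK e He). apply is_derive_affine.
  + apply (eq_mod_eps2_derive _ _ _ _ H2). apply is_derive_affine.
    apply is_derive_remainder with (h := fun e => snd (unit_circle t) + e * snd (mact A (unit_circle t)))
      (K := K) (delta := 1).
    lra. intros e He. apply (HK e He). apply is_derive_affine.
Qed.

Lemma sin_cos_k_PI k : sin (INR k * PI) = 0 /\ (cos (INR k * PI) = 1 \/ cos (INR k * PI) = -1).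
Proof.
induction k as [|k [IH1 IH2]].
- simpl. rewrite Rmult_0_l, sin_0, cos_0. auto.
- rewrite S_INR, Rmult_plus_distr_r, Rmult_1_l, neg_sin, neg_cos, IH1. split. ring.
  destruct IH2 as [->| ->]; [right|left]; ring.
Qed.

Lemma trig_2k_period k t : sin (2 * INR k * (t + PI)) = sin (2 * INR k * t) /\
  cos (2 * INR k * (t + PI)) = cos (2 * INR k * t).
Proof.
replace (2 * INR k * (t + PI)) with (2 * INR k * t + 2 * INR k * PI) by ring.
split. apply sin_period. apply cos_period.
Qed.

(** The infinitesimal deformation kap cos(2 kap t) g - sin(2 kap t) g' of the
    circle g, up to the factor C. *)
Definition mode (C kap : R) : curve := fun t =>
  (C * (kap * cos (2 * kap * t) * cos t + sin (2 * kap * t) * sin t),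
   C * (kap * cos (2 * kap * t) * sin t - sin (2 * kap * t) * cos t)).

Lemma mode_smooth C kap : smooth (mode C kap).
Proof.
assert (H1 := diffn_cos_1). assert (H2 := diffn_sin_1).
assert (H4 := fun n => diffn_sin n (2 * kap)). assert (H5 := fun n => diffn_cos n (2 * kap)).
intros n t. split; apply diffn_ex_derive_n; intros m; simpl.
- apply diffn_mult. apply diffn_const. apply diffn_plus; repeat apply diffn_mult; auto. apply diffn_const.
- replace (fun s => C * (kap * cos (2 * kap * s) * sin s - sin (2 * kap * s) * cos s)) with
    (fun s => C * (kap * cos (2 * kap * s) * sin s + (-1) * (sin (2 * kap * s) * cos s))).
  apply diffn_mult. apply diffn_const. apply diffn_plus; repeat apply diffn_mult; auto; apply diffn_const.
  apply functional_extensionality; intros s. ring.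
Qed.

Lemma quadratic_eq_mod f h c : (forall e, f e - h e = e ^ 2 * c) -> eq_mod_eps2 f h.
Proof.
intros H. exists (Rabs c), 1. split. lra. intros e _.
rewrite H, Rabs_mult, (Rabs_pos_eq (e ^ 2)) by apply pow2_ge_0. right; ring.
Qed.

Lemma sin2_cos2_mult x : sin x * sin x = 1 - cos x * cos x.
Proof. generalize (sin2_cos2 x); unfold Rsqr; lra. Qed.

(** The bracket condition is linear in the field and, by sum-to-product formulas, is
    a multiple of the difference of the two sides of the hypothesis on a. *)
Lemma mode_infinitesimal C k a : 0 < a < PI ->
  cos a * sin (INR k * a) = INR k * sin a * cos (INR k * a) ->
  infinitesimal_deformation unit_circle a (sin a) (mode C (INR k)).
Proof.
intros Ha Heq. set (kap := INR k) in *.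
split; [now apply unit_circle_self_backlund|]. split; [apply mode_smooth|].
exists 0, 0. intros t. split; [|split].
- destruct (trig_2k_period k t) as [E1 E2]. fold kap in E1, E2.
  split; apply quadratic_eq_mod with 0; intros e;
    unfold first_order, vadd, vscal, unit_circle, mode; simpl fst; simpl snd;
    rewrite E1, E2, neg_sin, neg_cos; ring.
- set (x' := C * (- 2 * kap ^ 2 * sin (2 * kap * t) * cos t - kap * cos (2 * kap * t) * sin t +
     2 * kap * cos (2 * kap * t) * sin t + sin (2 * kap * t) * cos t)).
  set (y' := C * (- 2 * kap ^ 2 * sin (2 * kap * t) * sin t + kap * cos (2 * kap * t) * cos t -
     2 * kap * cos (2 * kap * t) * cos t + sin (2 * kap * t) * sin t)).
  apply quadratic_eq_mod with (bracket (mode C kap t) (x', y')). intros e.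
  assert (V1 : Derive (fun s => fst (first_order unit_circle (mode C kap) e s)) t = - sin t + e * x').
  { apply is_derive_unique. unfold first_order, vadd, vscal, unit_circle, mode. simpl fst.
    auto_derive; auto. unfold x'. rring. }
  assert (V2 : Derive (fun s => snd (first_order unit_circle (mode C kap) e s)) t = cos t + e * y').
  { apply is_derive_unique. unfold first_order, vadd, vscal, unit_circle, mode. simpl snd.
    auto_derive; auto. unfold y'. rring. }
  unfold velocity. rewrite V1, V2. unfold bracket, first_order, vadd, vscal, unit_circle, mode.
  simpl fst. simpl snd.
  match goal with |- _ = ?r => transitivity (sin t * sin t + cos t * cos t - 1 + r) end.
  unfold x', y'. ring. rewrite (sin2_cos2_mult t). ring.
- apply quadratic_eq_mod with (bracket (mode C kap t) (mode C kap (t + a))). intros e.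
  rewrite Rmult_0_r, Rplus_0_r.
  assert (Hlin : bracket (unit_circle t) (mode C kap (t + a)) + bracket (mode C kap t) (unit_circle (t + a)) = 0).
  { unfold bracket, unit_circle, mode. simpl fst. simpl snd.
    assert (Ea : sin (t + a) * cos t - cos (t + a) * sin t = sin a).
    { rewrite <- sin_minus. f_equal; ring. }
    assert (Eb : cos (t + a) * cos t + sin (t + a) * sin t = cos a).
    { rewrite <- cos_minus. f_equal; ring. }
    assert (Ec : cos (2 * kap * (t + a)) + cos (2 * kap * t) = 2 * cos (2 * kap * t + kap * a) * cos (kap * a)).
    { replace (2 * kap * (t + a)) with ((2 * kap * t + kap * a) + kap * a) by ring.
      replace (2 * kap * t) with ((2 * kap * t + kap * a) - kap * a) at 2 by ring.
      rewrite cos_plus, cos_minus. ring. }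
    assert (Ed : sin (2 * kap * (t + a)) - sin (2 * kap * t) = 2 * cos (2 * kap * t + kap * a) * sin (kap * a)).
    { replace (2 * kap * (t + a)) with ((2 * kap * t + kap * a) + kap * a) by ring.
      replace (2 * kap * t) with ((2 * kap * t + kap * a) - kap * a) at 2 by ring.
      rewrite sin_plus, sin_minus. ring. }
    transitivity (C * (kap * (sin (t + a) * cos t - cos (t + a) * sin t) * (cos (2 * kap * (t + a)) + cos (2 * kap * t))
      - (cos (t + a) * cos t + sin (t + a) * sin t) * (sin (2 * kap * (t + a)) - sin (2 * kap * t)))). ring.
    rewrite Ea, Eb, Ec, Ed.
    transitivity (2 * C * cos (2 * kap * t + kap * a) * (kap * sin a * cos (kap * a) - cos a * sin (kap * a))). ring.
    rewrite Heq. ring. }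
  assert (H0 : bracket (unit_circle t) (unit_circle (t + a)) = sin a).
  { apply unit_circle_self_backlund. auto. }
  rewrite <- H0. transitivity (e * (bracket (unit_circle t) (mode C kap (t + a)) +
    bracket (mode C kap t) (unit_circle (t + a))) + e ^ 2 * bracket (mode C kap t) (mode C kap (t + a))).
  2: rewrite Hlin; ring. unfold bracket, first_order, vadd, vscal. simpl fst. simpl snd. ring.
Qed.

(** The gamma'-component [g, g1] is a quadratic form in (cos t, sin t) for an
    sl_2-deformation, and a multiple of sin (2 k t) here. *)
Lemma mode_nontrivial C k : (2 <= k)%nat -> C <> 0 -> ~ trivial_infinitesimal unit_circle (mode C (INR k)).
Proof.
intros Hk HC HT. destruct (sl2_of_trivial _ HT) as [A HA].
set (kap := INR k) in *.
assert (Hkap : 2 <= kap) by (apply (le_INR 2 k Hk)).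
assert (HQ : forall t, m10 A * cos t * cos t - m01 A * sin t * sin t + (m11 A - m00 A) * sin t * cos t =
    - C * sin (2 * kap * t)).
{ intros t. assert (H := f_equal (bracket (unit_circle t)) (HA t)).
  unfold bracket, mact, mode, unit_circle in H. simpl in H.
  transitivity (cos t * (m10 A * cos t + m11 A * sin t) - sin t * (m00 A * cos t + m01 A * sin t)). ring.
  rewrite <- H. transitivity (- C * sin (2 * kap * t) * (sin t * sin t + cos t * cos t)). ring.
  rewrite (sin2_cos2_mult t). ring. }
assert (Hpi := PI_RGT_0).
assert (E0 : m10 A = 0).
{ specialize (HQ 0). replace (2 * kap * 0) with 0 in HQ by ring. rewrite sin_0, cos_0 in HQ. lra. }
assert (E1 : m01 A = 0).
{ specialize (HQ (PI / 2)). rewrite sin_PI2, cos_PI2 in HQ.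
  replace (2 * kap * (PI / 2)) with (kap * PI) in HQ by field.
  unfold kap in HQ. rewrite (proj1 (sin_cos_k_PI k)) in HQ. lra. }
assert (Hx : 0 < PI / (2 * kap) /\ PI / (2 * kap) < PI / 2).
{ split. apply Rdiv_lt_0_compat; lra.
  unfold Rdiv. apply Rmult_lt_compat_l; auto. apply Rinv_lt_contravar; nra. }
assert (E2 : m11 A - m00 A = 0).
{ specialize (HQ (PI / (2 * kap))).
  replace (2 * kap * (PI / (2 * kap))) with PI in HQ by (field; lra).
  rewrite sin_PI, E0, E1 in HQ.
  assert (Hs : 0 < sin (PI / (2 * kap))) by (apply sin_gt_0; lra).
  assert (Hc : 0 < cos (PI / (2 * kap))) by (apply cos_gt_0; lra).
  assert (Hsc : sin (PI / (2 * kap)) * cos (PI / (2 * kap)) <> 0).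
  { apply Rgt_not_eq, Rmult_lt_0_compat; auto. }
  apply Rmult_eq_reg_r with (2 := Hsc). lra. }
specialize (HQ (PI / (4 * kap))).
replace (2 * kap * (PI / (4 * kap))) with (PI / 2) in HQ by (field; lra).
rewrite sin_PI2, E0, E1, E2 in HQ. lra.
Qed.

(** * Fourier uniqueness *)

Definition period_int (f : R -> R) : R := RInt f 0 PI.
Definition cont (f : R -> R) : Prop := forall t, continuous f t.
Definition per (f : R -> R) : Prop := forall t, f (t + PI) = f t.

Lemma cont_ex_RInt f a b : cont f -> ex_RInt f a b.
Proof. intros H. apply (ex_RInt_continuous (V := R_CompleteNormedModule)). intros z _; apply H. Qed.

Lemma cont_plus f g : cont f -> cont g -> cont (fun t => f t + g t).
Proof. intros Hf Hg t. apply (continuous_plus (V := R_NormedModule)); auto. Qed.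

Lemma cont_mult f g : cont f -> cont g -> cont (fun t => f t * g t).
Proof. intros Hf Hg t. apply (continuous_mult (K := R_AbsRing)); auto. Qed.

Lemma cont_const c : cont (fun _ => c).
Proof. intros t. apply continuous_const. Qed.

Lemma ex_derive_cont f : (forall t, ex_derive f t) -> cont f.
Proof. intros H t. apply (ex_derive_continuous (V := R_NormedModule)), H. Qed.

Lemma cont_cos w ph : cont (fun t => cos (w * t + ph)).
Proof. apply ex_derive_cont. intros t. auto_derive; auto. Qed.

Lemma cont_shift f h : cont f -> cont (fun t => f (t + h)).
Proof.
intros Hf t. apply (continuous_comp (fun t => t + h) f); auto.
apply ex_derive_cont. intros u; auto_derive; auto.
Qed.

Lemma period_int_plus f g : cont f -> cont g -> period_int (fun t => f t + g t) = period_int f + period_int g.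
Proof.
intros Hf Hg. apply (RInt_plus (V := R_CompleteNormedModule)); now apply cont_ex_RInt.
Qed.

Lemma period_int_scal c f : cont f -> period_int (fun t => c * f t) = c * period_int f.
Proof. intros Hf. apply (RInt_scal (V := R_CompleteNormedModule)). now apply cont_ex_RInt. Qed.

Lemma period_int_ext f g : (forall t, f t = g t) -> period_int f = period_int g.
Proof. intros H. apply RInt_ext. auto. Qed.

Ltac prove_cont := lazymatch goal with
  | |- cont (fun _ => ?c) => apply cont_const
  | |- cont (fun t => @?f t + @?g t) => apply (cont_plus f g); prove_cont
  | |- cont (fun t => @?f t * @?g t) => apply (cont_mult f g); prove_cont
  | |- cont (fun t => cos (_ * t + _)) => apply cont_cos
  | |- cont (fun t => ?f (t + _)) => apply (cont_shift f); prove_cont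
  | _ => solve [auto]
  end.

(** The integral over a full period does not see translations: the integral
    over [h, h + PI] splits at PI and its second part moves back by a period. *)
Lemma period_int_shift f h : cont f -> per f -> period_int (fun t => f (t + h)) = period_int f.
Proof.
intros Hf Hp.
assert (E : forall a b c, RInt (fun t => f (t + c)) a b = RInt f (a + c) (b + c)).
{ intros a b c.
  replace (a + c) with (1 * a + c) by ring. replace (b + c) with (1 * b + c) by ring.
  rewrite <- (RInt_comp_lin (V := R_CompleteNormedModule) f 1 c a b).
  - apply RInt_ext. intros x _. unfold scal; simpl; unfold mult; simpl.
    rewrite !Rmult_1_l. reflexivity.
  - now apply cont_ex_RInt. }
unfold period_int. rewrite E.
assert (H1 := RInt_Chasles (V := R_CompleteNormedModule) f (0 + h) PI (PI + h)
  (cont_ex_RInt f _ _ Hf) (cont_ex_RInt f _ _ Hf)).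
assert (H2 := RInt_Chasles (V := R_CompleteNormedModule) f 0 (0 + h) PI
  (cont_ex_RInt f _ _ Hf) (cont_ex_RInt f _ _ Hf)).
rewrite <- H1, <- H2.
assert (H3 : RInt f PI (PI + h) = RInt f 0 (0 + h)).
{ transitivity (RInt f (0 + PI) (h + PI)). f_equal; ring.
  rewrite <- E, Rplus_0_l. apply RInt_ext. auto. }
rewrite H3. apply Rplus_comm.
Qed.

Lemma period_int_derivative F f : (forall t, is_derive F t (f t)) -> cont f -> per F -> period_int f = 0.
Proof.
intros HF Hf Hp. apply is_RInt_unique.
replace 0 with (minus (F PI) (F 0)) at 2.
- apply (is_RInt_derive F f); auto.
- rewrite <- (Rplus_0_l PI), Hp. unfold minus, plus, opp; simpl. ring.
Qed.

Lemma period_int_parts v v' f f' :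
  (forall t, is_derive v t (v' t)) -> (forall t, is_derive f t (f' t)) ->
  cont v' -> cont f' -> per v -> per f ->
  period_int (fun t => v' t * f t) = - period_int (fun t => v t * f' t).
Proof.
intros Hv Hf Cv' Cf' Pv Pf.
assert (Cv : cont v) by (apply ex_derive_cont; intros t; eexists; apply Hv).
assert (Cf : cont f) by (apply ex_derive_cont; intros t; eexists; apply Hf).
assert (H : period_int (fun t => v' t * f t + v t * f' t) = 0).
{ apply period_int_derivative with (fun t => v t * f t).
  - intros t. apply (is_derive_mult v f); auto. intros; apply Rmult_comm.
  - prove_cont.
  - intros t. now rewrite Pv, Pf. }
rewrite period_int_plus in H by prove_cont. lra.
Qed.

Lemma cos_2k_per (k : Z) ph : per (fun t => cos (2 * IZR k * t + ph)).
Proof.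
intros t. destruct (Z_le_gt_dec 0 k) as [Hz|Hz].
- replace (2 * IZR k * (t + PI) + ph) with ((2 * IZR k * t + ph) + 2 * INR (Z.to_nat k) * PI).
  apply cos_period. rewrite INR_IZR_INZ, Z2Nat.id by lia. ring.
- replace (2 * IZR k * t + ph) with ((2 * IZR k * (t + PI) + ph) + 2 * INR (Z.to_nat (- k)) * PI).
  symmetry. apply cos_period. rewrite INR_IZR_INZ, Z2Nat.id, opp_IZR by lia. ring.
Qed.

Lemma period_int_cos (k : Z) ph : k <> 0%Z -> period_int (fun t => cos (2 * IZR k * t + ph)) = 0.
Proof.
intros Hk. assert (Hk' : IZR k <> 0) by (now apply not_0_IZR).
apply period_int_derivative with (fun t => / (2 * IZR k) * cos (2 * IZR k * t + (ph - PI / 2))).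
- intros t. auto_derive; auto.
  replace (2 * IZR k * t + (ph - PI / 2)) with (- (PI / 2 - (2 * IZR k * t + ph))) by ring.
  rewrite sin_neg, sin_shift. field. auto.
- apply cont_cos.
- intros t. f_equal. apply cos_2k_per.
Qed.

Lemma period_int_cos_0 ph : period_int (fun t => cos (2 * IZR 0 * t + ph)) = PI * cos ph.
Proof.
rewrite (period_int_ext _ (fun _ => cos ph)).
- unfold period_int. rewrite RInt_const. unfold scal; simpl; unfold mult; simpl. ring.
- intros t. f_equal. ring.
Qed.

Definition orthogonal_to_all (w : R -> R) : Prop :=
  forall (k : Z) ph, period_int (fun t => w t * cos (2 * IZR k * t + ph)) = 0.

(** Completeness of the trigonometric system: all powers of a trigonometric
    polynomial larger than 1 only near t0 are orthogonal to w, while their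
    integrals against w blow up if w is positive at t0. *)
Lemma orthogonal_nonpos w : cont w -> per w -> orthogonal_to_all w -> forall t0, w t0 <= 0.
Proof.
intros Cw Pw Ow t0. apply Rnot_lt_le. intros Hpos.
set (W := fun t => w (t + (t0 - PI / 2))).
assert (CW : cont W) by now apply cont_shift.
assert (HW0 : W (PI / 2) = w t0) by (unfold W; f_equal; ring).
set (m := w t0 / 2).
assert (Hm : 0 < m) by (unfold m; lra).
destruct (proj1 (continuity_pt_locally W (PI / 2)) (proj2 (continuity_pt_filterlim W (PI / 2)) (CW (PI / 2))) (mkposreal m Hm)) as [d0 Hd0].
simpl in Hd0. assert (Hpi := PI_RGT_0).
set (d := Rmin (d0 / 2) (PI / 8)).
assert (Hd : 0 < d) by (apply Rmin_glb_lt; [generalize (cond_pos d0); lra|lra]).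
assert (Hdd : d < d0) by (eapply Rle_lt_trans; [apply Rmin_l|generalize (cond_pos d0); lra]).
assert (Hd8 : d <= PI / 8) by apply Rmin_r.
assert (HWm : forall t, Rabs (t - PI / 2) <= d -> m <= W t).
{ intros t Ht. assert (Hb : Rabs (t - PI / 2) < d0) by lra.
  specialize (Hd0 t Hb). rewrite HW0 in Hd0. apply Rabs_lt_between in Hd0. unfold m in *. lra. }
destruct (continuity_ab_maj (fun t => Rabs (W t)) 0 PI) as [tM [HM _]]. lra.
{ intros c _. apply continuity_pt_filterlim.
  apply (continuous_comp W Rabs). apply CW. apply continuous_Rabs. }
set (M := Rabs (W tM)).
assert (HM0 : 0 <= M) by apply Rabs_pos.
(* With this constant 1 <= Q for |t - PI/2| <= d, and |Q| <= 1 on the rest of the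
   period [0, PI], whose midpoint stands for t0. *)
set (del := 1 - cos (2 * d)).
set (Q := fun t => del - cos (2 * t)).
assert (CQ : cont Q).
{ apply ex_derive_cont. intros t. unfold Q. auto_derive; auto. }
assert (CQn : forall n, cont (fun t => Q t ^ n)).
{ induction n as [|n IH]. apply (cont_const 1). now apply (cont_mult Q (fun t => Q t ^ n)). }
(* Every power of Q is a trigonometric polynomial, so it is orthogonal to W. *)
assert (HQ : forall n (k : Z) ph, period_int (fun t => W t * Q t ^ n * cos (2 * IZR k * t + ph)) = 0).
{ induction n as [|n IH]; intros k ph.
  - rewrite <- (Ow k (ph - 2 * IZR k * (t0 - PI / 2))).
    rewrite <- (period_int_shift (fun t => w t * cos (2 * IZR k * t + (ph - 2 * IZR k * (t0 - PI / 2)))) (t0 - PI / 2)).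
    + apply period_int_ext. intros t. unfold W. simpl. rewrite Rmult_1_r. f_equal. f_equal. ring.
    + prove_cont.
    + intros t. rewrite Pw. f_equal. apply cos_2k_per.
  - assert (C0 : forall (j : Z) x, cont (fun t => W t * Q t ^ n * cos (2 * IZR j * t + x))).
    { intros j x. apply cont_mult; [|apply cont_cos]. now apply cont_mult. }
    rewrite (period_int_ext _ (fun t => del * (W t * Q t ^ n * cos (2 * IZR k * t + ph)) +
      (- (1/2) * (W t * Q t ^ n * cos (2 * IZR (k + 1) * t + ph)) +
       - (1/2) * (W t * Q t ^ n * cos (2 * IZR (k - 1) * t + ph))))).
    + rewrite period_int_plus, period_int_scal, period_int_plus, !period_int_scal, !IH by prove_cont. ring.
    + intros t. rewrite plus_IZR, minus_IZR. simpl pow.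
      replace (2 * (IZR k + 1) * t + ph) with ((2 * IZR k * t + ph) + 2 * t) by ring.
      replace (2 * (IZR k - 1) * t + ph) with ((2 * IZR k * t + ph) - 2 * t) by ring.
      rewrite (cos_plus (2 * IZR k * t + ph)), (cos_minus (2 * IZR k * t + ph)). unfold Q at 1. field. }
assert (HQ0 : forall n, period_int (fun t => W t * Q t ^ n) = 0).
{ intros n. rewrite <- (HQ n 0%Z 0). apply period_int_ext. intros t.
  replace (2 * IZR 0 * t + 0) with 0 by ring. rewrite cos_0; ring. }
set (eta := cos d - cos (2 * d)).
assert (Heta : 0 < eta).
{ unfold eta. assert (cos (2 * d) < cos d); [|lra]. apply cos_decreasing_1; lra. }
assert (Hc2d : 0 < cos (2 * d)) by (apply cos_gt_0; lra).
assert (Hc2d1 : cos (2 * d) <= 1) by apply COS_bound.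
assert (Hcos : forall t x, 0 <= x -> x <= PI -> 0 <= t <= PI ->
   (Rabs (t - PI / 2) <= x / 2 -> - cos (2 * t) >= cos x) /\
   (x / 2 <= Rabs (t - PI / 2) -> - cos (2 * t) <= cos x)).
{ intros t x Hx1 Hx2 Ht.
  assert (E : - cos (2 * t) = cos (2 * Rabs (t - PI / 2))).
  { replace (cos (2 * Rabs (t - PI / 2))) with (cos (2 * (t - PI / 2))).
    replace (2 * (t - PI / 2)) with (2 * t - PI) by field. rewrite cos_minus, cos_PI, sin_PI. ring.
    unfold Rabs. destruct Rcase_abs; auto. rewrite <- cos_neg. f_equal. ring. }
  rewrite E. assert (Hab : 0 <= Rabs (t - PI / 2) <= PI / 2).
  { split. apply Rabs_pos. apply Rabs_le. lra. }
  split; intros H.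
  - apply Rle_ge. destruct (Req_dec (2 * Rabs (t - PI / 2)) x) as [->|Hne]. lra.
    apply cos_decr_1; lra.
  - apply cos_decr_1; lra. }
assert (HQin : forall t, 0 <= t <= PI -> Rabs (t - PI / 2) <= d -> 1 <= Q t).
{ intros t Ht Htd. destruct (Hcos t (2 * d)) as [H _]; try lra.
  unfold Q, del. assert (- cos (2 * t) >= cos (2 * d)) by (apply H; lra). lra. }
assert (HQmid : forall t, 0 <= t <= PI -> Rabs (t - PI / 2) <= d / 2 -> 1 + eta <= Q t).
{ intros t Ht Htd. destruct (Hcos t d) as [H _]; try lra.
  unfold Q, del, eta. assert (- cos (2 * t) >= cos d) by (apply H; lra). lra. }
assert (HQout : forall t, 0 <= t <= PI -> d <= Rabs (t - PI / 2) -> Rabs (Q t) <= 1).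
{ intros t Ht Htd. destruct (Hcos t (2 * d)) as [_ H]; try lra.
  unfold Q, del. assert (- cos (2 * t) <= cos (2 * d)) by (apply H; lra).
  assert (HH := COS_bound (2 * t)). apply Rabs_le. lra. }
assert (Hlow : forall n t, 0 <= t <= PI -> - M <= W t * Q t ^ n).
{ intros n t Ht. destruct (Rle_lt_dec (Rabs (t - PI / 2)) d) as [Hin|Hout].
  - assert (H1 := HWm t Hin). assert (H2 := HQin t Ht Hin).
    assert (0 <= Q t ^ n) by (apply pow_le; lra).
    assert (0 <= W t * Q t ^ n) by (apply Rmult_le_pos; lra). lra.
  - assert (H1 : Rabs (W t * Q t ^ n) <= M * 1).
    { rewrite Rabs_mult. apply Rmult_le_compat; try apply Rabs_pos. now apply HM.
      rewrite <- RPow_abs. rewrite <- (pow1 n). apply pow_incr. split. apply Rabs_pos.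
      apply HQout; auto; lra. }
    apply Rabs_le_between in H1. lra. }
assert (Hmid : forall n t, 0 <= t <= PI -> Rabs (t - PI / 2) <= d / 2 -> m * (1 + INR n * eta) <= W t * Q t ^ n).
{ intros n t Ht Htd. assert (H1 : m <= W t) by (apply HWm; lra). assert (H2 := HQmid t Ht Htd).
  assert (H3 : 1 + INR n * eta <= (1 + eta) ^ n) by (now apply poly).
  assert (H4 : (1 + eta) ^ n <= Q t ^ n) by (apply pow_incr; lra).
  apply Rmult_le_compat; try lra. generalize (pos_INR n); intros; nra. }
assert (Hfin : forall n, m * (1 + INR n * eta) * d <= M * PI).
{ intros n. set (f := fun t => W t * Q t ^ n).
  assert (Cf : cont f) by (apply cont_mult; auto).
  assert (Hint : forall a b c, a <= b -> (forall t, a < t < b -> c <= f t) -> c * (b - a) <= RInt f a b).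
  { intros a b c Hab Hc. replace (c * (b - a)) with (RInt (fun _ => c) a b).
    apply RInt_le; auto. apply ex_RInt_const. now apply cont_ex_RInt.
    rewrite RInt_const. unfold scal; simpl; unfold mult; simpl. ring. }
  set (a := PI / 2 - d / 2). set (b := PI / 2 + d / 2).
  assert (H0 := HQ0 n). fold f in H0. unfold period_int in H0.
  rewrite <- (RInt_Chasles (V := R_CompleteNormedModule) f 0 a PI) in H0 by now apply cont_ex_RInt.
  rewrite <- (RInt_Chasles (V := R_CompleteNormedModule) f a b PI) in H0 by now apply cont_ex_RInt.
  unfold plus in H0; simpl in H0.
  assert (I1 : - M * (a - 0) <= RInt f 0 a).
  { apply Hint. unfold a; lra. intros t Ht. apply Hlow. unfold a in Ht; lra. }
  assert (I2 : m * (1 + INR n * eta) * (b - a) <= RInt f a b).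
  { apply Hint. unfold a, b; lra. intros t Ht. unfold a, b in Ht. apply Hmid. lra. apply Rabs_le. lra. }
  assert (I3 : - M * (PI - b) <= RInt f b PI).
  { apply Hint. unfold b; lra. intros t Ht. apply Hlow. unfold b in Ht; lra. }
  replace (b - a) with d in I2 by (unfold a, b; field).
  assert (M * (a + (PI - b)) <= M * PI) by (apply Rmult_le_compat_l; auto; unfold a, b; lra).
  lra. }
assert (Hmed : 0 < m * eta * d) by (apply Rmult_lt_0_compat; [apply Rmult_lt_0_compat|]; assumption).
destruct (INR_unbounded (M * PI / (m * eta * d))) as [n Hn].
specialize (Hfin n).
assert (HH : M * PI < INR n * (m * eta * d)).
{ apply Rmult_lt_reg_r with (/ (m * eta * d)). now apply Rinv_0_lt_compat.
  rewrite (Rmult_assoc (INR n)), Rinv_r, Rmult_1_r by lra. exact Hn. }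
assert (0 < m * d) by (apply Rmult_lt_0_compat; assumption). nra.
Qed.

Lemma orthogonal_zero w : cont w -> per w -> orthogonal_to_all w -> forall t, w t = 0.
Proof.
intros Cw Pw Ow t. apply Rle_antisym. now apply orthogonal_nonpos.
assert (H : - 1 * w t <= 0); [|lra].
apply (orthogonal_nonpos (fun t => - 1 * w t)).
- prove_cont.
- intros u. now rewrite Pw.
- intros k ph. rewrite (period_int_ext _ (fun t => - 1 * (w t * cos (2 * IZR k * t + ph)))).
  rewrite period_int_scal, Ow by prove_cont. ring. intros; ring.
Qed.

(** Subtracting from v its modes of index 0 and 1 leaves a function orthogonal to
    every mode. *)
Lemma low_frequency v : cont v -> per v ->
  (forall (k : nat) ph, (2 <= k)%nat -> period_int (fun t => v t * cos (2 * INR k * t + ph)) = 0) ->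
  exists a b c, forall t, v t = a + b * cos (2 * t) + c * sin (2 * t).
Proof.
intros Cv Pv Hv. assert (Hpi := PI_RGT_0).
set (F := fun (k : Z) ph => period_int (fun t => v t * cos (2 * IZR k * t + ph))).
set (a := F 0%Z 0 / PI). set (b := 2 * F 1%Z 0 / PI). set (c := 2 * F 1%Z (- (PI / 2)) / PI).
exists a, b, c.
assert (Cc : forall (k : Z) ph, cont (fun t => cos (2 * IZR k * t + ph))) by (intros; apply cont_cos).
assert (Fsplit : forall k ph, F k ph = cos ph * F k 0 + sin ph * F k (- (PI / 2)) * - 1).
{ intros k ph. unfold F.
  rewrite (period_int_ext _ (fun t => cos ph * (v t * cos (2 * IZR k * t + 0)) +
     (sin ph * - 1) * (v t * cos (2 * IZR k * t + - (PI / 2))))).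
  - rewrite period_int_plus, !period_int_scal by prove_cont. ring.
  - intros t. rewrite Rplus_0_r, cos_plus.
    replace (2 * IZR k * t + - (PI / 2)) with (- (PI / 2 - 2 * IZR k * t)) by ring.
    rewrite cos_neg, cos_shift. ring. }
assert (Fneg : forall k ph, F (- k)%Z ph = F k (- ph)).
{ intros k ph. apply period_int_ext. intros t. f_equal. rewrite opp_IZR, <- cos_neg. f_equal. ring. }
set (w := fun t => v t + (- a + (- b * cos (2 * IZR 1 * t + 0) + - c * cos (2 * IZR 1 * t + - (PI / 2))))).
assert (Cw : cont w).
{ unfold w. prove_cont. }
assert (Pw : per w).
{ intros t. unfold w. rewrite Pv. rewrite !(cos_2k_per 1 _ t). reflexivity. }
assert (Hprod : forall (j k : Z) x y, period_int (fun t => cos (2 * IZR j * t + x) * cos (2 * IZR k * t + y)) =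
   1/2 * period_int (fun t => cos (2 * IZR (k + j) * t + (y + x))) + 1/2 * period_int (fun t => cos (2 * IZR (k - j) * t + (y - x)))).
{ intros j k x y. rewrite <- !period_int_scal, <- period_int_plus by prove_cont.
  apply period_int_ext. intros t. rewrite plus_IZR, minus_IZR.
  replace (2 * (IZR k + IZR j) * t + (y + x)) with ((2 * IZR k * t + y) + (2 * IZR j * t + x)) by ring.
  replace (2 * (IZR k - IZR j) * t + (y - x)) with ((2 * IZR k * t + y) - (2 * IZR j * t + x)) by ring.
  rewrite (cos_plus (2 * IZR k * t + y)), (cos_minus (2 * IZR k * t + y)). field. }
assert (Ow : orthogonal_to_all w).
{ assert (Hw : forall (k : Z) ph, period_int (fun t => w t * cos (2 * IZR k * t + ph)) =
    F k ph + (- a * period_int (fun t => cos (2 * IZR k * t + ph)) +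
    (- b * period_int (fun t => cos (2 * IZR 1 * t + 0) * cos (2 * IZR k * t + ph)) +
     - c * period_int (fun t => cos (2 * IZR 1 * t + - (PI / 2)) * cos (2 * IZR k * t + ph))))).
  { intros k ph. unfold F. rewrite <- !period_int_scal, <- !period_int_plus by prove_cont.
    apply period_int_ext. intros t. unfold w. ring. }
  assert (Hnat : forall (k : nat) ph, period_int (fun t => w t * cos (2 * IZR (Z.of_nat k) * t + ph)) = 0).
  { intros k ph. rewrite Hw, !Hprod. destruct k as [|[|k]].
    - simpl Z.of_nat. rewrite Fsplit, period_int_cos_0.
      rewrite !(period_int_cos (0 + 1)), !(period_int_cos (0 - 1)) by lia.
      replace (F 0%Z (- (PI / 2))) with 0.
      unfold a. field. lra.
      unfold F. symmetry. rewrite (period_int_ext _ (fun t => 0 * v t)). rewrite period_int_scal; auto; ring.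
      intros t. replace (2 * IZR 0 * t + - (PI / 2)) with (- (PI / 2)) by ring.
      rewrite cos_neg, cos_PI2. ring.
    - change (Z.of_nat 1) with 1%Z. rewrite (Fsplit 1%Z ph), (period_int_cos 1) by lia.
      rewrite !(period_int_cos (1 + 1)) by lia. change (1 - 1)%Z with 0%Z. rewrite !period_int_cos_0.
      replace (ph - - (PI / 2)) with (PI / 2 + ph) by ring.
      rewrite Rminus_0_r. replace (cos (PI / 2 + ph)) with (- sin ph).
      unfold b, c. field. lra.
      rewrite (sin_cos ph). ring.
    - unfold F. rewrite <- INR_IZR_INZ, Hv by lia.
      rewrite INR_IZR_INZ. rewrite !period_int_cos by lia. ring. }
  intros k ph. destruct (Z_le_gt_dec 0 k) as [Hk|Hk].
  - rewrite <- (Z2Nat.id k Hk). apply Hnat.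
  - rewrite <- (Hnat (Z.to_nat (- k)) (- ph)). apply period_int_ext. intros t. f_equal.
    rewrite Z2Nat.id, opp_IZR, <- cos_neg by lia. f_equal. ring. }
intros t. assert (H := orthogonal_zero w Cw Pw Ow t). unfold w in H.
replace (2 * IZR 1 * t + 0) with (2 * t) in H by ring.
replace (2 * IZR 1 * t + - (PI / 2)) with (- (PI / 2 - 2 * t)) in H by ring.
rewrite cos_neg, cos_shift in H. lra.
Qed.

(** * The equation tan (k alpha) = k tan alpha *)

Lemma cos_odd_half_PI k : Nat.Odd k <-> cos (INR k * (PI / 2)) = 0.
Proof.
destruct (Nat.Even_or_Odd k) as [[j ->]|[j ->]].
- rewrite mult_INR. replace (INR 2 * INR j * (PI / 2)) with (INR j * PI) by (simpl; field).
  split.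
  + intros [i Hi]. lia.
  + intros H. destruct (sin_cos_k_PI j) as [_ [E|E]]; rewrite E in H; lra.
- rewrite plus_INR, mult_INR.
  replace ((INR 2 * INR j + INR 1) * (PI / 2)) with (PI / 2 + INR j * PI) by (simpl; field).
  split; intros _.
  + rewrite cos_plus, cos_PI2, (proj1 (sin_cos_k_PI j)). ring.
  + now exists j.
Qed.

(** Clearing denominators in tan (kap alpha) = kap tan alpha also covers alpha = PI/2
    with kap odd. *)
Definition mode_equation (kap alpha : R) : Prop :=
  cos alpha * sin (kap * alpha) = kap * sin alpha * cos (kap * alpha).

Lemma sin_cos_not_both_0 x : sin x = 0 -> cos x = 0 -> False.
Proof. intros H1 H2. assert (H := sin2_cos2 x). unfold Rsqr in H. rewrite H1, H2 in H. lra. Qed.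

Lemma tan_equation_of_mode k alpha : 0 < alpha < PI -> (2 <= k)%nat ->
  mode_equation (INR k) alpha -> (3 <= k)%nat /\ tan_equation k alpha.
Proof.
intros Ha Hk Heq. unfold mode_equation in Heq.
assert (Hs : 0 < sin alpha) by (apply sin_gt_0; lra).
assert (HkR : 2 <= INR k) by (apply (le_INR 2 k Hk)).
destruct (Req_dec (cos alpha) 0) as [Hc|Hc].
- assert (Hal : alpha = PI / 2).
  { destruct (Rtotal_order alpha (PI / 2)) as [H|[H|H]]; auto; exfalso.
    - assert (0 < cos alpha) by (apply cos_gt_0; lra). lra.
    - assert (cos alpha < 0) by (apply cos_lt_0; lra). lra. }
  rewrite Hc, Rmult_0_l in Heq. symmetry in Heq.
  assert (Hodd : Nat.Odd k).
  { apply cos_odd_half_PI. rewrite <- Hal.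
    apply Rmult_integral in Heq. destruct Heq as [Heq|Heq]; auto.
    apply Rmult_integral in Heq. destruct Heq; lra. }
  split. destruct Hodd as [j Hj]; lia. now right.
- assert (Hck : cos (INR k * alpha) <> 0).
  { intros H0. rewrite H0, Rmult_0_r in Heq. apply Rmult_integral in Heq.
    destruct Heq as [Heq|Heq]; auto. now apply (sin_cos_not_both_0 (INR k * alpha)). }
  split.
  + destruct (Nat.eq_dec k 2) as [->|]; [|lia]. exfalso.
    simpl in Heq. replace ((1 + 1) * alpha) with (2 * alpha) in Heq by ring.
    rewrite sin_2a, cos_2a in Heq.
    assert (E : 2 * sin alpha * (sin alpha * sin alpha) = 0) by lra.
    assert (0 < sin alpha * (sin alpha * sin alpha)) by (repeat apply Rmult_lt_0_compat; auto). lra.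
  + left. split; [auto|split; [auto|]]. unfold tan.
    apply Rmult_eq_reg_r with (cos (INR k * alpha) * cos alpha).
    2:{ now apply Rmult_integral_contrapositive. }
    transitivity (cos alpha * sin (INR k * alpha)). field; auto.
    rewrite Heq. field; auto.
Qed.

Lemma mode_of_tan_equation k alpha : tan_equation k alpha -> mode_equation (INR k) alpha.
Proof.
intros [(Hc & Hck & Ht)|[-> Hodd]]; unfold mode_equation.
- unfold tan in Ht.
  transitivity (sin (INR k * alpha) / cos (INR k * alpha) * (cos (INR k * alpha) * cos alpha)). field; auto.
  rewrite Ht. field; auto.
- rewrite cos_PI2. rewrite (proj1 (cos_odd_half_PI k) Hodd). ring.
Qed.

(** * Infinitesimal deformations *)

(** Reduction of the three first-order conditions to the gamma'-component
    v = [g, g1] of the deformation field and its derivative -2 u. *)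
Lemma infinitesimal_equations alpha c g1 :
  infinitesimal_deformation unit_circle alpha c g1 ->
  exists u v : R -> R, exists C : R,
    (forall t, g1 t = (u t * cos t - v t * sin t, u t * sin t + v t * cos t)) /\
    cont u /\ (forall t, is_derive v t (- 2 * u t)) /\ per v /\
    (forall t, (u t + u (t + alpha)) * sin alpha + (v (t + alpha) - v t) * cos alpha = C).
Proof.
intros (Hb & Hsm & al1 & c1 & H).
set (x := fun t => fst (g1 t)). set (y := fun t => snd (g1 t)).
assert (Hx : forall t, ex_derive x t) by (intros t; apply (Hsm 1%nat t)).
assert (Hy : forall t, ex_derive y t) by (intros t; apply (Hsm 1%nat t)).
set (u := fun t => cos t * x t + sin t * y t). set (v := fun t => cos t * y t - sin t * x t).
exists u, v, (c1 - al1 * cos alpha).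
assert (Hu : forall t, ex_derive u t).
{ intros t. unfold u. auto_derive; auto. }
assert (Hanti : forall t, x (t + PI) = - x t /\ y (t + PI) = - y t).
{ intros t. destruct (H t) as [[H1 H2] _].
  unfold first_order, vadd, vscal, unit_circle in H1, H2. simpl in H1, H2. split.
  - apply (eq_mod_eps2_derive _ _ _ _ H1). apply is_derive_affine.
    unfold x. auto_derive; auto; rring.
  - apply (eq_mod_eps2_derive _ _ _ _ H2). apply is_derive_affine.
    unfold y. auto_derive; auto; rring. }
assert (Hdiv : forall t, cos t * Derive y t - sin t * Derive x t + u t = 0).
{ intros t. destruct (H t) as [_ [H2 _]].
  apply (eq_mod_eps2_derive _ _ _ _ H2).
  2: apply (is_derive_const (V := R_NormedModule)).
  apply is_derive_ext with (fun e => (cos t + e * x t) * (cos t + e * Derive y t) -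
     (sin t + e * y t) * (- sin t + e * Derive x t)).
  - intros e. unfold bracket, velocity, first_order, vadd, vscal, unit_circle. simpl fst. simpl snd.
    assert (E1 : Derive (fun s => cos s + e * fst (g1 s)) t = - sin t + e * Derive x t).
    { apply is_derive_unique. change (is_derive (fun s => cos s + e * x s) t (- sin t + e * Derive x t)).
      auto_derive; auto. change (fun z => x z) with x. rring. }
    assert (E2 : Derive (fun s => sin s + e * snd (g1 s)) t = cos t + e * Derive y t).
    { apply is_derive_unique. change (is_derive (fun s => sin s + e * y s) t (cos t + e * Derive y t)).
      auto_derive; auto. change (fun z => y z) with y. rring. }
    rewrite E1, E2. reflexivity.
  - auto_derive; auto. unfold u. rring. }
split; [|split; [|split; [|split]]].
- intros t. rewrite (surjective_pairing (g1 t)). fold (x t) (y t). unfold u, v.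
  assert (E := sin2_cos2_mult t). f_equal.
  + transitivity (x t * (cos t * cos t + sin t * sin t)). rewrite E; ring. ring.
  + transitivity (y t * (cos t * cos t + sin t * sin t)). rewrite E; ring. ring.
- now apply ex_derive_cont.
- intros t. unfold v. specialize (Hdiv t).
  replace (- 2 * u t) with ((cos t * Derive y t - sin t * Derive x t) - u t) by lra.
  unfold u. auto_derive; auto. change (fun z => x z) with x. change (fun z => y z) with y. rring.
- intros t. unfold v. destruct (Hanti t) as [-> ->]. rewrite neg_sin, neg_cos. ring.
- intros t. destruct (H t) as [_ [_ H3]].
  assert (Hc : is_derive (fun e => c + e * c1) 0 c1) by apply is_derive_affine.
  assert (Hd : (x t * sin (t + alpha) + cos t * (al1 * cos (t + alpha) + y (t + alpha))) -
    (y t * cos (t + alpha) + sin t * (- al1 * sin (t + alpha) + x (t + alpha))) = c1).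
  { apply (eq_mod_eps2_derive _ _ _ _ H3); [|exact Hc].
    unfold bracket, first_order, vadd, vscal, unit_circle. simpl fst. simpl snd.
    change (is_derive (fun e => (cos t + e * x t) * (sin (t + (alpha + e * al1)) + e * y (t + (alpha + e * al1))) -
      (sin t + e * y t) * (cos (t + (alpha + e * al1)) + e * x (t + (alpha + e * al1)))) 0
      (x t * sin (t + alpha) + cos t * (al1 * cos (t + alpha) + y (t + alpha)) -
       (y t * cos (t + alpha) + sin t * (- al1 * sin (t + alpha) + x (t + alpha))))).
    auto_derive.
    * repeat split; auto.
    * rewrite !Rmult_0_l, !Rplus_0_r. rring.
  }
  rewrite <- Hd.
    unfold u, v.
    assert (E := sin2_cos2_mult (t + alpha)).
    assert (Es : sin alpha = sin (t + alpha) * cos t - cos (t + alpha) * sin t).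
    { rewrite <- sin_minus. f_equal; ring. }
    assert (Ec : cos alpha = cos (t + alpha) * cos t + sin (t + alpha) * sin t).
    { rewrite <- cos_minus. f_equal; ring. }
    rewrite Es, Ec.
    generalize (sin2_cos2_mult t). revert E.
    generalize (sin t) (cos t) (sin (t + alpha)) (cos (t + alpha)) (x t) (y t) (x (t + alpha)) (y (t + alpha)).
    intros s0 c0 s1 c2 x0 y0 x1 y1 E E'.
    transitivity ((x0 * s1 - y0 * c2) * (c0 * c0 + s0 * s0) + (c0 * y1 - s0 * x1) * (c2 * c2 + s1 * s1)).
    ring. rewrite E, E'. ring.
Qed.

(** Testing the first-order equation against the mode of index k, centred at the
    midpoint of t and t + alpha, turns it into a scalar equation for each Fourier
    coefficient. *)
Lemma fourier_coefficient_zero (u v : R -> R) C alpha (k : nat) ph :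
  cont u -> (forall t, is_derive v t (- 2 * u t)) -> per v ->
  (forall t, (u t + u (t + alpha)) * sin alpha + (v (t + alpha) - v t) * cos alpha = C) ->
  (2 <= k)%nat -> ~ mode_equation (INR k) alpha ->
  period_int (fun t => v t * cos (2 * INR k * t + ph)) = 0.
Proof.
intros Cu Hv Pv Heq Hk Hne.
assert (Cv : cont v) by (apply ex_derive_cont; intros t; eexists; apply Hv).
assert (Pu : per u).
{ intros t. assert (H1 := Hv (t + PI)).
  assert (H2 : is_derive (fun s => v (s + PI)) t (1 * (- 2 * u (t + PI)))).
  { apply (is_derive_comp v (fun s => s + PI)); auto. auto_derive; auto; rring. }
  assert (H3 := is_derive_ext _ _ _ _ (fun s => Pv s) H2).
  assert (H4 := is_derive_inj _ _ _ _ H3 (Hv t)). lra. }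
set (kap := INR k) in *.
assert (Hkap : 2 <= kap) by (apply (le_INR 2 k Hk)).
assert (HZ : forall t x, 2 * kap * t + x = 2 * IZR (Z.of_nat k) * t + x).
{ intros. unfold kap. now rewrite INR_IZR_INZ. }
assert (Cc : forall x, cont (fun t => cos (2 * kap * t + x))) by (intros; apply cont_cos).
assert (Pc : forall x, per (fun t => cos (2 * kap * t + x))).
{ intros x t. rewrite !HZ. apply cos_2k_per. }
assert (Mc : forall x, period_int (fun t => cos (2 * kap * t + x)) = 0).
{ intros x. rewrite (period_int_ext _ _ (fun t => f_equal cos (HZ t x))). apply period_int_cos. lia. }
(* Integration by parts: u = - v'/2. *)
assert (Hparts : forall x, period_int (fun t => u t * cos (2 * kap * t + x)) =
   kap * period_int (fun t => v t * cos (2 * kap * t + (x + PI / 2)))).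
{ intros x.
  assert (HP := period_int_parts v (fun t => - 2 * u t) (fun t => cos (2 * kap * t + x))
    (fun t => 2 * kap * cos (2 * kap * t + (x + PI / 2)))).
  rewrite (period_int_ext _ (fun t => - 2 * (u t * cos (2 * kap * t + x)))) in HP by (intros; ring).
  rewrite (period_int_ext (fun t => v t * (2 * kap * _)) (fun t => 2 * kap * (v t * cos (2 * kap * t + (x + PI / 2))))) in HP by (intros; ring).
  rewrite !period_int_scal in HP by prove_cont.
  assert (HP' : - 2 * period_int (fun t => u t * cos (2 * kap * t + x)) =
     - (2 * kap * period_int (fun t => v t * cos (2 * kap * t + (x + PI / 2))))).
  { apply HP; auto.
    - intros t. auto_derive; auto. rewrite <- Rplus_assoc, (cos_plus (2 * kap * t + x)), cos_PI2, sin_PI2. rring.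
    - prove_cont.
    - prove_cont. }
  lra. }
assert (Hshift : forall f x, cont f -> per f ->
   period_int (fun t => f (t + alpha) * cos (2 * kap * t + x)) = period_int (fun t => f t * cos (2 * kap * t + (x - 2 * kap * alpha)))).
{ intros f x Cf Pf.
  rewrite <- (period_int_shift (fun t => f t * cos (2 * kap * t + (x - 2 * kap * alpha))) alpha).
  - apply period_int_ext. intros t. do 2 f_equal. ring.
  - prove_cont.
  - intros t. now rewrite Pf, Pc. }
set (J := fun x => period_int (fun t => v t * cos (2 * kap * t + x))).
assert (Hmain : forall x, sin alpha * (kap * J (x + PI / 2) + kap * J (x - 2 * kap * alpha + PI / 2)) +
   cos alpha * (J (x - 2 * kap * alpha) - J x) = 0).
{ intros x.
  assert (HI : period_int (fun t => C * cos (2 * kap * t + x)) = 0) by (rewrite period_int_scal, Mc; auto; ring).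
  rewrite (period_int_ext _ (fun t => sin alpha * (u t * cos (2 * kap * t + x)) +
    (sin alpha * (u (t + alpha) * cos (2 * kap * t + x)) +
    (cos alpha * (v (t + alpha) * cos (2 * kap * t + x)) +
     - cos alpha * (v t * cos (2 * kap * t + x)))))) in HI.
  2:{ intros t. rewrite <- (Heq t). ring. }
  rewrite !period_int_plus, !period_int_scal in HI by prove_cont.
  rewrite !Hshift, !Hparts in HI by auto. unfold J. lra. }
assert (Jsplit : forall x, J x = cos x * J 0 + sin x * J (PI / 2)).
{ intros x. unfold J. rewrite <- !period_int_scal, <- period_int_plus by prove_cont.
  apply period_int_ext. intros t. rewrite Rplus_0_r, (cos_plus (2 * kap * t) (PI / 2)), cos_PI2, sin_PI2, cos_plus. ring. }
fold (J ph).
(* With this phase the two translates of the test function are symmetric about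
   ph, up to a quarter period. *)
assert (HM := Hmain (ph + kap * alpha + PI / 2)).
rewrite (Jsplit (ph + kap * alpha + PI / 2 + PI / 2)), (Jsplit (ph + kap * alpha + PI / 2 - 2 * kap * alpha + PI / 2)),
  (Jsplit (ph + kap * alpha + PI / 2 - 2 * kap * alpha)), (Jsplit (ph + kap * alpha + PI / 2)) in HM.
replace (ph + kap * alpha + PI / 2 + PI / 2) with ((ph + kap * alpha) + PI) in HM by field.
replace (ph + kap * alpha + PI / 2 - 2 * kap * alpha + PI / 2) with ((ph - kap * alpha) + PI) in HM by field.
replace (ph + kap * alpha + PI / 2 - 2 * kap * alpha) with (PI / 2 + (ph - kap * alpha)) in HM by field.
replace (ph + kap * alpha + PI / 2) with (PI / 2 + (ph + kap * alpha)) in HM by field.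
rewrite !neg_cos, !neg_sin, <- !cos_sin in HM.
rewrite (cos_plus (PI / 2)), (cos_plus (PI / 2)), cos_PI2, sin_PI2 in HM.
rewrite (Jsplit ph).
rewrite !cos_plus, !cos_minus, !sin_plus, !sin_minus in HM.
assert (Hfin : (cos alpha * sin (kap * alpha) - kap * sin alpha * cos (kap * alpha)) *
   (cos ph * J 0 + sin ph * J (PI / 2)) = 0) by lra.
apply Rmult_integral in Hfin. destruct Hfin as [Hfin|Hfin]; auto.
exfalso. apply Hne. unfold mode_equation. lra.
Qed.

(** If no mode equation holds, v has no mode of index above 1, and such fields v
    are exactly those of the sl_2-deformations. *)
Lemma exists_mode alpha : 0 < alpha < PI ->
  admits_nontrivial_infinitesimal unit_circle alpha ->
  exists k, (3 <= k)%nat /\ tan_equation k alpha.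
Proof.
intros Ha (c & g1 & Hinf & Hnt). apply NNPP. intros Hno. apply Hnt.
destruct (infinitesimal_equations _ _ _ Hinf) as (u & v & C & Hg1 & Cu & Hv & Pv & Heq).
destruct (low_frequency v) as (a & b & c' & Hlow); auto.
{ apply ex_derive_cont. intros t. eexists; apply Hv. }
{ intros k ph Hk. apply (fourier_coefficient_zero u v C alpha k ph); auto.
  intros Hmode. apply Hno. exists k. now apply tan_equation_of_mode. }
assert (Hu : forall t, u t = b * sin (2 * t) - c' * cos (2 * t)).
{ intros t.
  assert (D : is_derive (fun t => a + b * cos (2 * t) + c' * sin (2 * t)) t
    (- 2 * b * sin (2 * t) + 2 * c' * cos (2 * t))) by (auto_derive; auto; rring).
  assert (D2 := is_derive_ext _ _ _ _ Hlow (Hv t)).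
  assert (E := is_derive_inj _ _ _ _ D D2). lra. }
apply trivial_of_sl2 with (Mat2 (- c') (b - a) (a + b) c').
- unfold in_sl2. simpl. ring.
- intros t. rewrite Hg1, Hu, Hlow. unfold mact, unit_circle. simpl.
  rewrite sin_2a, cos_2a. assert (E := sin2_cos2_mult t).
  f_equal.
  + transitivity ((b * sin t - c' * cos t) * (cos t * cos t + sin t * sin t) - a * sin t). ring. rewrite E. ring.
  + transitivity ((b * cos t + c' * sin t) * (cos t * cos t + sin t * sin t) + a * cos t). ring. rewrite E. ring.
Qed.

(** * Existence of deformations *)

(** Sets up the two implicit-function problems at q = 0; the second one is
    non-degenerate because its derivative is a non-zero multiple of
    sin alpha * sin (k alpha), and sin (k alpha) = 0 is incompatible with the mode
    equation. *)
Lemma exists_deformation alpha k : 0 < alpha < PI -> (3 <= k)%nat -> tan_equation k alpha ->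
  exists (c eps0 : R) (gam : R -> R -> vec) (alphat ct : R -> R),
    analytic_deformation unit_circle alpha c eps0 gam alphat ct /\
    nontrivial_infinitesimal_deformation unit_circle alpha c (associated_infinitesimal gam).
Proof.
intros Ha Hk Htan. assert (Hmode := mode_of_tan_equation k alpha Htan).
set (kap := INR k). assert (Hkap : 3 <= kap).
{ replace 3 with (INR 3) by (simpl; ring). now apply le_INR. }
(* The solution of tanh s0 = 1/kap. *)
set (s0 := / 2 * ln ((kap + 1) / (kap - 1))).
assert (Hratio : 1 < (kap + 1) / (kap - 1)).
{ apply Rmult_lt_reg_r with (kap - 1). lra. unfold Rdiv. rewrite Rmult_assoc, Rinv_l; lra. }
assert (Hexp : exp s0 * exp s0 = (kap + 1) / (kap - 1)).
{ rewrite <- exp_plus. replace (s0 + s0) with (ln ((kap + 1) / (kap - 1))) by (unfold s0; field).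
  apply exp_ln. lra. }
assert (Hs0 : 0 <= s0).
{ unfold s0. 
  assert (0 < ln ((kap + 1) / (kap - 1))). { rewrite <- ln_1. apply ln_increasing; lra. } lra. }
assert (HeX := exp_pos s0).
assert (Hinv : exp (- s0) = exp s0 * ((kap - 1) / (kap + 1))).
{ rewrite exp_Ropp. apply Rmult_eq_reg_l with (exp s0); [|lra]. rewrite Rinv_r, <- Rmult_assoc, Hexp by lra.
  field. lra. }
assert (Hsin : 0 < sin alpha) by (apply sin_gt_0; lra).
assert (Hsk : sin (kap * alpha) <> 0).
{ intros H0. unfold mode_equation in Hmode. fold kap in Hmode. rewrite H0, Rmult_0_r in Hmode.
  symmetry in Hmode. apply Rmult_integral in Hmode. destruct Hmode as [H1|H1].
  apply Rmult_integral in H1. destruct H1; lra.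
  now apply (sin_cos_not_both_0 (kap * alpha)). }
unfold mode_equation in Hmode. fold kap in Hmode.
assert (Hm : forall F : R -> R, F ((1 - kap) * alpha) = F (alpha - kap * alpha)) by (intros F; f_equal; ring).
assert (Hp : forall F : R -> R, F ((1 + kap) * alpha) = F (alpha + kap * alpha)) by (intros F; f_equal; ring).
destruct (family_exists kap alpha s0) as (r & A & S & B & s & al & lam & spec).
- lra.
- auto.
- rewrite Hinv. field. lra.
- rewrite Hinv, (Hm sin), (Hp sin), sin_minus, sin_plus.
  transitivity (exp s0 * 2 / (kap + 1) * (kap * sin alpha * cos (kap * alpha) - cos alpha * sin (kap * alpha))).
  field; lra. rewrite Hmode. ring.
- rewrite Hinv, (Hm cos), (Hp cos), cos_minus, cos_plus.
  replace (exp s0 * ((1 - kap) * (cos alpha * cos (kap * alpha) + sin alpha * sin (kap * alpha))) +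
    exp s0 * ((kap - 1) / (kap + 1)) * ((1 + kap) * (cos alpha * cos (kap * alpha) - sin alpha * sin (kap * alpha))))
   with (exp s0 * (-2) * (kap - 1) * sin alpha * sin (kap * alpha)) by (field; lra).
  repeat apply Rmult_integral_contrapositive_currified; auto; lra.
- exists (sin alpha), r, (fun t e => theta_curve kap (s e) e (lam e) t), al,
    (fun e => lam e ^ 2 * (U kap (s e) e (al e) * / Ev kap e (al e))).
  split.
  + apply (theta_analytic_deformation k alpha s0 r A S B s al lam spec Ha).
  + replace (associated_infinitesimal (fun t e => theta_curve kap (s e) e (lam e) t)) with
      (mode (4 * kap / (kap ^ 2 - 1)) kap).
    * split. now apply mode_infinitesimal.
      apply mode_nontrivial. lia. apply Rgt_not_eq, Rdiv_lt_0_compat; nra.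
    * apply functional_extensionality. intros t.
      symmetry. apply (associated_theta k alpha s0 r A S B s al lam spec t Hexp). fold kap; lra.
Qed.

Theorem corollary4p20 :
  forall alpha : R, 0 < alpha < PI ->
    (admits_nontrivial_infinitesimal unit_circle alpha <->
     exists k : nat, (3 <= k)%nat /\ tan_equation k alpha) /\
    (admits_nontrivial_infinitesimal unit_circle alpha ->
     exists (c eps0 : R) (gam : R -> R -> vec) (alphat ct : R -> R),
       analytic_deformation unit_circle alpha c eps0 gam alphat ct /\
       nontrivial_infinitesimal_deformation unit_circle alpha c
         (associated_infinitesimal gam)).
Proof.
intros alpha Ha. split; [split|].
- now apply exists_mode.
- intros (k & Hk & Ht). destruct (exists_deformation alpha k Ha Hk Ht) as (c & e0 & gam & al & ct & _ & Hn).
  exists c, (associated_infinitesimal gam). exact Hn.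
- intros Hadm. destruct (exists_mode alpha Ha Hadm) as (k & Hk & Ht).
  now apply exists_deformation with k.
Qed.
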